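(* For each $n\ge 1$ let $z_0^n\in\mathbb{R}^n$ and let $Z^n=(Z^n_t)_{t\ge 0}$ be the Ornstein--Uhlenbeck process on $\mathbb{R}^n$ solving $\mathrm{d}Z^n_t=\sqrt{2/n}\,\mathrm{d}B^n_t-Z^n_t\,\mathrm{d}t$, $Z^n_0=z^n_0$, where $B^n$ is a standard $n$-dimensional Brownian motion. Let $P_n^0=\mathcal{N}(0,\frac1n I_n)$ be its invariant law. Let $\mathrm{dist}\in\{\mathrm{TV},\mathrm{Hellinger},\mathrm{Kullback},\chi^2,\mathrm{Fisher}\}$. Then for all $\varepsilon\in(0,1)$, \[ \lim_{n\to\infty}\mathrm{dist}(\mathrm{Law}(Z^n_{t_n})\mid P_n^0)=\begin{cases}\max&\text{if }t_n=(1-\varepsilon)c_n\\ 0&\text{if }t_n=(1+\varepsilon)c_n\end{cases} \] where \[ c_n=\begin{cases}\log(\sqrt n\,|z_0^n|)\vee\frac14\log(n)&\text{if }\mathrm{dist}\in\{\mathrm{TV},\mathrm{Hellinger},\mathrm{Kullback},\chi^2\},\\ \log(n|z_0^n|)\vee\frac12\log(n)&\text{if }\mathrm{dist}=\mathrm{Fisher}.\end{cases} \] Regarding the Wasserstein distance, the following dichotomy occurs: \begin{itemize} \item if $\lim_{n\to\infty}|z_0^n|=+\infty$, then for all $\varepsilon\in(0,1)$, with $c_n=\log|z_0^n|$, \[ \lim_{n\to\infty}\mathrm{Wasserstein}(\mathrm{Law}(Z^n_{t_n}),P_n^0)=\begin{cases}+\infty&\text{if }t_n=(1-\varepsilon)c_n\\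 0&\text{if }t_n=(1+\varepsilon)c_n;\end{cases} \] \item if $\lim_{n\to\infty}|z_0^n|=\alpha\in[0,\infty)$, then there is no cutoff phenomenon, namely for any $t>0$ \[ \lim_{n\to\infty}\mathrm{Wasserstein}^2(\mathrm{Law}(Z^n_t),P_n^0)=\alpha^2\mathrm{e}^{-2t}+2\Bigl(1-\sqrt{1-\mathrm{e}^{-2t}}-\tfrac12\mathrm{e}^{-2t}\Bigr). \] \end{itemize}
   Context: $|\cdot|$ is the Euclidean norm, $a\vee b=\max(a,b)$, and $\log 0=-\infty$. For probability measures $\nu,\mu$ on $\mathbb{R}^n$, $\mathrm{dist}(\nu\mid\mu)$ denotes one of: $\mathrm{Wasserstein}(\nu,\mu)=(\inf\mathbb{E}|X-Y|^2)^{1/2}$, infimum over couplings $X\sim\nu$, $Y\sim\mu$; $\mathrm{TV}$: $\|\nu-\mu\|_{\mathrm{TV}}=\sup_A|\nu(A)-\mu(A)|$; $\mathrm{Hellinger}(\nu,\mu)=(1-\int\sqrt{f_\nu f_\mu}\,\mathrm{d}\lambda)^{1/2}$ where $f_\nu,f_\mu$ are densities with respect to a common reference measure $\lambda$; $\mathrm{Kullback}(\nu\mid\mu)=\int\log\frac{\mathrm{d}\nu}{\mathrm{d}\mu}\,\mathrm{d}\nu$; $\chi^2(\nu\mid\mu)=\int|\frac{\mathrm{d}\nu}{\mathrm{d}\mu}-1|^2\mathrm{d}\mu$; $\mathrm{Fisher}(\nu\mid\mu)=\int|\nabla\log\frac{\mathrm{d}\nu}{\mathrm{d}\mu}|^2\mathrm{d}\nu$;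 the last three are set to $+\infty$ when $\nu$ is not absolutely continuous with respect to $\mu$. The value $\max$ is $1$ if $\mathrm{dist}\in\{\mathrm{TV},\mathrm{Hellinger}\}$ and $+\infty$ if $\mathrm{dist}\in\{\mathrm{Wasserstein},\mathrm{Kullback},\chi^2,\mathrm{Fisher}\}$. *)

(* Defs.v *)
From HB Require Import structures.
From mathcomp Require Import all_boot all_order all_algebra.
From mathcomp Require Import all_classical all_reals all_analysis.

Set Implicit Arguments.
Unset Strict Implicit.
Unset Printing Implicit Defensive.

Import Order.TTheory GRing.Theory Num.Theory.
Import numFieldNormedType.Exports.

Local Open Scope classical_set_scope.
Local Open Scope ring_scope.

(* The library norm on ['rV[R]_n] is the sup norm; it induces the same topology,
   hence the same Borel sets and the same derivatives. *)
Definition enorm (R : realType) (n : nat) (x : 'rV[R]_n) : R :=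
  Num.sqrt (\sum_(i < n) x ord0 i ^+ 2).

(* R^n carries its Borel sigma-algebra. *)
HB.instance Definition _ (R : realType) (n : nat) :=
  Measurable.copy 'rV[R]_n (g_sigma_algebraType (@open 'rV[R]_n)).

(* [nu] is N(m, s^2 I_n), s <> 0: independent coordinates, the i-th one being
   N(m_i, s^2); the values on boxes determine [nu]. *)
Definition is_gaussian (R : realType) (n : nat) (m : 'rV[R]_n) (s : R)
    (nu : set 'rV[R]_n -> \bar R) : Prop :=
  forall A : 'I_n -> set (measurableTypeR R), (forall i, measurable (A i)) ->
    nu [set x : 'rV[R]_n | forall i, A i (x ord0 i)] =
    (\prod_(i < n) normal_prob (m ord0 i) s (A i))%E.

(* The product rule on subfamilies is the case [A i := setT] off the subfamily. *)
Definition mutually_independent (R : realType) d (Omega : measurableType d)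
    (P : probability Omega R) d' (T : measurableType d') (I : finType)
    (X : I -> Omega -> T) : Prop :=
  forall A : I -> set T, (forall i, measurable (A i)) ->
    P [set w | forall i, A i (X i w)] = (\prod_(i : I) P (X i @^-1` A i))%E.

(* Processes are indexed by the whole of R, but only the times t >= 0 are
   constrained. *)
Record brownian_motion (R : realType) d (Omega : measurableType d)
    (P : probability Omega R) (n : nat) (B : R -> {RV P >-> 'rV[R]_n}) : Prop :=
  BrownianMotion {
    bm_start : {ae P, forall w, B 0 w = 0} ;
    bm_independent_increments : forall (k : nat) (t : nat -> R),
      0 <= t 0%N -> {homo t : i j / (i < j)%N >-> i < j} ->
      mutually_independent P (fun (i : 'I_k) w => B (t i.+1) w - B (t i) w) ;
    bm_gaussian_increments : forall s t : R, 0 <= s -> s < t ->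
      is_gaussian 0 (Num.sqrt (t - s)) (pushforward P (fun w => B t w - B s w)) ;
    bm_continuous :
      {ae P, forall w, {within `[0, +oo[, continuous (fun t : R => B t w)}}
  }.

(* Z solves dZ_t = sigma dB_t - Z_t dt, Z_0 = z0, in integral form. As sigma is
   a constant, the stochastic integral is sigma (B_t - B_0), and B_0 = 0. *)
Definition ou_solution (R : realType) d (Omega : measurableType d)
    (P : probability Omega R) (n : nat) (sigma : R) (z0 : 'rV[R]_n)
    (B Z : R -> {RV P >-> 'rV[R]_n}) : Prop :=
  {ae P, forall w,
    {within `[0, +oo[, continuous (fun t : R => Z t w)} /\
    forall t : R, 0 <= t -> forall i : 'I_n,
      Z t w ord0 i = z0 ord0 i + sigma * B t w ord0 i
                     - \int[lebesgue_measure]_(s in `[0, t]) Z s w ord0 i}.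

Section reference_measure.
Variables (d : measure_display) (T : measurableType d) (R : realType).
Variables nu mu : probability T R.

Definition reference_measure : set T -> \bar R := measure_add nu mu.

HB.instance Definition _ := Measure.on reference_measure.

Let fin_num_reference_measure : fin_num_fun reference_measure.
Proof.
move=> A mA; rewrite /reference_measure measure_addE.
by rewrite fin_numD !fin_num_measure.
Qed.

HB.instance Definition _ :=
  @Measure_isFinite.Build _ T R reference_measure fin_num_reference_measure.

End reference_measure.

Section distances.
Variables (R : realType) (n : nat).
Implicit Types nu mu : probability 'rV[R]_n R.
Local Open Scope ereal_scope.

Definition is_coupling nu mu (pi : probability ('rV[R]_n * 'rV[R]_n)%type R) :=
  forall A, measurable A -> pi (fst @^-1` A) = nu A /\ pi (snd @^-1` A) = mu A.

Definition wasserstein nu mu : \bar R :=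
  ereal_inf [set \int[pi]_xy ((enorm (xy.1 - xy.2) ^+ 2)%R%:E) |
             pi in is_coupling nu mu] `^ 2^-1.

Definition total_variation nu mu : \bar R :=
  ereal_sup [set `|nu A - mu A| | A in measurable].

Definition density nu (mu : {sigma_finite_measure set 'rV[R]_n -> \bar R}) :
    'rV[R]_n -> \bar R :=
  Radon_Nikodym (charge_of_finite_measure nu) mu.

(* The value does not depend on the common reference measure; nu + mu always
   dominates both. *)
Definition hellinger nu mu : \bar R :=
  let la := reference_measure nu mu in
  (1 - \int[la]_x ((density nu la x * density mu la x) `^ 2^-1)) `^ 2^-1.

Definition kullback nu mu : \bar R :=
  if `[< nu `<< mu >] then \int[nu]_x lne (density nu mu x) else +oo.

Definition chi2 nu mu : \bar R :=
  if `[< nu `<< mu >] then \int[mu]_x `|density nu mu x - 1| ^+ 2 else +oo.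

Definition gradient (f : 'rV[R]_n -> R) (x : 'rV[R]_n) : 'rV[R]_n :=
  (\row_i 'D_(delta_mx ord0 i) f x)%R.

(* The Radon-Nikodym derivative is only defined up to mu-null sets, so its
   gradient is that of a differentiable version h, and the value is +oo if there
   is none. When mu has full support, as Gaussian laws do, two such versions
   coincide by continuity and the infimum is over at most one value. The set
   h <= 0 is nu-null. *)
Definition fisher nu mu : \bar R :=
  if `[< nu `<< mu >] then
    ereal_inf [set \int[nu]_(x in [set x | (0 < h x)%R])
                     ((enorm (gradient (fun y => ln (h y)) x) ^+ 2)%R%:E) |
               h in [set h : 'rV[R]_n -> R |
                     (forall x, differentiable h x) /\
                     ae_eq mu setT (EFin \o h) (density nu mu)]]
  else +oo.

End distances.

Variant distance := TV | Hellinger | Kullback | Chi2 | Fisher.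

Definition dist (R : realType) (n : nat) (D : distance) :
    probability 'rV[R]_n R -> probability 'rV[R]_n R -> \bar R :=
  match D with
  | TV => @total_variation R n
  | Hellinger => @hellinger R n
  | Kullback => @kullback R n
  | Chi2 => @chi2 R n
  | Fisher => @fisher R n
  end.

Definition dist_max (R : realType) (D : distance) : \bar R :=
  match D with
  | TV | Hellinger => 1%E
  | Kullback | Chi2 | Fisher => +oo%E
  end.

(* [lne 0 = -oo], whereas [ln 0 = 0]. *)
Definition cutoff_time (R : realType) (n : nat) (D : distance) (z0 : 'rV[R]_n) : R :=
  fine match D with
  | TV | Hellinger | Kullback | Chi2 =>
      maxe (lne (Num.sqrt n%:R * enorm z0)%:E) (4^-1 * ln n%:R)%:E
  | Fisher =>
      maxe (lne (n%:R * enorm z0)%:E) (2^-1 * ln n%:R)%:E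
  end.

(* Main.v *)
Require Import Defs.
From HB Require Import structures.
From mathcomp Require Import all_boot all_order all_algebra.
From mathcomp Require Import all_classical all_reals all_analysis measurable_realfun.
From mathcomp Require Import ring lra.

(* Let u = exp(-2t).  The law of Z_t is N(exp(-t) z0, ((1 - u) / n) I).  To see
   this without stochastic integration, telescope exp(s) Z_s along a grid of
   [0, t]: by uniform continuity of the path, exp(-t) z0 plus the sum of the
   independent increments of B weighted by sigma exp(s_j - t) converges to Z_t
   almost surely.  The sums are exactly Gaussian, so their normalisation has a
   law independent of the grid, and so has the limit.

   The density of this law with respect to N(0, I / n) is a product of
   one-dimensional exponentials of quadratics, so its moments are explicit.  Let
   a be the moment of order 1/2 and v that of order 2.  Then chi^2 = v - 1,
   Hellinger = sqrt(1 - a), - 2 ln a <= Kullback <= v - 1 and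
   1 - a <= TV <= sqrt(v - 1), where, with E = n (u |z0|^2 + u^2), one has
   a <= exp(- E / 16), and v <= exp E when u <= 1/2.  Fisher is equal to
   n^2 (u |z0|^2 + u^2 / (1 - u)): differentiable versions of the density are
   unique, Gaussian laws having full support.  The cutoff time c is where these
   quantities are of order 1: they are at least exp(2 eps c) at time (1 - eps) c
   and at most 2 exp(- 2 eps c) at time (1 + eps) c.

   Wasserstein^2 is equal to u |z0|^2 + (1 - sqrt(1 - u))^2: an affine coupling
   attains this value, and a quadratic lower bound of the cost by a function of
   x plus a function of y shows its optimality. *)

Set Implicit Arguments.
Unset Strict Implicit.
Unset Printing Implicit Defensive.

Import Order.TTheory GRing.Theory Num.Theory.
Import numFieldNormedType.Exports.

Local Open Scope classical_set_scope.
Local Open Scope ring_scope.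

(** * Image measures and product rules *)

(** [is_gaussian] prescribes a law on boxes only. Identities between measures are therefore proved
    on boxes and extended by uniqueness of finite measures, and integrals of products of coordinate
    functions are computed one factor at a time, the factors already treated being absorbed into the
    measure.

    The two moments suffice because each bound is the integral of a pointwise inequality between a
    few exponentials exp(k L) of the log-density L, mostly the tangent-line bound 1 + x <= exp x.
    This loses constants, such as 16, but treats several distances at once: cutoff only requires
    bounds depending on E alone, one tending to the maximum as E grows and one to 0 as E vanishes.
    The moment of order 2 blows up as u tends to 1, hence the restriction u <= 1/2, which is
    harmless after the cutoff time, where u tends to 0.

    The mean and variance of the normal law come from the same tangent-line bound applied to
    explicit exponential moments, rather than from differentiation under the integral. *)

Section image_measure.
Context d d' (T : measurableType d) (T' : measurableType d') (R : realType).
Variables (m : {measure set T -> \bar R}) (X : {mfun T >-> T'}).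

Definition image_measure : set T' -> \bar R := pushforward m X.

Let image_measure0 : image_measure set0 = 0%E. Proof. exact: measure0. Qed.

Let image_measure_ge0 A : (0 <= image_measure A)%E.
Proof. exact: measure_ge0. Qed.

Let image_measure_sigma_additive : semi_sigma_additive image_measure.
Proof. exact: measure_semi_sigma_additive. Qed.

HB.instance Definition _ := isMeasure.Build _ _ _ image_measure
  image_measure0 image_measure_ge0 image_measure_sigma_additive.

Lemma ge0_integral_image (f : T' -> \bar R) : (forall y, 0 <= f y)%E ->
  measurable_fun setT f -> (\int[image_measure]_y f y = \int[m]_x f (X x))%E.
Proof. by move=> f0 mf; rewrite [LHS]ge0_integral_pushforward. Qed.

Lemma integrable_image (f : T' -> \bar R) : measurable_fun setT f ->
  m.-integrable setT (f \o X) <-> image_measure.-integrable setT f.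
Proof.
move=> mf; have mfX : measurable_fun setT (f \o X) by exact: measurableT_comp.
have E : (\int[image_measure]_y `|f y| = \int[m]_x `|(f \o X) x|)%E.
  by rewrite ge0_integral_image//; exact: measurableT_comp.
by split=> /integrableP[_ h]; apply/integrableP; split => //; rewrite ?E// -E.
Qed.

Lemma integral_image (f : T' -> \bar R) : measurable_fun setT f ->
  m.-integrable setT (f \o X) ->
  (\int[image_measure]_y f y = \int[m]_x f (X x))%E.
Proof. by move=> mf fX; rewrite [LHS]integral_pushforward. Qed.

End image_measure.

Section product_rule.
Local Open Scope ereal_scope.
Context d (Om : measurableType d) (R : realType) d' (T : measurableType d').
Variables (I : finType) (X : I -> {mfun Om >-> T}).

Lemma measurable_box (A : I -> set T) : (forall i, measurable (A i)) ->
  measurable [set w | forall i, A i (X i w)].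
Proof.
move=> mA; rewrite (_ : [set _ | _] = \big[setI/setT]_(i : I) (X i @^-1` A i)).
  by apply: bigsetI_measurable => i _; exact: measurable_funPTI.
rewrite -bigcap_seq; apply/seteqP; split => [w Aw i _|w Aw i]; first exact: Aw.
by apply: Aw => /=; rewrite mem_index_enum.
Qed.

Lemma measurable_box_cond (P : pred I) (A : I -> set T) :
  (forall i, P i -> measurable (A i)) ->
  measurable [set w | forall i, P i -> A i (X i w)].
Proof.
move=> mA; rewrite (_ : [set _ | _] =
  [set w | forall i, (if P i then A i else setT) (X i w)]).
  by apply: (@measurable_box (fun i => if P i then A i else setT)) => i; case: ifPn => // /mA.
apply/seteqP; split => w Aw i; first by case: ifPn => // /Aw.
by move=> Pi; have := Aw i; rewrite Pi.
Qed.

Variables (mu : I -> {finite_measure set T -> \bar R}).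

Lemma fin_num_prod_measure (P : pred I) (A : I -> set T) :
  (forall i, P i -> measurable (A i)) ->
  \prod_(i | P i) mu i (A i) \is a fin_num.
Proof.
move=> mA; elim/big_ind : _ => // [x y|i Pi]; first exact: fin_numM.
by apply: fin_num_measure; exact: mA.
Qed.

(* One factor at a time: with the other factors fixed, both sides are finite
   measures in the remaining one. *)
Lemma product_rule_generated (M : {finite_measure set Om -> \bar R}) (c : R)
    (G : set (set T)) (g : (set T)^nat) :
  (0 <= c)%R -> measurable = <<s G >> -> setI_closed G -> (forall k, G (g k)) ->
  \bigcup_k g k = setT ->
  (forall A, (forall i, G (A i)) ->
    M [set w | forall i, A i (X i w)] = c%:E * \prod_(i : I) mu i (A i)) ->
  forall A, (forall i, measurable (A i)) ->
    M [set w | forall i, A i (X i w)] = c%:E * \prod_(i : I) mu i (A i).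
Proof.
move=> c0 mG GI Gg gT HG A mA.
have Gm : G `<=` measurable by rewrite mG; exact: sub_sigma_algebra.
(* [s] lists the positions already allowed to carry arbitrary measurable sets; the others still
   carry sets of [G]. *)
suff H (s : seq I) : forall A, (forall i, i \in s -> measurable (A i)) ->
    (forall i, i \notin s -> G (A i)) ->
    M [set w | forall i, A i (X i w)] = c%:E * \prod_(i : I) mu i (A i).
  by apply: (H (enum I)) => // i; rewrite mem_enum.
elim: s => {A mA}[|j s IH] A mA GA; first by apply: HG => i; exact: GA.
have mA' i : i != j -> measurable (A i).
  move=> ij; have [is_|is_] := boolP (i \in s).
    by apply: mA; rewrite in_cons is_ orbT.
  by apply: Gm; apply: GA; rewrite in_cons negb_or ij.
pose D := [set w | forall i, i != j -> A i (X i w)].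
have mD : measurable D by exact: measurable_box_cond.
have k0 : (0 <= c * fine (\prod_(i | i != j) mu i (A i)))%R.
  by rewrite mulr_ge0// fine_ge0// prode_ge0.
have splitM B : [set w | forall i, (if i == j then B else A i) (X i w)] =
    X j @^-1` B `&` D.
  apply/seteqP; split => w /= Aw.
    split; first by have := Aw j; rewrite eqxx.
    by move=> i /negbTE ij; have := Aw i; rewrite ij.
  by move=> i; case: eqVneq => [->|ij]; [exact: Aw.1|exact: Aw.2].
have splitP B : measurable B ->
    c%:E * \prod_(i : I) mu i (if i == j then B else A i) =
    (c * fine (\prod_(i | i != j) mu i (A i)))%:E * mu j B.
  move=> mB; rewrite (bigD1 j)//= eqxx EFinM fineK; last exact: fin_num_prod_measure.
  rewrite -muleA [X in _ = _ * X]muleC; congr (_ * (_ * _)).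
  by apply: eq_bigr => i /negbTE ->.
have AE : A = fun i => if i == j then A j else A i.
  by apply/funext => i; case: eqVneq => [->|].
rewrite [in LHS]AE [in RHS]AE splitM splitP; last by apply: mA; rewrite mem_head.
have mAj : measurable (A j) by apply: mA; rewrite mem_head.
pose m1 := [the {measure set T -> \bar R} of image_measure (mrestr M mD) (X j)].
pose m2 := [the {measure set T -> \bar R} of mscale (NngNum k0) (mu j)].
have m12 : forall B, G B -> m1 B = m2 B.
  move=> B GB; rewrite /m1 /m2 /= /image_measure /pushforward /mrestr /mscale/=.
  rewrite -splitP; last exact: Gm.
  rewrite -splitM; apply: IH => i.
    by case: eqVneq => [_ _|ij is_]; [exact: Gm|exact: mA'].
  case: eqVneq => // ij is_.
  by apply: GA; rewrite in_cons negb_or ij.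
have := @measure_unique _ _ _ G g mG GI Gg gT m1 m2 m12.
move=> /(_ _ _ mAj); rewrite /m1 /m2 /= /image_measure /pushforward /mrestr /mscale/=; apply.
move=> k; rewrite ltey_eq fin_num_measure//; apply: measurableI => //.
by apply: measurable_funPTI; exact/Gm/Gg.
Qed.

End product_rule.

(** * Measures with a density *)

Section density.
Local Open Scope ereal_scope.
Context d (T : measurableType d) (R : realType).
Variable mu : {sigma_finite_measure set T -> \bar R}.

Section has_density.
Variables (nu : {finite_measure set T -> \bar R}) (rho : T -> R).
Hypotheses (rho0 : forall x, (0 <= rho x)%R) (mrho : measurable_fun setT rho).
Hypothesis nuE : forall A, measurable A -> nu A = \int[mu]_(x in A) (rho x)%:E.

Let mrhoE : measurable_fun setT (EFin \o rho).
Proof. exact/measurable_EFinP. Qed.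

Lemma density_dominates : nu `<< mu.
Proof.
apply/null_content_dominatesP => A mA muA; rewrite nuE//.
by apply: null_set_integral => //; exact: measurable_funTS mrhoE.
Qed.

Lemma Radon_Nikodym_density :
  ae_eq mu setT (Radon_Nikodym (charge_of_finite_measure nu) mu) (EFin \o rho).
Proof.
have dom := density_dominates.
apply: integral_ae_eq => //; first exact: Radon_Nikodym_integrable.
by move=> E _ mE; rewrite -Radon_Nikodym_integral// -nuE.
Qed.

Lemma ge0_integral_density (f : T -> \bar R) : (forall x, 0 <= f x) ->
  measurable_fun setT f -> \int[nu]_x f x = \int[mu]_x (f x * (rho x)%:E).
Proof.
move=> f0 mf; have dom := density_dominates.
rewrite -(Radon_Nikodym_SigmaFinite.change_of_variables dom)//.
have mF : measurable_fun setT (Radon_Nikodym_SigmaFinite.f nu mu).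
  exact/measurable_int/Radon_Nikodym_SigmaFinite.f_integrable.
apply: ae_eq_integral => //.
- exact: emeasurable_funM.
- exact: emeasurable_funM.
- apply: ae_eqe_mul2l; apply: ae_eq_trans Radon_Nikodym_density.
  exact: ae_eq_Radon_Nikodym_SigmaFinite.
Qed.

End has_density.

Section density_measure.
Variable rho : T -> R.
Hypotheses (rho0 : forall x, (0 <= rho x)%R).
Hypothesis irho : mu.-integrable setT (EFin \o rho).

(** Turns a weighted integral into a finite measure, to which uniqueness on generators applies. It
    is an existence statement because the measure structure depends on the hypotheses on [rho]. *)
Lemma density_measure_exists : exists nu : {finite_measure set T -> \bar R},
  forall A, measurable A -> nu A = \int[mu]_(x in A) (rho x)%:E.
Proof.
have mrho := measurable_int _ irho.
pose nu A := \int[mu]_(x in A) (rho x)%:E.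
have nu0 : nu set0 = 0 by rewrite /nu integral_set0.
have nu_ge0 A : 0 <= nu A by apply: integral_ge0 => x _; rewrite lee_fin.
have nuS : semi_sigma_additive nu.
  move=> F mF tF mUF; rewrite /nu ge0_integral_bigcup//.
  - by apply: is_cvg_ereal_nneg_natsum_cond => n _ _; exact: nu_ge0.
  - exact: measurable_funTS.
  - by move=> x _; rewrite lee_fin.
pose m : {measure set T -> \bar R} :=
  HB.pack nu (isMeasure.Build _ _ _ nu nu0 nu_ge0 nuS).
have fin : fin_num_fun m.
  move=> A mA; apply: (integrable_fin_num mA).
  exact: integrableS irho.
pose m' : {finite_measure set T -> \bar R} :=
  HB.pack (Measure.sort m) (Measure_isFinite.Build _ _ _ (Measure.sort m) fin).
by exists m'.
Qed.

End density_measure.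
End density.

(** * Expectation of a product of independent factors *)

Section product_expectation.
Local Open Scope ereal_scope.
Context d (Om : measurableType d) (R : realType) d' (T : measurableType d').
Variables (I : finType) (X : I -> {mfun Om >-> T}).
Variables (mu : I -> {finite_measure set T -> \bar R}).
Variable M : {finite_measure set Om -> \bar R}.
Hypothesis HM : forall A, (forall i, measurable (A i)) ->
  M [set w | forall i, A i (X i w)] = \prod_(i : I) mu i (A i).
Variables (f : I -> T -> R) (a : I -> R).
Hypotheses (f0 : forall i x, (0 <= f i x)%R) (mf : forall i, measurable_fun setT (f i)).
Hypothesis intf : forall i, \int[mu i]_x (f i x)%:E = (a i)%:E.

Let a0 i : (0 <= a i)%R.
Proof. by rewrite -lee_fin -intf integral_ge0// => x _; rewrite lee_fin. Qed.

Let g s w := (\prod_(i <- s) f i (X i w))%R.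

Let g0 s w : (0 <= g s w)%R. Proof. by apply: prodr_ge0 => i _. Qed.

Let mg s : measurable_fun setT (g s).
Proof.
apply: measurable_prod => i _.
exact: (measurableT_comp (mf i) (measurable_funPT (X i))).
Qed.

(** Induction on the list of factors already integrated, the others being kept as events. With the
    product of the treated factors as a density, the image of the measure under [X j] is a multiple
    of [mu j], by the induction hypothesis applied to every set in position [j]; integrating [f j]
    against this image adds one factor. *)
Lemma integral_prod_rule :
  \int[M]_w (\prod_(i : I) f i (X i w))%:E = (\prod_(i : I) a i)%:E.
Proof.
suff H (s : seq I) : uniq s -> forall A, (forall i, measurable (A i)) ->
    \int[M]_(w in [set w | forall i, i \notin s -> A i (X i w)]) (g s w)%:E =
    \prod_(i | i \notin s) mu i (A i) * (\prod_(i <- s) a i)%:E.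
  have := H (enum I) (enum_uniq I) (fun=> setT) (fun=> measurableT).
  rewrite [X in X * _]big1; last by move=> i; rewrite mem_enum.
  rewrite mul1e.
  rewrite /g !big_enum/= => <-.
  rewrite (_ : [set _ | _] = setT); last by apply/seteqP; split.
  by apply: eq_integral => w _; rewrite big_enum.
elim: s => [_ A mA|j s IH /= /andP[js us] A mA].
  rewrite big_nil mule1 -HM//; under eq_integral do rewrite /g big_nil.
  rewrite integral_cst ?mul1e; first by apply: congr1; apply/seteqP; split=> w /= Aw i *; apply: Aw.
  exact: measurable_box_cond.
set D := [set w | _].
have mD : measurable D by exact: measurable_box_cond.
pose K := (fine (\prod_(i | i \notin j :: s) mu i (A i)) * \prod_(i <- s) a i)%R.
have K0 : (0 <= K)%R by rewrite mulr_ge0 ?prodr_ge0// fine_ge0// prode_ge0.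
have step B : measurable B ->
    \int[M]_(w in D `&` X j @^-1` B) (g s w)%:E = K%:E * mu j B.
  move=> mB; have := IH us (fun i => if i == j then B else A i).
  rewrite (_ : [set w | _] = D `&` X j @^-1` B); last first.
    apply/seteqP; split => w /=.
      move=> Aw; split=> [i|].
        rewrite in_cons negb_or => /andP[/negbTE ij iNs].
        by have := Aw i iNs; rewrite ij.
      by have := Aw j js; rewrite eqxx.
    move=> [Dw Bw] i iNs; case: eqVneq => [->//|ij].
    by apply: Dw; rewrite in_cons negb_or ij.
  move=> ->; last by move=> i; case: ifP.
  rewrite (bigD1 j)//= eqxx.
  rewrite (eq_bigr (fun i => mu i (A i))); last first.
    by move=> i /andP[_ /negbTE ->].
  rewrite (eq_bigl (fun i => i \notin j :: s)); last first.
    by move=> i; rewrite in_cons negb_or andbC.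
  rewrite /K EFinM fineK; last exact: fin_num_prod_measure.
  by rewrite -muleA muleC.
have irho : M.-integrable setT (EFin \o (g s \_ D)).
  apply/integrableP; split.
    by apply/measurable_EFinP; apply/(measurable_restrictT _ mD)/measurable_funTS.
  under eq_integral => w _.
    rewrite /= ger0_norm; last by rewrite patchE; case: ifP.
    rewrite -/((EFin \o (g s \_ D)) w) -restrict_EFin; over.
  rewrite -integral_mkcond.
  have := step setT measurableT; rewrite preimage_setT setIT => ->.
  by rewrite ltey_eq fin_numM// fin_num_measure.
have rho0 x : (0 <= (g s \_ D) x)%R by rewrite patchE; case: ifP.
have mrho : measurable_fun setT (g s \_ D) by exact/measurable_EFinP/(measurable_int _ irho).
have [nu nuE] := density_measure_exists rho0 irho.
pose m1 := [the {measure set T -> \bar R} of image_measure nu (X j)].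
pose m2 := [the {measure set T -> \bar R} of mscale (NngNum K0) (mu j)].
have m12 B : measurable B -> m1 B = m2 B.
  move=> mB; rewrite /m1 /m2 /= /image_measure /pushforward /mscale/=.
  have mXB : measurable (X j @^-1` B) by exact: measurable_funPTI.
  rewrite nuE// -step// setIC integral_mkcondr; apply: eq_integral => w _.
  by rewrite restrict_EFin.
have int12 : \int[m1]_x (f j x)%:E = \int[m2]_x (f j x)%:E.
  by apply: eq_measure_integral => B mB _; exact: m12.
have mfE : measurable_fun setT (EFin \o f j) by exact/measurable_EFinP.
have : \int[m2]_x (f j x)%:E = (K * a j)%:E.
  by rewrite /m2 /= ge0_integral_mscale//= ?intf ?EFinM// => x _; rewrite lee_fin.
rewrite -int12 /m1 /= /image_measure ge0_integral_pushforward//=; last first.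
  by move=> x _; rewrite lee_fin.
rewrite preimage_setT (ge0_integral_density mrho nuE); last 2 first.
- by move=> x; rewrite lee_fin.
- exact: (measurableT_comp mfE (measurable_funPT (X j))).
rewrite big_cons /K => E.
transitivity (fine (\prod_(i | i \notin j :: s) mu i (A i)) * \prod_(i <- s) a i * a j)%:E; last first.
  rewrite -mulrA EFinM fineK; last exact: fin_num_prod_measure.
  by rewrite [(a j * _)%R]mulrC.
rewrite -E integral_mkcond; apply: eq_integral => w _.
rewrite /= restrict_EFin /= !patchE; case: ifP => _; last by rewrite mule0.
by rewrite -EFinM /g big_cons.
Qed.

End product_expectation.

(** * Borel sets of row vectors *)

Section borel_rV.
Context (R : realType) (n : nat).
Local Notation V := 'rV[R]_n.

Lemma continuous_measurable_rV (f : V -> R) :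
  continuous f -> measurable_fun [set: V] f.
Proof.
move=> cf; apply: (measurability _ (RGenOInfty.measurableE R)) => _ [_ [x ->] <-].
rewrite setTI; apply: sub_sigma_algebra => /=.
by move/continuousP : cf; apply; exact: interval_open.
Qed.

Definition rv_coord (i : 'I_n) (x : V) : R := x ord0 i.

Lemma measurable_coord i : measurable_fun [set: V] (rv_coord i).
Proof. by apply: continuous_measurable_rV => x; exact: coord_continuous. Qed.

Definition mcoord i : {mfun V >-> measurableTypeR R} :=
  @mfun_Sub _ _ V (measurableTypeR R) (rv_coord i) (mem_set (measurable_coord i)).

Definition boxes : set (set V) :=
  [set B | exists A : 'I_n -> set (measurableTypeR R),
     (forall i, measurable (A i)) /\ B = [set x | forall i, A i (rv_coord i x)]].

Lemma setI_boxes : setI_closed boxes.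
Proof.
move=> _ _ [A [mA ->]] [B [mB ->]]; exists (fun i => A i `&` B i); split.
  by move=> i; exact: measurableI.
by apply/seteqP; split=> x /= => [[Ax Bx] i|ABx]; split=> // i; case: (ABx i).
Qed.

Lemma boxes_setT : boxes setT.
Proof. by exists (fun=> setT); split=> //; apply/seteqP; split. Qed.

Lemma boxes_measurable : boxes `<=` measurable.
Proof.
move=> _ [A [mA ->]].
exact: (measurable_box mcoord).
Qed.

Lemma rV_rat_dense (x : V) (e : R) : 0 < e ->
  exists q : 'rV[rat]_n, forall i, ball (ratr (q ord0 i) : R) e (x ord0 i).
Proof.
move=> e0.
have /choice[q hq] i : exists r : rat, ball (ratr r : R) e (x ord0 i).
  have xe : x ord0 i < x ord0 i + e by rewrite ltrDl.
  have [r] := rat_in_itvoo xe.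
  rewrite in_itv/= => /andP[xr rx]; exists r; rewrite /ball/= ger0_norm; first by lra.
  by rewrite subr_ge0 ltW.
by exists (\row_i q i) => i; rewrite mxE.
Qed.

(** For the sup norm, balls are boxes: an open set is the countable union of the boxes with rational
    centre and radius 1/(k+1) that it contains. *)
Lemma measurable_rV_boxes : @measurable _ V = <<s boxes >>.
Proof.
apply/seteqP; split; last first.
  by apply: smallest_sub; [exact: sigma_algebra_measurable|exact: boxes_measurable].
apply: smallest_sub; first exact: smallest_sigma_algebra.
move=> U oU.
pose b (p : 'rV[rat]_n * nat) : set V :=
  [set x | forall i, ball (ratr (p.1 ord0 i) : R) p.2.+1%:R^-1 (rv_coord i x)].
have -> : U = \bigcup_(p in [set p | b p `<=` U]) b p.
  apply/seteqP; split => [x Ux|x [p pU bx]]; last exact: pU.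
  have /nbhs_ballP[e/= e0 eU] := open_nbhs_nbhs (conj oU Ux).
  have [k ke] : exists k, k.+1%:R^-1 < e / 2.
    have e20 : 0 < e / 2 by rewrite divr_gt0.
    have [k _ hk] := near_infty_natSinv_lt (PosNum e20).
    by exists k; apply: hk => /=.
  have [q hq] := @rV_rat_dense x k.+1%:R^-1 ltac:(by []).
  exists (q, k) => //= y yb; apply: eU; split=> // i j.
  rewrite (ord1 i).
  rewrite [e]splitr; apply: (@ball_triangle _ _ (ratr (q ord0 j) : R)).
    by apply: ball_sym; apply: le_ball (hq j); exact: ltW.
  by apply: le_ball (yb j); exact: ltW.
rewrite (_ : \bigcup_(p in _) _ =
    \bigcup_p (if pselect (b p `<=` U) is left _ then b p else set0)); last first.
  apply/seteqP; split=> [x [p pU bx]|x [p _]]; first by exists p => //; case: pselect.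
  by case: pselect => // pU bx; exists p.
apply: (@countable_bigcupT_measurable _ (g_sigma_algebraType boxes)) => // p.
case: pselect => _; last exact: measurable0.
apply: sub_sigma_algebra.
by exists (fun i => ball (ratr (p.1 ord0 i) : R) p.2.+1%:R^-1); split=> // i; exact: measurable_ball.
Qed.

Lemma measurable_fun_rVP d (T : measurableType d) (f : T -> V) :
  (forall i, measurable_fun setT (fun t => rv_coord i (f t))) ->
  measurable_fun setT f.
Proof.
move=> mf; apply: (measurability _ measurable_rV_boxes) => _ [_ [A [mA ->]] <-].
rewrite setTI.
exact: (measurable_box (fun i =>
  @mfun_Sub _ _ T (measurableTypeR R) _ (mem_set (mf i)))).
Qed.

Lemma eq_measure_boxes (m1 m2 : {finite_measure set V -> \bar R}) :
  (forall A : 'I_n -> set (measurableTypeR R), (forall i, measurable (A i)) ->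
    m1 [set x | forall i, A i (rv_coord i x)] = m2 [set x | forall i, A i (rv_coord i x)]) ->
  forall A, measurable A -> m1 A = m2 A.
Proof.
move=> m12 A mA.
apply: (measure_unique boxes (fun=> setT)) => //.
- exact: measurable_rV_boxes.
- exact: setI_boxes.
- by move=> _; exact: boxes_setT.
- by rewrite bigcup_const//; exists 0%N.
- by move=> _ [B [mB ->]]; exact: m12.
- by move=> _; rewrite ltey_eq fin_num_measure.
Qed.

End borel_rV.

(** * One-dimensional normal laws *)

Section gaussian_integrals.
Local Open Scope ereal_scope.
Context (R : realType).
Local Notation la := (@lebesgue_measure R).
Local Notation TR := (measurableTypeR R).

Lemma measurable_affine (a b : R) : measurable_fun [set: TR] (fun x : TR => (a * x + b)%R : TR).
Proof. by apply: measurable_funD => //; exact: measurable_funM. Qed.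

Definition maffine (a b : R) : {mfun TR >-> TR} :=
  @mfun_Sub _ _ TR TR _ (mem_set (@measurable_affine a b)).

(** Multiplied by [a], the image of Lebesgue measure under the affine map has the right mass on
    half-open intervals, which characterises Lebesgue measure. *)
Lemma lebesgue_measure_affine (a b : R) (A : set TR) : (0 < a)%R -> measurable A ->
  la ((fun x : R => a * x + b)%R @^-1` A) = a^-1%:E * la A.
Proof.
move=> a0 mA.
have a0' : (0 <= a)%R by exact: ltW.
pose m := [the {measure set TR -> \bar R} of mscale (NngNum a0')
  [the {measure set TR -> \bar R} of image_measure la (maffine a b)]].
have <- : m A = la A.
  apply/esym/lebesgue_measure_unique => // _ [[x y] _ <-].
  rewrite /m /= /mscale /= /image_measure /pushforward /=.
  rewrite (_ : _ @^-1` _ = `](x - b) / a, (y - b) / a]%classic)%R; last first.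
    apply/seteqP; split=> z /=; rewrite !in_itv/= ltr_pdivrMr// ler_pdivlMr//;
      by rewrite ltrBlDr lerBrDr mulrC.
  rewrite !lebesgue_measure_itv/= !lte_fin ltr_pM2r ?invr_gt0// ltrD2r.
  case: ifP => _; last by rewrite mule0.
  by rewrite -!EFinD -EFinM; congr EFin; field; rewrite gt_eqF.
rewrite /m /= /mscale /= /image_measure /pushforward /= muleA -EFinM mulVf ?gt_eqF//.
by rewrite mul1e.
Qed.

Lemma ge0_integral_affine (a b : R) (f : R -> \bar R) : (0 < a)%R ->
  (forall x, 0 <= f x) -> measurable_fun setT f ->
  \int[la]_x f (a * x + b)%R = a^-1%:E * \int[la]_x f x.
Proof.
move=> a0 f0 mf.
have a0' : (0 <= a^-1)%R by rewrite invr_ge0 ltW.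
rewrite -(ge0_integral_mscale la measurableT (NngNum a0') mf)//.
transitivity (\int[image_measure la (maffine a b)]_x f x).
  by rewrite ge0_integral_pushforward.
apply: eq_measure_integral => A mA _.
exact: lebesgue_measure_affine.
Qed.

(** Complete the square and substitute sqrt a * x - b / (2 sqrt a) in the integral of exp(- x^2).
    The closed forms below go back to this one. *)
Lemma integral_expR_quadratic (a b c : R) : (0 < a)%R ->
  \int[la]_x (expR (c + b * x - a * x ^+ 2))%:E =
  (Num.sqrt (pi / a) * expR (c + b ^+ 2 / (4 * a)))%:E.
Proof.
move=> a0; have sa0 : (0 < Num.sqrt a)%R by rewrite sqrtr_gt0.
have := @ge0_integral_affine (Num.sqrt a) (- (b / (2 * Num.sqrt a))) (EFin \o gauss_fun)
  sa0 (fun x => gauss_fun_ge0 x : 0 <= (gauss_fun x)%:E).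
rewrite integralT_gauss => /(_ _).
have mg : measurable_fun setT (EFin \o @gauss_fun R).
  by apply/measurable_EFinP; exact: measurable_gauss_fun.
move=> /(_ mg) E.
transitivity (\int[la]_x ((expR (c + b ^+ 2 / (4 * a)))%:E *
    (EFin \o gauss_fun) (Num.sqrt a * x + - (b / (2 * Num.sqrt a)))%R)).
  apply: eq_integral => x _; rewrite /= /gauss_fun -EFinM -expRD; congr (expR _)%:E.
  have e : (a = Num.sqrt a ^+ 2)%R by rewrite sqr_sqrtr// ltW.
  move: sa0 e; set r := Num.sqrt a => r0 ->.
  by field; rewrite gt_eqF.
rewrite ge0_integralZl//=; last 2 first.
- exact: (measurableT_comp mg (measurable_affine _ _)).
- by move=> x _; rewrite lee_fin gauss_fun_ge0.
rewrite E -!EFinM sqrtrM ?pi_ge0// sqrtrV ?ltW// mulrC; congr EFin; ring.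
Qed.

End gaussian_integrals.

Section normal.
Local Open Scope ereal_scope.
Context (R : realType).
Local Notation la := (@lebesgue_measure R).
Local Notation TR := (measurableTypeR R).
Implicit Types m s a b c x y : R.

Lemma normal_pdf_expR m s x : (0 < s)%R ->
  normal_pdf m s x = ((s * Num.sqrt (2 * pi))^-1 * expR (- (x - m) ^+ 2 / (2 * s ^+ 2)))%R.
Proof.
move=> s0; rewrite normal_pdfE ?gt_eqF// /normal_peak /normal_fun.
rewrite -[(_ * pi *+ 2)%R]mulr_natr -mulrA [(pi * _)%R]mulrC sqrtrM ?sqr_ge0// sqrtr_sqr gtr0_norm//.
by rewrite -(mulr_natl (s ^+ 2)).
Qed.

Lemma measurable_EFin_normal_pdf m s : measurable_fun setT (EFin \o normal_pdf m s).
Proof. by apply/measurable_EFinP; exact: measurable_normal_pdf. Qed.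

Lemma ge0_integral_normal m s (f : R -> \bar R) : (forall x, 0 <= f x) ->
  measurable_fun setT f ->
  \int[normal_prob m s]_x f x = \int[la]_x (f x * (normal_pdf m s x)%:E).
Proof.
move=> f0 mf.
by apply: (@ge0_integral_density _ TR R la [the {finite_measure set TR -> \bar R} of normal_prob m s] (normal_pdf m s)) => //; exact: measurable_normal_pdf.
Qed.

Lemma normal_prob_indic m s (A : set TR) : measurable A ->
  normal_prob m s A = \int[la]_x ((\1_A x)%:E * (normal_pdf m s x)%:E).
Proof.
move=> mA; rewrite -ge0_integral_normal//.
  by rewrite integral_indic// setIT.
by apply/measurable_EFinP; exact: measurable_indic.
Qed.

Lemma normal_prob_affine a b m s (A : set TR) : (0 < a)%R -> (0 < s)%R -> measurable A ->
  normal_prob m s ((fun x : R => a * x + b)%R @^-1` A) = normal_prob (a * m + b) (a * s) A.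
Proof.
move=> a0 s0 mA; have as0 : (0 < a * s)%R by rewrite mulr_gt0.
have mA' : measurable ((fun x : R => a * x + b)%R @^-1` A : set TR).
  exact: (measurable_funPTI (maffine a b)).
rewrite [LHS](normal_prob_indic m s mA') [RHS](normal_prob_indic (a * m + b) (a * s) mA).
transitivity (\int[la]_x (a%:E * ((\1_A (a * x + b)%R)%:E *
    (normal_pdf (a * m + b) (a * s) (a * x + b))%:E))).
  apply: eq_integral => x _; rewrite [RHS]muleCA; congr (_ * _).
  rewrite -EFinM; congr EFin; rewrite !normal_pdf_expR// [RHS]mulrA; congr (_ * expR _)%R; last first.
    by field; rewrite !gt_eqF.
  by field; rewrite !gt_eqF// sqrtr_gt0 mulr_gt0// pi_gt0.
have mf : measurable_fun setT (fun x => (\1_A x)%:E * (normal_pdf (a * m + b) (a * s) x)%:E).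
  apply: emeasurable_funM; last exact: measurable_EFin_normal_pdf.
  by apply/measurable_EFinP; exact: measurable_indic.
have f0 x : 0 <= (\1_A x)%:E * (normal_pdf (a * m + b) (a * s) x)%:E.
  by rewrite -EFinM lee_fin mulr_ge0// normal_pdf_ge0.
rewrite ge0_integralZl//=; last first.
- by rewrite lee_fin ltW.
- exact: (measurableT_comp mf (measurable_affine _ _)).
rewrite (@ge0_integral_affine R a b (fun x => (\1_A x)%:E * (normal_pdf (a * m + b) (a * s) x)%:E))//.
by rewrite muleA -EFinM divff ?gt_eqF// mul1e.
Qed.

(** [a] may be negative as long as the normal density wins, so that exponentials of small positive
    multiples of x^2 are covered. *)
Lemma normal_expR_quadratic m s a b c : (0 < s)%R -> (0 < a + (2 * s ^+ 2)^-1)%R ->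
  \int[normal_prob m s]_x (expR (c + b * x - a * x ^+ 2))%:E =
  ((s * Num.sqrt (2 * (a + (2 * s ^+ 2)^-1)))^-1 *
   expR (c - m ^+ 2 / (2 * s ^+ 2) +
         (b + m / s ^+ 2) ^+ 2 / (4 * (a + (2 * s ^+ 2)^-1))))%:E.
Proof.
move=> s0; set A := (a + _)%R => A0.
have mq c' b' a' : measurable_fun setT (fun x : R => (expR (c' + b' * x - a' * x ^+ 2))%:E).
  apply/measurable_EFinP; apply: measurableT_comp => //.
  by apply: measurable_funB; [apply: measurable_funD => //|]; apply: measurable_funM.
rewrite ge0_integral_normal//.
transitivity (\int[la]_x (((s * Num.sqrt (2 * pi))^-1)%:E *
   (expR ((c - m ^+ 2 / (2 * s ^+ 2)) + (b + m / s ^+ 2) * x - A * x ^+ 2))%:E)).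
  apply: eq_integral => x _; rewrite normal_pdf_expR// -!EFinM mulrCA -expRD.
  congr (_ * expR _)%:E.
  by rewrite /A; field; rewrite gt_eqF.
have k0 : (0 <= (s * Num.sqrt (2 * pi))^-1)%R by rewrite invr_ge0 mulr_ge0 ?sqrtr_ge0// ltW.
rewrite ge0_integralZl//; last exact: mq.
rewrite [X in _ * X](integral_expR_quadratic _ _ A0) -EFinM mulrA; congr (_ * _)%:E.
rewrite !invfM -mulrA; congr (_ * _)%R.
rewrite -sqrtrV ?mulr_ge0 ?pi_ge0// -sqrtrM ?invr_ge0 ?mulr_ge0 ?pi_ge0//.
rewrite -sqrtrV ?mulr_ge0 ?ltW//; congr Num.sqrt.
have p0 : (@pi R != 0)%R by rewrite gt_eqF// pi_gt0.
have A1 : (A != 0)%R by rewrite gt_eqF.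
by move: p0; generalize (@pi R) => p p0; field; rewrite A1.
Qed.

End normal.

Section normal_convolution.
Local Open Scope ereal_scope.
Context (R : realType).
Local Notation la := (@lebesgue_measure R).
Local Notation TR := (measurableTypeR R).
Variables (a b : R).
Hypotheses (a0 : (0 < a)%R) (b0 : (0 < b)%R).
Let s := Num.sqrt (a ^+ 2 + b ^+ 2)%R.

Let s0 : (0 < s)%R. Proof. by rewrite sqrtr_gt0 addr_gt0// exprn_gt0. Qed.

Let ss : (s ^+ 2 = a ^+ 2 + b ^+ 2)%R.
Proof. by rewrite sqr_sqrtr// addr_ge0// sqr_ge0. Qed.

(** For fixed [y], the normal density at [y], seen as a function of its mean [x], is the exponential
    of a quadratic in [x]. *)
Lemma integral_normal_pdf_convolution (y : R) :
  \int[normal_prob 0 a]_x (normal_pdf x b y)%:E = (normal_pdf 0 s y)%:E.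
Proof.
have A0 : (0 < (2 * b ^+ 2)^-1 + (2 * a ^+ 2)^-1)%R.
  by rewrite addr_gt0// invr_gt0 mulr_gt0// exprn_gt0.
have := @normal_expR_quadratic R 0 a _ (y / b ^+ 2) (- y ^+ 2 / (2 * b ^+ 2)) a0 A0.
move=> E; transitivity (\int[normal_prob 0 a]_x (((b * Num.sqrt (2 * pi))^-1)%:E *
   (expR (- y ^+ 2 / (2 * b ^+ 2) + y / b ^+ 2 * x - (2 * b ^+ 2)^-1 * x ^+ 2))%:E)).
  apply: eq_integral => x _; rewrite normal_pdf_expR// -EFinM; congr (_ * expR _)%:E.
  by field; rewrite gt_eqF.
have mq : measurable_fun setT (fun x => (expR (- y ^+ 2 / (2 * b ^+ 2) +
    y / b ^+ 2 * x - (2 * b ^+ 2)^-1 * x ^+ 2))%:E).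
  apply/measurable_EFinP; apply: measurableT_comp => //.
  by apply: measurable_funB; [apply: measurable_funD => //|]; apply: measurable_funM.
have k0 : (0 <= (b * Num.sqrt (2 * pi))^-1)%R.
  by rewrite invr_ge0 mulr_ge0 ?sqrtr_ge0// ltW.
rewrite ge0_integralZl//.
rewrite [X in _ * X]E -EFinM normal_pdf_expR// ss mulrA; congr (_ * expR _)%:E.
  have -> : (2 * ((2 * b ^+ 2)^-1 + (2 * a ^+ 2)^-1) = (s / (a * b)) ^+ 2)%R.
    by rewrite expr_div_n ss; field; rewrite !gt_eqF.
  rewrite sqrtr_sqr ger0_norm ?divr_ge0 ?mulr_ge0 ?ltW//.
  have p0 : (0 < Num.sqrt (2 * @pi R))%R by rewrite sqrtr_gt0 mulr_gt0// pi_gt0.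
  move: p0 s0; generalize (Num.sqrt (2 * @pi R)) => p p0 s0'.
  by field; rewrite !gt_eqF.
have : (a ^+ 2 + b ^+ 2 != 0)%R by rewrite gt_eqF// addr_gt0// exprn_gt0.
move=> ab; field.
by rewrite ab !gt_eqF.
Qed.

Lemma normal_prob_convolution (A : set TR) : measurable A ->
  (normal_prob 0 a \x normal_prob 0 b) [set p : TR * TR | A (p.1 + p.2 : R)%R] =
  normal_prob 0 s A.
Proof.
move=> mA; rewrite /product_measure1 /=.
have xsec x : xsection [set p : TR * TR | A (p.1 + p.2 : R)%R] x =
    (fun y : R => 1 * y + x)%R @^-1` A.
  by apply/seteqP; split=> y /=; rewrite /xsection /= inE /= mul1r addrC.
transitivity (\int[normal_prob 0 a]_x \int[la]_y ((\1_A y)%:E * (normal_pdf x b y)%:E)).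
  apply: eq_integral => x _; rewrite xsec normal_prob_affine//.
  by rewrite !mul1r add0r normal_prob_indic.
have mpdf : measurable_fun [set: TR * TR] (fun p : TR * TR => normal_pdf p.1 b p.2).
  rewrite (_ : (fun p => _) = fun p : TR * TR => ((b * Num.sqrt (2 * pi))^-1 *
      expR (- (p.2 - p.1) ^+ 2 / (2 * b ^+ 2)))%R); last first.
    by apply/funext => p; rewrite normal_pdf_expR.
  apply: measurable_funM => //; apply: measurableT_comp => //.
  apply: measurable_funM => //; apply: measurableT_comp => //.
  by apply: measurable_funX; exact: measurable_funB.
have mf : measurable_fun [set: TR * TR]
    (fun p : TR * TR => (\1_A p.2 * normal_pdf p.1 b p.2)%:E).
  apply/measurable_EFinP; apply: measurable_funM => //.
  by apply: measurableT_comp => //; exact: measurable_indic.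
have f0 (p : TR * TR) : 0 <= (\1_A p.2 * normal_pdf p.1 b p.2)%:E.
  by rewrite lee_fin mulr_ge0// normal_pdf_ge0.
rewrite (@fubini_tonelli _ _ TR TR R (normal_prob 0 a) la _ mf f0) normal_prob_indic//.
apply: eq_integral => y _.
rewrite -integral_normal_pdf_convolution -ge0_integralZl//=.
- by apply/measurable_EFinP; exact: (measurable_fun_pair1 y mpdf).
- by move=> x _; rewrite lee_fin normal_pdf_ge0.
Qed.

End normal_convolution.

(** A first-order test: as l takes both signs, a linear term bounded by a quadratic one near 0 must
    vanish. Applied to the integral of 1 + l f <= exp(l f), it identifies the mean and the variance
    of the standard normal law. *)
Lemma eq0_quadratic_bound (R : realFieldType) (c K e : R) : 0 < c -> 0 < K ->
  (forall l, `|l| <= c -> l * e <= K * l ^+ 2) -> e = 0.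
Proof.
move=> c0 K0 H; apply/eqP/negPn/negP => e0.
have e0' : 0 < `|e| by rewrite normr_gt0.
(* With l = t e, the hypothesis gives t e^2 <= K t^2 e^2 <= t e^2 / 2. *)
pose t := Num.min (c / `|e|) (2 * K)^-1.
have t0 : 0 < t by rewrite lt_min divr_gt0// invr_gt0 mulr_gt0.
have tc : t <= c / `|e| by rewrite ge_min lexx.
have tK : t <= (2 * K)^-1 by rewrite ge_min lexx orbT.
have := H (t * e); rewrite normrM (gtr0_norm t0) -ler_pdivlMr// => /(_ tc).
have e2 : 0 < e ^+ 2 by rewrite exprn_even_gt0.
rewrite (_ : t * e * e = t * e ^+ 2); last by ring.
rewrite (_ : K * (t * e) ^+ 2 = (K * t) * (t * e ^+ 2)); last by ring.
have p0 : 0 < t * e ^+ 2 by rewrite mulr_gt0.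
have : K * t * (t * e ^+ 2) <= 2^-1 * (t * e ^+ 2).
  rewrite ler_pM2r// (_ : 2^-1 = K * (2 * K)^-1) ?ler_pM2l//.
  by field; rewrite gt_eqF.
by set X := t * e ^+ 2 in p0 *; set Y := K * t * X; lra.
Qed.

Section normal_moments.
Local Open Scope ereal_scope.
Context (R : realType).
Implicit Types m s : R.
Local Notation TR := (measurableTypeR R).
Local Notation N := (@normal_prob R 0 1).

Let std_exp (b a : R) : (0 < 1 + 2 * a)%R ->
  \int[N]_x (expR (b * x - a * x ^+ 2))%:E =
  ((Num.sqrt (1 + 2 * a))^-1 * expR (b ^+ 2 / (2 * (1 + 2 * a))))%:E.
Proof.
move=> a0; have A0 : (0 < a + (2 * 1 ^+ 2)^-1 :> R)%R by rewrite expr1n; lra.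
have := normal_expR_quadratic 0 b 0 ltr01 A0.
under eq_integral do rewrite add0r.
move=> ->; congr (_ * expR _)%:E.
  by rewrite mul1r; congr ((Num.sqrt _)^-1)%R; rewrite expr1n; field.
rewrite expr1n expr0n /=; field.
by rewrite gt_eqF//; lra.
Qed.

Let measurable_quad (a b c : R) : measurable_fun [set: TR] (fun x : R => a + b * x + c * x ^+ 2)%R.
Proof.
by apply: measurable_funD; [apply: measurable_funD => //|]; apply: measurable_funM.
Qed.

Let std_sqr_integrable : N.-integrable setT (fun x => (x ^+ 2)%:E).
Proof.
(* x^2 <= 8 exp(x^2 / 8), and the right-hand side is integrable because 1/8 < 1/2. *)
apply: (@le_integrable _ TR R N setT measurableT _ (fun x => (8 * expR (0 * x - (- 8^-1) * x ^+ 2))%:E)).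
- by apply/measurable_EFinP; apply: measurable_funX.
- move=> x _; rewrite lee_fin !ger0_norm ?sqr_ge0 ?mulr_ge0 ?expR_ge0//.
  by have := @expR_ge1Dx R (0 * x - (- 8^-1) * x ^+ 2); lra.
apply/integrableP; split.
  apply/measurable_EFinP; apply: measurable_funM => //; apply: measurableT_comp => //.
  by apply: measurable_funB; apply: measurable_funM.
under eq_integral do rewrite /= ger0_norm ?mulr_ge0 ?expR_ge0// EFinM.
rewrite ge0_integralZl//; last first.
  apply/measurable_EFinP; apply: measurableT_comp => //.
  by apply: measurable_funB; apply: measurable_funM.
rewrite [X in _ * X]std_exp; last by lra.
by rewrite -EFinM ltry.
Qed.

Let std_id_integrable : N.-integrable setT (fun x => x%:E).
Proof.
apply: (@le_integrable _ TR R N setT measurableT _ (fun x => (1 + x ^+ 2)%:E)).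
- exact/measurable_EFinP.
- move=> x _; rewrite lee_fin [leRHS]ger0_norm ?addr_ge0 ?sqr_ge0//.
  have := sqr_ge0 (`|x| - 1 : R); rewrite -(@real_normK _ x) ?num_real//.
  by have := sqr_ge0 (`|x| + 1 : R); nra.
apply: (@integrableD _ TR R N setT measurableT (cst 1%E) (fun x => (x ^+ 2)%:E)) => //.
exact: finite_measure_integrable_cst.
Qed.

(** The tangent-line bound for exp(l f), integrated. Here [v] is an explicit exponential moment,
    whose expansion at l = 0 determines the integral of [f]. *)
Let std_moment (f : R -> R) (l v : R) : N.-integrable setT (fun x => (f x)%:E) ->
  measurable_fun setT f -> \int[N]_x (expR (l * f x))%:E = v%:E ->
  (1 + l * fine (\int[N]_x (f x)%:E) <= v)%R.
Proof.
move=> fi mf ev; have mexp : measurable_fun setT (fun x => (expR (l * f x))%:E).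
  apply/measurable_EFinP; apply: measurableT_comp => //.
  exact: measurable_funM.
have i1 : N.-integrable setT (cst 1%E : TR -> \bar R).
  exact: finite_measure_integrable_cst.
have i2 : N.-integrable setT (fun x => l%:E * (f x)%:E) by exact: integrableZl.
rewrite -lee_fin EFinD EFinM fineK; last exact: integrable_fin_num.
have -> : 1%:E = \int[N]_x (cst 1 x) :> \bar R.
  rewrite integral_cst// mul1e; exact/esym/(@probability_setT _ TR R N).
rewrite -integralZl//= -integralD//= -ev; apply: le_integral => //.
- exact: integrableD.
- apply/integrableP; split => //.
  under eq_integral do rewrite /= ger0_norm ?expR_ge0//.
  by rewrite ev ltry.
- by move=> x _; rewrite -EFinM -EFinD lee_fin expR_ge1Dx.
Qed.

Let std_mean : \int[N]_x x%:E = 0.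
Proof.
have fin := integrable_fin_num measurableT std_id_integrable.
rewrite -(fineK fin); congr EFin.
apply: (@eq0_quadratic_bound R 1 1) => // l l1.
have := @std_moment id l _ std_id_integrable (@measurable_id _ TR setT).
move=> /(_ (expR (l ^+ 2 / 2))).
have -> : \int[N]_x (expR (l * id x))%:E = (expR (l ^+ 2 / 2))%:E.
  transitivity (\int[N]_x (expR (l * x - 0 * x ^+ 2))%:E).
    by apply: eq_integral => x _; rewrite mul0r subr0.
  by rewrite std_exp ?mulr0 ?addr0 ?sqrtr1 ?invr1 ?mul1r ?mulr1.
move=> /(_ erefl) H; rewrite mul1r -(lerD2l 1); apply: le_trans H _.
have l2 : (l ^+ 2 <= 1)%R by rewrite -real_normK ?num_real// expr_le1.
have l20 := sqr_ge0 l.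
have := @expR_ge1Dx R (- (l ^+ 2 / 2)); rewrite expRN.
have := expR_gt0 (l ^+ 2 / 2).
set E := expR _ => E0 h.
have {h} : ((1 + - (l ^+ 2 / 2)) * E <= 1)%R by rewrite -ler_pdivlMr// div1r.
by nra.
Qed.

Let std_var : \int[N]_x (x ^+ 2)%:E = 1.
Proof.
have fin := integrable_fin_num measurableT std_sqr_integrable.
rewrite -(fineK fin); congr EFin; apply/eqP; rewrite -subr_eq0; apply/eqP.
apply: (@eq0_quadratic_bound R 4^-1 4) => // l l1.
have : (- 4^-1 <= l <= 4^-1)%R by rewrite -ler_norml.
move=> /andP[lm lM].
have l0 : (0 < 1 + 2 * (- l))%R by lra.
have := @std_moment (fun x => x ^+ 2)%R l _ std_sqr_integrable
  (@exprn_measurable R setT 2).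
move=> /(_ (Num.sqrt (1 + 2 * (- l)))^-1%R).
have -> : \int[N]_x (expR (l * x ^+ 2))%:E = ((Num.sqrt (1 + 2 * (- l)))^-1)%:E.
  transitivity (\int[N]_x (expR (0 * x - (- l) * x ^+ 2))%:E).
    by apply: eq_integral => x _; rewrite mul0r add0r mulNr opprK.
  by rewrite std_exp// expr0n/= mul0r expR0 mulr1.
move=> /(_ erefl) h.
rewrite mulrBr mulr1 lerBlDr -(lerD2l 1); apply: le_trans h _.
(* It remains to bound (1 - 2 l)^(-1/2) by 1 + l + 4 l^2. After squaring and clearing the
   denominator, the difference is l^2 (5 - 10 l - 32 l^3), which is nonnegative for |l| <= 1/4. *)
rewrite [leRHS](_ : _ = 1 + l + 4 * l ^+ 2)%R; last by ring.
rewrite -[leRHS]invrK lef_pV2 ?posrE ?sqrtr_gt0 ?invr_gt0//; last by nra.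
have p0 : (0 < 1 + l + 4 * l ^+ 2)%R by nra.
have q0 : (0 <= (1 + l + 4 * l ^+ 2)^-1)%R by rewrite invr_ge0 ltW.
rewrite -[leLHS](ger0_norm q0) -sqrtr_sqr ler_sqrt; last exact: ltW.
rewrite exprVn -[leLHS]div1r ler_pdivrMr ?exprn_gt0//.
rewrite -subr_ge0 (_ : _ - 1 = l ^+ 2 * (5 - 10 * l - 32 * l ^+ 3))%R; last by ring.
rewrite mulr_ge0 ?sqr_ge0//.
have l2 : (l ^+ 2 <= 16^-1)%R by nra.
have : (l ^+ 3 <= 64^-1)%R.
  by rewrite exprS; have := sqr_ge0 l; set q := (l ^+ 2)%R in l2 *; nra.
by set k := (l ^+ 3)%R; lra.
Qed.

Lemma normal_prob_affine_std m s (A : set TR) : (0 < s)%R -> measurable A ->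
  normal_prob m s A = image_measure N (maffine s m) A.
Proof.
move=> s0 mA; rewrite /image_measure /pushforward /= normal_prob_affine//.
by rewrite mulr0 add0r mulr1.
Qed.

Lemma normal_quadratic (m s a b c : R) : (0 < s)%R ->
  (normal_prob m s).-integrable setT (fun x => (a + b * x + c * x ^+ 2)%:E) /\
  \int[normal_prob m s]_x (a + b * x + c * x ^+ 2)%:E =
    (a + b * m + c * (m ^+ 2 + s ^+ 2))%:E.
Proof.
move=> s0.
have mf : measurable_fun [set: TR] (fun x : TR => (a + b * x + c * x ^+ 2)%:E).
  exact/measurable_EFinP.
have qE : ((fun x : TR => (a + b * x + c * x ^+ 2)%:E) \o maffine s m) =
    (fun x => (a + b * m + c * m ^+ 2)%:E + ((b * s + 2 * c * m * s)%:E * x%:E + (c * s ^+ 2)%:E * (x ^+ 2)%:E)).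
  by apply/funext => x /=; rewrite -!EFinM -!EFinD; congr EFin; ring.
have i1 : N.-integrable setT (cst (a + b * m + c * m ^+ 2)%:E : TR -> \bar R).
  exact: finite_measure_integrable_cst.
have i2 : N.-integrable setT (fun x => (b * s + 2 * c * m * s)%:E * x%:E).
  exact: integrableZl.
have i3 : N.-integrable setT (fun x => (c * s ^+ 2)%:E * (x ^+ 2)%:E).
  exact: integrableZl.
have i23 := integrableD measurableT i2 i3.
have intq : N.-integrable (maffine s m @^-1` setT)
    ((fun x : TR => (a + b * x + c * x ^+ 2)%:E) \o maffine s m).
  by rewrite qE preimage_setT; exact: (integrableD measurableT i1 i23).
have im : (image_measure N (maffine s m)).-integrable setT (fun x => (a + b * x + c * x ^+ 2)%:E).
  exact: integrable_pushforward.
split.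
  apply/integrableP; split => //.
  rewrite (@eq_measure_integral _ TR R setT (image_measure N (maffine s m))).
    by case/integrableP : im.
  by move=> A mA _; exact: normal_prob_affine_std.
rewrite (@eq_measure_integral _ TR R setT (image_measure N (maffine s m))); last first.
  by move=> A mA _; exact: normal_prob_affine_std.
rewrite [LHS]integral_pushforward// qE preimage_setT.
rewrite integralD// integralD// integralZl// integralZl// std_mean std_var.
rewrite integral_cst// [X in _ * X](@probability_setT _ TR R N) mule0 add0e !mule1 -EFinD; congr EFin; ring.
Qed.

End normal_moments.

(** * Gaussian vectors *)

Section gaussian_vector.
Local Open Scope ereal_scope.
Context (R : realType) (n : nat).
Local Notation V := 'rV[R]_n.
Local Notation TR := (measurableTypeR R).

Lemma is_gaussian_product_rule (m : V) (s : R) (nu : {finite_measure set V -> \bar R}) :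
  is_gaussian m s nu -> forall A : 'I_n -> set TR, (forall i, measurable (A i)) ->
  nu [set x | forall i, A i (mcoord R i x)] = \prod_i normal_prob (m ord0 i) s (A i).
Proof. by move=> + A mA => /(_ A mA). Qed.

Variables (m : V) (s : R) (nu : probability V R).
Hypotheses (s0 : (0 < s)%R) (gnu : is_gaussian m s nu).

Lemma gaussian_marginal (i : 'I_n) (A : set TR) : measurable A ->
  image_measure nu (mcoord R i) A = normal_prob (m ord0 i) s A.
Proof.
move=> mA; have := gnu (A := fun j => if j == i then A else setT).
rewrite (bigD1 i)//= eqxx big1 ?mule1; last first.
  by move=> j /negbTE ->; exact: probability_setT.
rewrite /image_measure /pushforward => <-; last by move=> j; case: ifP.
congr (nu _); apply/seteqP; split=> x /= h; last by have := h i; rewrite eqxx.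
by move=> j; case: eqVneq => // ->.
Qed.

Lemma gaussian_coord_quadratic (i : 'I_n) (a b c : R) :
  nu.-integrable setT (fun x : V => (a + b * x ord0 i + c * x ord0 i ^+ 2)%:E) /\
  \int[nu]_x (a + b * x ord0 i + c * x ord0 i ^+ 2)%:E =
    (a + b * m ord0 i + c * (m ord0 i ^+ 2 + s ^+ 2))%:E.
Proof.
have [qi qE] := normal_quadratic (m ord0 i) a b c s0.
have mq := measurable_int _ qi.
have law A : measurable A -> A `<=` [set: TR] ->
    normal_prob (m ord0 i) s A = image_measure nu (mcoord R i) A.
  by move=> mA _; rewrite gaussian_marginal.
have iq : nu.-integrable setT (fun x : V => (a + b * x ord0 i + c * x ord0 i ^+ 2)%:E).
  apply/(integrable_image nu (mcoord R i) mq); apply/integrableP; split => //.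
  by rewrite -(eq_measure_integral _ law); case/integrableP : qi.
by split=> //; rewrite -qE (eq_measure_integral _ law) integral_image.
Qed.

(** The log-density, the squared norm of its gradient, the transport potentials and the cost of the
    affine coupling are all sums of quadratics in one coordinate each, with a common leading
    coefficient. *)
Lemma gaussian_sum_quadratic (a b : 'I_n -> R) (c : R) :
  nu.-integrable setT (fun x : V => (\sum_i (a i + b i * x ord0 i + c * x ord0 i ^+ 2))%:E) /\
  \int[nu]_x (\sum_i (a i + b i * x ord0 i + c * x ord0 i ^+ 2))%:E =
    (\sum_i (a i + b i * m ord0 i + c * (m ord0 i ^+ 2 + s ^+ 2)))%:E.
Proof.
have qE (x : V) : (\sum_i (a i + b i * x ord0 i + c * x ord0 i ^+ 2))%:E =
   \sum_i (a i + b i * (x : V) ord0 i + c * x ord0 i ^+ 2)%:E.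
  by rewrite sumEFin.
have qi i := (gaussian_coord_quadratic i (a i) (b i) c).1.
split.
  by rewrite (funext qE); exact: integrable_sum.
under eq_integral do rewrite qE.
rewrite integral_sum// -sumEFin; apply: eq_bigr => i _.
exact: (gaussian_coord_quadratic i (a i) (b i) c).2.
Qed.

End gaussian_vector.

Section gaussian_density.
Local Open Scope ereal_scope.
Context (R : realType) (n : nat).
Local Notation V := 'rV[R]_n.
Local Notation TR := (measurableTypeR R).
Variables (m : V) (s r : R) (nu mu : probability V R).
Hypotheses (s0 : (0 < s)%R) (r0 : (0 < r)%R).
Hypotheses (gnu : is_gaussian m s nu) (gmu : is_gaussian 0 r mu).

(** Logarithm of the density of N(m_i, s^2) with respect to N(0, r^2), expanded in powers of [x] so
    that the lemmas on quadratics apply. *)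
Definition lratio (i : 'I_n) (x : R) : R :=
  (ln (r / s) - m ord0 i ^+ 2 / (2 * s ^+ 2) + m ord0 i / s ^+ 2 * x -
   ((2 * s ^+ 2)^-1 - (2 * r ^+ 2)^-1) * x ^+ 2)%R.

Definition log_density (x : V) : R := (\sum_i lratio i (x ord0 i))%R.

Lemma normal_pdf_lratio i x :
  (expR (lratio i x) * normal_pdf 0 r x)%R = normal_pdf (m ord0 i) s x.
Proof.
rewrite !normal_pdf_expR// mulrCA -expRD /lratio.
rewrite (_ : (_ + _)%R = (ln (r / s) + - (x - m ord0 i) ^+ 2 / (2 * s ^+ 2))%R); last first.
  by field; rewrite !gt_eqF.
rewrite expRD lnK ?posrE ?divr_gt0// mulrA; congr (_ * _)%R.
have : (0 < Num.sqrt (2 * @pi R))%R by rewrite sqrtr_gt0 mulr_gt0// pi_gt0.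
by generalize (Num.sqrt (2 * @pi R)) => p p0; field; rewrite !gt_eqF.
Qed.

Lemma measurable_expR_lratio (k : R) i : measurable_fun [set: TR] (fun x : R => expR (k * lratio i x)).
Proof.
apply: measurableT_comp => //; apply: measurable_funM => //.
by apply: measurable_funB; [apply: measurable_funD => //|]; apply: measurable_funM.
Qed.

Lemma measurable_log_density (k : R) : measurable_fun [set: V] (fun x => expR (k * log_density x)).
Proof.
rewrite (_ : (fun x => _) = (fun x : V => (\prod_i expR (k * lratio i (mcoord R i x)))%R)); last first.
  by apply/funext => x; rewrite /log_density mulr_sumr expR_sum.
apply: measurable_prod => i _.
exact: (measurableT_comp (measurable_expR_lratio k i) (measurable_funPT (mcoord R i))).
Qed.

Lemma integral_expR_log_density (k : R) (v : 'I_n -> R) :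
  (forall i, \int[normal_prob 0 r]_x (expR (k * lratio i x))%:E = (v i)%:E) ->
  \int[mu]_x (expR (k * log_density x))%:E = (\prod_i v i)%:E.
Proof.
move=> hv.
pose N (i : 'I_n) := [the {finite_measure set TR -> \bar R} of normal_prob ((0 : V) ord0 i) r].
pose f i x := expR (k * lratio i x).
have f0 i x : (0 <= f i x)%R by exact: expR_ge0.
have mf i : measurable_fun [set: TR] (f i) by exact: measurable_expR_lratio.
have fv i : \int[N i]_x (f i x)%:E = (v i)%:E by rewrite /N /= mxE hv.
rewrite -(@integral_prod_rule _ V R _ TR _ (mcoord R (n:=n)) N mu
  (is_gaussian_product_rule gmu) f v f0 mf fv).
by apply: eq_integral => x _; rewrite /log_density mulr_sumr expR_sum.
Qed.

(** On a box, the integrand times the indicator is a product of functions of one coordinate, so the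
    product rule computes the integral. Both sides are finite measures, hence agreement on boxes is
    enough. *)
Lemma gaussian_density (A : set V) : measurable A ->
  nu A = \int[mu]_(x in A) (expR (log_density x))%:E.
Proof.
have mrho : measurable_fun [set: V] (expR \o log_density).
  by have := measurable_log_density 1; under eq_fun do rewrite mul1r.
have box (B : 'I_n -> set TR) : (forall i, measurable (B i)) ->
    \int[mu]_(x in [set x : V | forall i, B i (mcoord R i x)]) (expR (log_density x))%:E =
    nu [set x : V | forall i, B i (mcoord R i x)].
  move=> mB; rewrite (is_gaussian_product_rule gnu)//.
  have fin i : normal_prob (m ord0 i) s (B i) \is a fin_num by exact: fin_num_measure.
  transitivity ((\prod_i fine (normal_prob (m ord0 i) s (B i)))%R%:E); last first.
    by rewrite -prodEFin; apply: eq_bigr => i _; rewrite fineK.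
  pose N (i : 'I_n) := [the {finite_measure set TR -> \bar R} of normal_prob ((0 : V) ord0 i) r].
  pose f i x := (expR (1 * lratio i x) * \1_(B i) x)%R.
  have f0 i x : (0 <= f i x)%R by rewrite mulr_ge0// expR_ge0.
  have mf i : measurable_fun [set: TR] (f i).
    apply: measurable_funM; first exact: measurable_expR_lratio.
    exact: measurable_indic.
  have fv i : \int[N i]_x (f i x)%:E = (fine (normal_prob (m ord0 i) s (B i)))%:E.
    have mfi : measurable_fun setT (EFin \o f i).
      by apply/measurable_EFinP; exact: mf.
    have fi0 x : 0 <= (EFin \o f i) x by rewrite lee_fin.
    rewrite fineK// /N /= mxE [LHS](ge0_integral_normal 0 r fi0 mfi).
    rewrite [RHS](normal_prob_indic (m ord0 i) s (mB i)); apply: eq_integral => x _.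
    by rewrite -!EFinM /f mul1r -normal_pdf_lratio mulrAC mulrC.
  rewrite -(@integral_prod_rule _ V R _ TR _ (mcoord R (n:=n)) N mu
    (is_gaussian_product_rule gmu) f _ f0 mf fv).
  rewrite integral_mkcond; apply: eq_integral => x _.
  rewrite patchE; case: ifPn => [|].
    rewrite inE => /= Bx; rewrite /log_density expR_sum; congr EFin.
    by apply: eq_bigr => i _; rewrite /f indicE mem_set ?mulr1 ?mul1r.
  move=> /negP; rewrite inE /= => /existsNP[i Bi].
  by rewrite (bigD1 i)//= /f indicE memNset// mulr0 mul0r.
have irho : mu.-integrable setT (EFin \o (expR \o log_density)).
  apply/integrableP; split; first exact/measurable_EFinP.
  have := box (fun=> setT) (fun=> measurableT).
  rewrite (_ : [set _ | _] = setT); last by apply/seteqP; split.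
  move=> E; under eq_integral do rewrite /= ger0_norm ?expR_ge0//.
  by rewrite E probability_setT ltry.
have [eta etaE] := density_measure_exists (fun x => expR_ge0 (log_density x)) irho.
move=> mA; rewrite -etaE//; apply: (eq_measure_boxes (m1 := nu)) => // B mB.
rewrite etaE; last exact: (measurable_box (mcoord R (n:=n))).
exact: (esym (box B mB)).
Qed.

End gaussian_density.

(** * Distances between a law and its exponential tilt *)

Section has_integral.
Local Open Scope ereal_scope.
Context d (T : measurableType d) (R : realType) (M : probability T R).
Implicit Types (f g : T -> R) (a v w c : R).

(** Bundles integrability with a real value, so that linear combinations and comparisons of
    integrals take place in [R]. *)
Definition has_integral f v :=
  M.-integrable setT (EFin \o f) /\ \int[M]_x (f x)%:E = v%:E.

Lemma has_integralD f g v w : has_integral f v -> has_integral g w ->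
  has_integral (fun x => f x + g x)%R (v + w)%R.
Proof.
move=> [fi fv] [gi gw]; split; first exact: (integrableD measurableT fi gi).
by under eq_integral do rewrite EFinD; rewrite integralD// fv gw.
Qed.

Lemma has_integralZ c f v : has_integral f v ->
  has_integral (fun x => c * f x)%R (c * v)%R.
Proof.
move=> [fi fv]; split; first exact: (integrableZl measurableT c fi).
by under eq_integral do rewrite EFinM; rewrite integralZl// fv.
Qed.

Lemma has_integral_cst c : has_integral (fun=> c) c.
Proof.
split; first exact: finite_measure_integrable_cst.
by rewrite integral_cst//= [X in _ * X](probability_setT M) mule1.
Qed.

Lemma has_integral_le f g v w : has_integral f v -> has_integral g w ->
  (forall x, f x <= g x)%R -> (v <= w)%R.
Proof.
move=> [fi fv] [gi gw] fg; rewrite -lee_fin -fv -gw.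
by apply: le_integral => // x _; rewrite lee_fin.
Qed.

Lemma has_integral_ge0 f v : (forall x, 0 <= f x)%R -> measurable_fun setT f ->
  \int[M]_x (f x)%:E = v%:E -> has_integral f v.
Proof.
move=> f0 mf fv; split=> //; apply/integrableP; split; first exact/measurable_EFinP.
by under eq_integral do rewrite /= ger0_norm//; rewrite fv ltry.
Qed.

Lemma eq_has_integral f g v : f =1 g -> has_integral f v -> has_integral g v.
Proof. by move=> /funext ->. Qed.

End has_integral.

Section divergences.
Local Open Scope ereal_scope.
Context (R : realType) (n : nat).
Local Notation V := 'rV[R]_n.
Variables (nu mu : probability V R) (L : V -> R).
Hypothesis mL : measurable_fun setT L.
Hypothesis nuE : forall A, measurable A -> nu A = \int[mu]_(x in A) (expR (L x))%:E.

Let mexp (k : R) : measurable_fun setT (fun x => expR (k * L x)).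
Proof. by apply: measurableT_comp => //; exact: measurable_funM. Qed.

Let mrho : measurable_fun setT (expR \o L).
Proof. exact: measurableT_comp. Qed.

Lemma has_integral_tilt (k v : R) :
  has_integral mu (fun x => expR ((1 + k) * L x)) v ->
  has_integral nu (fun x => expR (k * L x)) v.
Proof.
move=> [_ hv]; apply: has_integral_ge0 => [x|//|]; first exact: expR_ge0.
rewrite -hv (ge0_integral_density mrho nuE); last 2 first.
- by move=> x; rewrite lee_fin expR_ge0.
- exact/measurable_EFinP.
by apply: eq_integral => x _; rewrite -EFinM -expRD mulrDl mul1r addrC.
Qed.

Let has_integral0 : has_integral mu (fun x => expR (0 * L x)) 1.
Proof.
apply: eq_has_integral (has_integral_cst mu 1) => x.
by rewrite mul0r expR0.
Qed.

Let has_integral1 : has_integral mu (fun x => expR (L x)) 1.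
Proof.
apply: has_integral_ge0 => [x|//|]; first exact: expR_ge0.
by rewrite -nuE// probability_setT.
Qed.

Variables (a v : R).
Hypothesis ha : has_integral mu (fun x => expR (2^-1 * L x)) a.
Hypothesis hv : has_integral mu (fun x => expR (2 * L x)) v.

Hypothesis a0 : (0 < a)%R.

Lemma sqr_tilt_ge1 : (1 <= v)%R.
Proof.
have h := has_integralD hv (has_integral_cst mu 1).
have := has_integral_le (has_integralZ 2 has_integral1) h _.
rewrite mulr1 => H; suff : (2 <= v + 1)%R by lra.
apply: H => x; rewrite expRM_natl.
by have := sqr_ge0 (expR (L x) - 1); nra.
Qed.

Lemma density_expR : ae_eq mu setT (density nu mu) (fun x => (expR (L x))%:E).
Proof. exact: (Radon_Nikodym_density mrho nuE). Qed.

Lemma dominates_expR : nu `<< mu.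
Proof. exact: (density_dominates mrho nuE). Qed.

Lemma densityK x : density nu mu x = (fine (density nu mu x))%:E.
Proof. by rewrite fineK//; apply: Radon_Nikodym_fin_num; exact: dominates_expR. Qed.

Lemma measurable_fine_density : measurable_fun setT (fun x => fine (density nu mu x)).
Proof.
apply: (measurableT_comp (fine_measurable measurableT)).
by apply: measurable_int; apply: Radon_Nikodym_integrable; exact: dominates_expR.
Qed.

Lemma chi2E : chi2 nu mu = (v - 1)%:E.
Proof.
rewrite /chi2; case: asboolP => [_|]; last by have := dominates_expR.
have h : has_integral mu (fun x => (expR (L x) - 1) ^+ 2)%R (v + -2 * 1 + 1)%R.
  apply: eq_has_integral (has_integralD (has_integralD hv
    (has_integralZ (-2) has_integral1)) (has_integral_cst mu 1)) => x.
  by rewrite expRM_natl; ring.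
transitivity (\int[mu]_x ((expR (L x) - 1) ^+ 2)%:E).
  apply: ae_eq_integral => //.
  - rewrite (_ : (fun x => _) = fun x => (`|fine (density nu mu x) - 1| ^+ 2)%:E).
      apply/measurable_EFinP; apply: measurable_funX; apply: measurableT_comp => //.
      by apply: measurable_funB => //; exact: measurable_fine_density.
    by apply/funext => x; rewrite densityK.
  - by case: h => /measurable_int.
  - apply: filterS density_expR => x /[apply] ->.
    by rewrite -EFinB abse_EFin -EFin_expe real_normK ?num_real.
by rewrite h.2; congr EFin; ring.
Qed.

Hypothesis hL : exists w, has_integral nu L w.

Lemma kullbackE w : has_integral nu L w -> kullback nu mu = w%:E.
Proof.
move=> [Li <-]; rewrite /kullback.
case: asboolP => [_|]; last by have := dominates_expR.
apply: ae_eq_integral => //.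
- rewrite (_ : (fun x => _) = fun x => if (fine (density nu mu x) <= 0)%R then -oo
      else (ln (fine (density nu mu x)))%:E).
    apply: measurable_fun_ifT => //.
      by apply: measurable_fun_ler => //; exact: measurable_fine_density.
    apply/measurable_EFinP; exact: (measurableT_comp (@measurable_ln R) measurable_fine_density).
  by apply/funext => x; rewrite densityK.
- exact: measurable_int Li.
- apply: (null_dominates_ae_eq _ dominates_expR) => //.
  apply: filterS density_expR => x /[apply] ->.
  by rewrite lne_EFin ?expR_gt0 ?expRK.
Qed.

(** Tangent-line bounds integrated against [nu]: 1 - exp(- L) <= L <= exp L - 1, and 1 + x <= exp x
    at x = - L / 2 - ln a, which amounts to Jensen's inequality for the logarithm. A moment of order
    k under [nu] is one of order 1 + k under [mu]. *)
Lemma kullback_bounds : exists w, kullback nu mu = w%:E /\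
  [/\ 0 <= w, w <= v - 1 & - 2 * ln a <= w]%R.
Proof.
have [w hw] := hL; exists w; split; first exact: kullbackE.
split.
- have hm : has_integral nu (fun x => expR (-1 * L x)) 1.
    by apply: has_integral_tilt; rewrite subrr.
  have := has_integral_le (has_integralD (has_integral_cst nu 1)
    (has_integralZ (-1) hm)) hw.
  rewrite mulr1 subrr; apply => x.
  by have := expR_ge1Dx (-1 * L x); lra.
- have h1 : has_integral nu (fun x => expR (1 * L x)) v by exact: has_integral_tilt.
  have := has_integral_le hw (has_integralD h1 (has_integral_cst nu (-1))).
  by apply => x; have := expR_ge1Dx (L x); rewrite mul1r; lra.
- have hm : has_integral nu (fun x => expR ((- 2^-1) * L x)) a.
    apply: has_integral_tilt; rewrite (_ : (1 + - 2^-1 = 2^-1)%R)//; lra.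
  have := has_integral_le (has_integralD (has_integral_cst nu (- 2 * ln a + 2))
    (has_integralZ (- 2 / a) hm)) hw.
  rewrite mulfVK ?gt_eqF// addrK; apply => x.
  have := expR_ge1Dx ((- 2^-1) * L x - ln a).
  rewrite expRD expRN lnK ?posrE// mulrAC -mulrA; lra.
Qed.

Lemma affinity_le1 : (a <= 1)%R.
Proof.
have := has_integral_le (has_integralZ 2 ha)
  (has_integralD has_integral1 (has_integral_cst mu 1)) _.
move=> H; suff : (2 * a <= 1 + 1)%R by lra.
apply: H => x; rewrite (_ : L x = 2 * (2^-1 * L x))%R; last by field.
rewrite expRM_natl mulrA mulVf// mul1r.
by have := sqr_ge0 (expR (2^-1 * L x) - 1); nra.
Qed.

Lemma has_integral_indic (A : set V) : measurable A ->
  has_integral mu (\1_A : V -> R) (fine (mu A)).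
Proof.
move=> mA; apply: has_integral_ge0 => //.
by rewrite integral_indic// setIT fineK// fin_num_measure.
Qed.

Lemma has_integral_indic_density (A : set V) : measurable A ->
  has_integral mu (fun x => \1_A x * expR (L x))%R (fine (nu A)).
Proof.
move=> mA; apply: has_integral_ge0.
- by move=> x; rewrite mulr_ge0// expR_ge0.
- by apply: measurable_funM => //; exact: measurable_indic.
rewrite fineK ?fin_num_measure// nuE// [RHS]integral_mkcond; apply: eq_integral => x _.
by rewrite patchE indicE; case: ifP => _; rewrite ?mul1r ?mul0r.
Qed.

Let diff (A : set V) := (fine (nu A) - fine (mu A))%R.

Let diffE A : measurable A -> `|nu A - mu A| = `|diff A|%:E.
Proof.
move=> mA; rewrite -[in LHS](@fineK _ (nu A)) ?fin_num_measure//.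
by rewrite -[in LHS](@fineK _ (mu A)) ?fin_num_measure// -EFinB.
Qed.

Let has_integral_diff A : measurable A ->
  has_integral mu (fun x => \1_A x * expR (L x) + -1 * \1_A x)%R (diff A).
Proof.
move=> mA; rewrite /diff -[X in (_ - X)%R]mul1r -mulNr.
apply: has_integralD; first exact: has_integral_indic_density.
by apply: has_integralZ; exact: has_integral_indic.
Qed.

Let diff_le1 A : measurable A -> (`|diff A| <= 1)%R.
Proof.
move=> mA; have fine01 (m : probability V R) : (0 <= fine (m A) <= 1)%R.
  rewrite fine_ge0//= -lee_fin fineK ?fin_num_measure//.
  exact: probability_le1.
rewrite ler_norml /diff; have := fine01 nu; have := fine01 mu.
by move=> /andP[? ?] /andP[? ?]; apply/andP; split; lra.
Qed.

(** Cauchy-Schwarz in pointwise form: 2 t 1_A (rho - 1) <= t^2 + (rho - 1)^2 with rho = exp L and t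
    = [diff A], integrated against [mu]. *)
Let diff_sqr A : measurable A -> (diff A ^+ 2 <= v - 1)%R.
Proof.
move=> mA; set t := diff A.
have h2 := has_integralD (has_integralD (has_integral_cst mu (t ^+ 2 + 1)) hv)
  (has_integralZ (-2) has_integral1).
have := has_integral_le (has_integralZ (2 * t) (has_integral_diff mA)) h2 _.
rewrite -/t => H; suff : (2 * t * t <= t ^+ 2 + 1 + v + -2 * 1)%R by lra.
apply: H => x; rewrite expRM_natl indicE; case: (_ \in _) => /=.
  by have := sqr_ge0 (t - (expR (L x) - 1)); lra.
by have := sqr_ge0 (expR (L x) - 1); have := sqr_ge0 t; lra.
Qed.

(** With rho = exp L, the pointwise inequality is rho - sqrt rho <= 1_{rho >= 1} (rho - 1): sqrt rho
    is at least 1 where rho >= 1, and at least rho where rho < 1. *)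
Let diff_lower : (1 - a <= diff [set x | 0 <= L x])%R.
Proof.
have mA : measurable [set x | (0 <= L x)%R].
  by rewrite -[X in measurable X]setTI; apply: measurable_fun_ler.
have := has_integral_le (has_integralD has_integral1 (has_integralZ (-1) ha))
  (has_integral_diff mA) _.
rewrite mulN1r; apply => x; rewrite indicE.
have eL : expR (L x) = (expR (2^-1 * L x) ^+ 2)%R.
  by rewrite -expRM_natl mulrA divff// mul1r.
have [L0|L0] := leP 0%R (L x).
  rewrite mem_set//=; have : (1 <= expR (2^-1 * L x))%R.
    by rewrite -[leLHS]expR0 ler_expR mulr_ge0.
  by lra.
rewrite memNset/=; last by rewrite leNgt L0.
have : (expR (2^-1 * L x) <= 1)%R by rewrite expR_le1 nmulr_lle0.
by have := expR_gt0 (2^-1 * L x); rewrite eL; nra.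
Qed.

Lemma total_variation_bounds : exists w, Defs.total_variation nu mu = w%:E /\
  [/\ 1 - a <= w, w <= 1 & w <= Num.sqrt (v - 1)]%R.
Proof.
have ub (c : R) : (forall A, measurable A -> (`|diff A| <= c)%R) ->
    Defs.total_variation nu mu <= c%:E.
  by move=> h; apply: ge_ereal_sup => _ [A mA <-]; rewrite diffE// lee_fin h.
have lb A : measurable A -> `|diff A|%:E <= Defs.total_variation nu mu.
  by move=> mA; apply: ereal_sup_ubound; exists A => //; rewrite diffE.
have mA : measurable [set x | (0 <= L x)%R].
  by rewrite -[X in measurable X]setTI; apply: measurable_fun_ler.
have fin : Defs.total_variation nu mu \is a fin_num.
  rewrite ge0_fin_numE; last exact: le_trans (lb _ mA).
  by apply: le_lt_trans (ub _ diff_le1) _; rewrite ltry.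
exists (fine (Defs.total_variation nu mu)); rewrite fineK//; split=> //.
rewrite -!lee_fin fineK//; split.
- by apply: le_trans (lb _ mA); rewrite lee_fin (le_trans diff_lower)// ler_norm.
- exact: ub diff_le1.
- by apply: ub => A mA'; rewrite -sqrtr_sqr ler_wsqrtr// diff_sqr.
Qed.

Let integral_reference (f : V -> R) : (forall x, 0 <= f x)%R -> measurable_fun setT f ->
  \int[reference_measure nu mu]_x (f x)%:E = \int[mu]_x (f x * (1 + expR (L x)))%:E.
Proof.
move=> f0 mf; have mfE : measurable_fun setT (EFin \o f) by exact/measurable_EFinP.
have fE0 x : 0 <= (EFin \o f) x by rewrite lee_fin.
rewrite [LHS]ge0_integral_measure_add//.
rewrite [X in X + _](ge0_integral_density mrho nuE fE0 mfE) addeC -ge0_integralD//.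
- by apply: eq_integral => x _; rewrite mulrDr mulr1 EFinD EFinM.
- by move=> x _; exact: fE0.
- by move=> x _; rewrite -EFinM lee_fin mulr_ge0// expR_ge0.
- by apply/measurable_EFinP; exact: measurable_funM.
- by move=> x _; exact: fE0.
Qed.

Let one_expR_gt0 x : (0 < 1 + expR (L x))%R.
Proof. by rewrite addr_gt0// expR_gt0. Qed.

Let measurable_div (g : V -> R) : measurable_fun setT g ->
  measurable_fun setT (fun x => g x / (1 + expR (L x)))%R.
Proof.
move=> mg.
rewrite (_ : (fun x => _) = (fun x => g x * expR (- ln (1 + expR (L x))))%R); last first.
  by apply/funext => x; rewrite expRN lnK ?posrE.
apply: measurable_funM => //; apply: measurableT_comp => //.
apply: measurableT_comp => //; apply: (measurableT_comp (@measurable_ln R)).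
exact: measurable_funD.
Qed.

Let reference_densityE (m : probability V R) (g : V -> R) :
  measurable_fun setT g -> (forall x, 0 <= g x)%R ->
  (forall A, measurable A -> m A = \int[mu]_(x in A) (g x)%:E) ->
  forall A, measurable A ->
  m A = \int[reference_measure nu mu]_(x in A) (g x / (1 + expR (L x)))%:E.
Proof.
move=> mg g0 mE A mA; rewrite mE// integral_mkcond [RHS]integral_mkcond.
have gA0 x : (0 <= ((fun x => g x / (1 + expR (L x))) \_ A) x)%R.
  by rewrite patchE; case: ifP => // _; rewrite divr_ge0// ltW.
have mgA : measurable_fun setT ((fun x => g x / (1 + expR (L x))) \_ A)%R.
  by apply/(measurable_restrictT _ mA)/measurable_funTS; exact: measurable_div.
transitivity (\int[reference_measure nu mu]_x
    (((fun x => g x / (1 + expR (L x)))%R \_ A) x)%:E); last first.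
  by apply: eq_integral => x _; rewrite restrict_EFin.
rewrite integral_reference//; apply: eq_integral => x _.
rewrite !patchE; case: ifP => _; last by rewrite mul0r.
by rewrite divfK// gt_eqF.
Qed.

(** With rho = exp L, the densities with respect to nu + mu are rho / (1 + rho) and 1 / (1 + rho).
    Their geometric mean is sqrt rho / (1 + rho), and nu + mu has density 1 + rho with respect to
    [mu], which cancels the denominator. *)
Lemma hellingerE : hellinger nu mu = (Num.sqrt (1 - a))%:E.
Proof.
pose la := [the {sigma_finite_measure set V -> \bar R} of reference_measure nu mu].
have nuE' := reference_densityE mrho (fun x => expR_ge0 (L x)) nuE.
have muE' : forall A, measurable A -> mu A = \int[la]_(x in A) (1 / (1 + expR (L x)))%:E.
  apply: (reference_densityE (g := fun=> 1%R)) => // A mA.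
  by rewrite integral_cst// mul1e.
have m1 := measurable_div mrho.
have m2 : measurable_fun setT (fun x => 1 / (1 + expR (L x)))%R.
  exact: measurable_div.
have d1 : ae_eq la setT (density nu la) (fun x => (expR (L x) / (1 + expR (L x)))%:E).
  exact: (Radon_Nikodym_density m1 nuE').
have d2 : ae_eq la setT (density mu la) (fun x => (1 / (1 + expR (L x)))%:E).
  exact: (Radon_Nikodym_density m2 muE').
have e x : ((expR (L x) / (1 + expR (L x)))%:E * (1 / (1 + expR (L x)))%:E) `^ 2^-1 =
    (expR (2^-1 * L x) / (1 + expR (L x)))%:E.
  have p := one_expR_gt0 x.
  have -> : (expR (L x) / (1 + expR (L x)))%:E * (1 / (1 + expR (L x)))%:E =
      ((expR (2^-1 * L x) / (1 + expR (L x))) ^+ 2)%:E.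
    have eL : (expR (2^-1 * L x) ^+ 2 = expR (L x))%R.
      by rewrite -expRM_natl mulrA divff// mul1r.
    rewrite -EFinM expr_div_n eL; congr EFin.
    by field; rewrite gt_eqF.
  rewrite poweR_EFin powR12_sqrt ?sqr_ge0// sqrtr_sqr ger0_norm//.
have md1 : measurable_fun setT (density nu la).
  by apply: measurable_int; apply: Radon_Nikodym_integrable; exact: (density_dominates m1 nuE').
have md2 : measurable_fun setT (density mu la).
  by apply: measurable_int; apply: Radon_Nikodym_integrable; exact: (density_dominates m2 muE').
have E : \int[la]_x ((density nu la x * density mu la x) `^ 2^-1) = a%:E.
  transitivity (\int[la]_x (expR (2^-1 * L x) / (1 + expR (L x)))%:E).
    apply: ae_eq_integral => //.
    - apply: (measurableT_comp (measurable_poweR 2^-1)).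
      exact: emeasurable_funM.
    - by apply/measurable_EFinP; exact: measurable_div.
    - by apply: filterS2 d1 d2 => x + + xT => /(_ xT) -> /(_ xT) ->; rewrite e.
  rewrite [LHS]integral_reference; last 2 first.
  - by move=> x; rewrite divr_ge0 ?expR_ge0// ltW.
  - exact: measurable_div.
  by rewrite -ha.2; apply: eq_integral => x _; rewrite divfK// gt_eqF.
rewrite /hellinger [X in (1 - X) `^ _]E -EFinB poweR_EFin powR12_sqrt//.
by rewrite subr_ge0 affinity_le1.
Qed.

End divergences.

(** * The law of the Ornstein-Uhlenbeck process *)

Section riemann_sum.
Context (R : realType).

Lemma unif_continuous_segment (f : R -> R) (t e : R) :
  {within `[0, +oo[, continuous f} -> 0 < e ->
  exists2 dl : R, 0 < dl & forall x y, 0 <= x <= t -> 0 <= y <= t ->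
    `|x - y| < dl -> `|f x - f y| < e.
Proof.
move=> /subspace_continuousP cf e0.
have e20 : 0 < e / 2 by rewrite divr_gt0.
pose Q (k : nat) (x : R) := 0 <= x <= t ->
  forall y, 0 <= y <= t -> `|x - y| < k.+1%:R^-1 -> `|f x - f y| < e.
have : \forall k \near \oo, `[0, t]%classic `<=` Q k.
  have /compact_near_coveringP cov := @segment_compact R 0 t.
  apply: cov => x /=; rewrite in_itv/= => xt.
  have x0 : `[0, +oo[%classic x by move: xt; rewrite /= in_itv/= andbT => /andP[].
  have /cvgrPdist_lt /(_ _ e20) := cf x x0.
  rewrite near_withinE => /nbhs_ballP[r/= r0 rf].
  have r20 : 0 < r / 2 by rewrite divr_gt0.
  exists (ball x (r / 2), [set k | k.+1%:R^-1 < r / 2]) => /=.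
    split; first exact: nbhsx_ballx.
    exact: (near_infty_natSinv_lt (PosNum r20)).
  move=> [x' k] /= [xx' kr] x't y yt x'y.
  have h1 : `|f x - f x'| < e / 2.
    apply: rf; first by apply: le_ball xx'; lra.
    by move: x't; rewrite in_itv/= andbT => /andP[].
  have h2 : `|f x - f y| < e / 2.
    apply: rf; last by move: yt; rewrite in_itv/= andbT => /andP[].
    rewrite [r]splitr; apply: ball_triangle xx' _.
    by rewrite /ball/=; exact: lt_trans kr.
  rewrite (_ : f x' - f y = (f x - f y) - (f x - f x')); last by ring.
  by apply: le_lt_trans (ler_normB _ _) _; rewrite [e]splitr ltrD.
move=> [k _ hk]; exists k.+1%:R^-1 => // x y xt yt.
by apply: (hk k) => //=; rewrite in_itv.
Qed.

Lemma integral_increment (f : R -> R) (r r' c e : R) :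
  {within `[0, +oo[, continuous f} -> 0 <= r -> r <= r' ->
  (forall x, r <= x <= r' -> `|f x - c| <= e) ->
  `|\int[lebesgue_measure]_(x in `[0, r']) f x -
    \int[lebesgue_measure]_(x in `[0, r]) f x - c * (r' - r)| <= e * (r' - r).
Proof.
move=> cf r0 rr' fe.
have fi : lebesgue_measure.-integrable `[0, r'] (EFin \o f).
  apply: continuous_compact_integrable; first exact: segment_compact.
  apply: continuous_subspaceW cf => x /=; rewrite !in_itv/= andbT.
  by move=> /andP[].
have fi' : lebesgue_measure.-integrable `]r, r'] (EFin \o f).
  apply: integrableS fi => //; apply: subset_itvr.
  by rewrite bnd_simp.
rewrite Rintegral_itvB//.
have mu r1 : \int[lebesgue_measure]_(x in `]r, r']) r1 = r1 * (r' - r).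
  rewrite Rintegral_cst//= lebesgue_measure_itv/= lte_fin.
  case: ltP => //= h; rewrite (_ : r' = r) ?subrr//.
  by apply/eqP; rewrite eq_le h rr'.
have ci r1 : lebesgue_measure.-integrable `]r, r'] (EFin \o (fun=> r1 : R)).
  have ci0 : lebesgue_measure.-integrable `[0, r'] (EFin \o (fun=> r1 : R)).
    apply: continuous_compact_integrable; first exact: segment_compact.
    by apply: continuous_subspaceT => x; exact: cvg_cst.
  apply: integrableS ci0 => //; apply: subset_itvr.
  by rewrite bnd_simp.
have up : \int[lebesgue_measure]_(x in `]r, r']) f x <= (c + e) * (r' - r).
  rewrite -mu; apply: le_Rintegral => // x /=; rewrite in_itv/= => /andP[rx xr'].
  have := fe x; rewrite (ltW rx) xr' => /(_ isT); rewrite ler_norml => /andP[_].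
  lra.
have lo : (c - e) * (r' - r) <= \int[lebesgue_measure]_(x in `]r, r']) f x.
  rewrite -mu; apply: le_Rintegral => // x /=; rewrite in_itv/= => /andP[rx xr'].
  have := fe x; rewrite (ltW rx) xr' => /(_ isT); rewrite ler_norml => /andP[+ _].
  lra.
move: up lo; set J := \int[_]_(x in _) _; rewrite mulrDl mulrBl.
move: J (c * _) (e * _); clear => J x y up lo.
by rewrite ler_norml; apply/andP; split; lra.
Qed.

Variables (z b : R -> R) (z0 sigma t : R).
Hypothesis t0 : 0 < t.
Hypothesis cz : {within `[0, +oo[, continuous z}.
Hypothesis b0 : b 0 = 0.
Hypothesis zE : forall r, 0 <= r ->
  z r = z0 + sigma * b r - \int[lebesgue_measure]_(x in `[0, r]) z x.

Definition grid (N j : nat) : R := t * j%:R / N.+1%:R.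
Let wgt N j : R := expR (grid N j - t).

Lemma grid0 N : grid N 0 = 0. Proof. by rewrite /grid mulr0 mul0r. Qed.

Lemma gridN N : grid N N.+1 = t. Proof. by rewrite /grid mulfK. Qed.

Lemma gridS N j : grid N j.+1 - grid N j = t / N.+1%:R.
Proof. by rewrite /grid -mulrBl -mulrBr -natr1 addrAC subrr add0r mulr1. Qed.

Lemma grid_ge0 N j : 0 <= grid N j.
Proof. by rewrite /grid !mulr_ge0 ?invr_ge0// ltW. Qed.

Lemma grid_le N j : grid N j <= grid N j.+1.
Proof. by rewrite -subr_ge0 gridS divr_ge0// ltW. Qed.

Lemma grid_le_t N j : (j <= N.+1)%N -> grid N j <= t.
Proof.
by move=> jN; rewrite /grid ler_pdivrMr// ler_pM2l// ler_nat.
Qed.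

(* Abel summation: the error of the weighted increments against the telescoping
   sum of [w_j z_j] only involves the drift, so that no regularity of [b] is
   needed. *)
Lemma ou_riemann_sum :
  (fun N => \sum_(j < N.+1) expR (grid N j - t) * (sigma * (b (grid N j.+1) - b (grid N j))))
    @ \oo --> z t - expR (- t) * z0.
Proof.
have [M M0 zM] : exists2 M, 0 < M & forall x, 0 <= x <= t -> `|z x| <= M.
  have cz' : {within `[0, t], continuous z}.
    apply: continuous_subspaceW cz => x /=; rewrite !in_itv/= andbT.
    by move=> /andP[].
  have [c1 _ hc1] := EVT_max (ltW t0) cz'.
  have [c2 _ hc2] := EVT_min (ltW t0) cz'.
  exists (1 + `|z c1| + `|z c2|).
    by have := normr_ge0 (z c1); have := normr_ge0 (z c2); lra.
  move=> x xt; have x0t : x \in `[0, t] by rewrite in_itv.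
  have := hc1 _ x0t; have := hc2 _ x0t.
  have := ler_norm (z c1); have := lerNnormlW (lexx `|z c2|).
  have := normr_ge0 (z c1); have := normr_ge0 (z c2).
  rewrite ler_norml => *; apply/andP; split; lra.
apply/cvgrPdist_le => e e0.
have e20 : 0 < e / (2 * t) by rewrite divr_gt0// mulr_gt0.
have [dl dl0 zdl] := unif_continuous_segment t cz e20.
have Mt0 : 0 < 2 * M * t by rewrite !mulr_gt0.
have small c : 0 < c -> \forall N \near \oo, t / N.+1%:R < c.
  move=> c0; have ct0 : 0 < c / t by rewrite divr_gt0.
  have := near_infty_natSinv_lt (PosNum ct0).
  by apply: filterS => N /=; rewrite ltr_pdivlMr// mulrC.
near=> N.
pose h := t / N.+1%:R.
have h0 : 0 < h by rewrite divr_gt0.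
have hdl : h < dl by rewrite /h; near: N; exact: small.
have h2 : h <= 2^-1 by rewrite /h; apply: ltW; near: N; exact: small.
have hM : 2 * M * t * h <= e / 2.
  rewrite mulrC -ler_pdivlMr//; apply: ltW; rewrite /h; near: N; apply: small.
  by rewrite !divr_gt0.
have sumh : \sum_(j < N.+1) h = t.
  by rewrite sumr_const card_ord -mulr_natr divfK.
have -> : z t - expR (- t) * z0 =
    \sum_(j < N.+1) (wgt N j.+1 * z (grid N j.+1) - wgt N j * z (grid N j)).
  have := @telescope_sumr _ 0 N.+1 (fun j => wgt N j * z (grid N j)) (leq0n _).
  rewrite big_mkord => ->; rewrite /wgt gridN grid0 subrr expR0 mul1r sub0r.
  by rewrite (zE (lexx 0)) b0 mulr0 addr0 set_itv1 Rintegral_set1 subr0.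
rewrite -sumrB; apply: le_trans (ler_norm_sum _ _ _) _.
(* The first term pays for the oscillation of [z] over one step and sums to e / 2; the second pays
   for exp h - 1 - h and sums to 2 M t h <= e / 2. *)
apply: (@le_trans _ _ (\sum_(j < N.+1) ((e / (2 * t)) * h + M * (2 * h * h)))).
  apply: ler_sum => j _.
  have jN : (j < N.+1)%N by [].
  set r := grid N j; set r' := grid N j.+1.
  have rr' : r <= r' by exact: grid_le.
  have r0 : 0 <= r by exact: grid_ge0.
  have r't : r' <= t by exact: grid_le_t.
  have hE : r' - r = h by rewrite /r' /r gridS.
  have I := @integral_increment z r r' (z r') (e / (2 * t)) cz r0 rr' _.
  have {}I : `|\int[lebesgue_measure]_(x in `[0, r']) z x -
      \int[lebesgue_measure]_(x in `[0, r]) z x - z r' * h| <= e / (2 * t) * h.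
    rewrite -hE; apply: I => x /andP[rx xr'].
    apply/ltW/zdl; rewrite ?(le_trans r0 rr') ?r't ?(le_trans r0 rx) ?(le_trans xr' r't)//.
    by rewrite ler0_norm ?subr_le0// opprB (le_lt_trans _ hdl)// -hE lerB.
  have wE : wgt N j.+1 = expR h * wgt N j.
    by rewrite /wgt -expRD -hE /r /r'; congr expR; ring.
  have w1 : wgt N j <= 1.
    by rewrite /wgt expR_le1 subr_le0 (le_trans rr').
  have w0 : 0 < wgt N j by exact: expR_gt0.
  have r'0 : 0 <= r' := le_trans r0 rr'.
  have zr'M : `|z r'| <= M by apply: zM; rewrite r'0.
  (* The upper bound comes from (1 - h) exp h <= 1 and h <= 1/2. *)
  have eh : `|expR h - 1 - h| <= 2 * h * h.
    have e1 := expR_ge1Dx h; have e2 := expR_ge1Dx (- h).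
    rewrite expRN in e2; rewrite ger0_norm; last by lra.
    have : (1 - h) * expR h <= 1 by rewrite -ler_pdivlMr ?expR_gt0// div1r.
    by nra.
  set I0 := \int[_]_(x in _) _ - _ in I.
  (* The integral equation replaces the noise increment by the increment of [z] plus the drift
     integral. What remains compares exp h - 1 with h, and the drift integral with h z(r'). *)
  have -> : wgt N j.+1 * z r' - wgt N j * z r -
      expR (r - t) * (sigma * (b r' - b r)) =
      wgt N j * ((expR h - 1 - h) * z r' - (I0 - z r' * h)).
    by rewrite wE /I0 (zE r'0) (zE r0) -/(wgt N j) /wgt -/r; ring.
  rewrite normrM (gtr0_norm w0).
  apply: (@le_trans _ _ (1 * `|(expR h - 1 - h) * z r' - (I0 - z r' * h)|)).
    by rewrite ler_wpM2r.
  rewrite mul1r; apply: le_trans (ler_normB _ _) _; rewrite addrC lerD//.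
  by rewrite normrM mulrC ler_pM.
have sum2 : \sum_(j < N.+1) M * (2 * h * h) = 2 * M * t * h.
  by rewrite sumr_const card_ord -mulr_natr /h; field.
rewrite big_split/= -mulr_sumr sumh sum2.
rewrite (_ : e / (2 * t) * t = e / 2); last by field; rewrite gt_eqF.
by rewrite [leRHS]splitr lerD2l.
Unshelve. all: by end_near. Qed.

End riemann_sum.

(** * Sums of independent centred Gaussian vectors *)

Section sum_of_gaussians.
Local Open Scope ereal_scope.
Context (R : realType) d (Om : measurableType d) (P : probability Om R) (n k : nat).
Local Notation V := 'rV[R]_n.
Local Notation TR := (measurableTypeR R).
Variables (Y : nat -> {mfun Om >-> V}) (s : nat -> R).
Hypothesis s0 : forall l, (l < k)%N -> (0 < s l)%R.
Hypothesis indepY : mutually_independent P (fun i : 'I_k => Y i : Om -> V).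
Hypothesis gY : forall l, (l < k)%N -> is_gaussian 0 (s l) (pushforward P (Y l)).

Let S (j : nat) (w : Om) : V := (\sum_(l < j) Y l w)%R.

Let mY l i : measurable_fun [set: Om] (fun w => Y l w ord0 i).
Proof. exact: (measurableT_comp (measurable_coord i) (measurable_funPT (Y l))). Qed.

Let mS j i : measurable_fun [set: Om] (fun w => S j w ord0 i).
Proof.
rewrite (_ : (fun w => _) = fun w => (\sum_(l < j) Y l w ord0 i)%R).
  by apply: measurable_sum => l; exact: mY.
by apply/funext => w; rewrite summxE.
Qed.

Let pair_mfun j i : {mfun Om >-> (TR * TR)%type} :=
  @mfun_Sub _ _ Om (TR * TR)%type (fun w => (S j w ord0 i, Y j w ord0 i))
    (mem_set (measurable_fun_pair (mS j i : @measurable_fun _ _ Om TR setT _)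
                                 (mY j i : @measurable_fun _ _ Om TR setT _))).

Let tau (j : nat) : R := Num.sqrt (\sum_(l < j) s l ^+ 2).

Definition rectangles : set (set (TR * TR)) :=
  [set A `*` B | A in measurable & B in measurable].

Lemma setI_rectangles : setI_closed rectangles.
Proof.
move=> _ _ [A mA [B mB <-]] [A' mA' [B' mB' <-]].
exists (A `&` A'); first exact: measurableI.
by exists (B `&` B'); [exact: measurableI|rewrite setXI].
Qed.

Let tail j (C : nat -> 'I_n -> set TR) : set Om :=
  [set w | forall l, (j <= l < k)%N -> forall i, C l i (Y l w ord0 i)].

Let measurable_tail j C : (forall l i, measurable (C l i)) -> measurable (tail j C).
Proof.
move=> mC; rewrite (_ : tail j C = \bigcap_l \bigcap_(i : 'I_n)
    (if (j <= l < k)%N then (fun w => Y l w ord0 i) @^-1` C l i else setT)).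
  apply: bigcapT_measurable => l; apply: fin_bigcap_measurable => // i _.
  case: ifP => // _; rewrite -[X in measurable X]setTI.
  by apply: mY => //; exact: mC.
apply/seteqP; split=> w /=.
  by move=> h l _ i _; case: ifP => // /h; exact.
by move=> h l jlk i; have := h l I i I; rewrite jlk => hh; exact: hh.
Qed.

(** Joint law of the coordinates of the partial sum and of the later summands. Keeping the latter
    makes the induction work: the next summand is split off the tail and added to the sum. *)
Let claim j := forall (A : 'I_n -> set TR) (C : nat -> 'I_n -> set TR),
  (forall i, measurable (A i)) -> (forall l i, measurable (C l i)) ->
  P ([set w | forall i, A i (S j w ord0 i)] `&` tail j C) =
  (\prod_i normal_prob 0 (tau j) (A i)) *
  \prod_(j <= l < k) \prod_i normal_prob 0 (s l) (C l i).

Let claim1 : (0 < k)%N -> claim 1.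
Proof.
move=> k0 A C mA mC.
pose B (l : nat) : set V := [set x : V | forall i, (if l == 0%N then A else C l) i (rv_coord i x)].
have mB l : measurable (B l).
  by apply: (measurable_box (mcoord R (n:=n))) => i; case: ifP.
rewrite (_ : _ `&` _ = [set w | forall l : 'I_k, B l (Y l w)]); last first.
  apply/seteqP; split=> w /=.
    move=> [SA YC] [l lk] i /=; case: eqVneq => [->|l0].
      by have := SA i; rewrite /S big_ord_recl big_ord0 addr0.
    by apply: YC; rewrite lt0n l0.
  move=> h; split=> [i|l /andP[l0 lk] i].
    by rewrite /S big_ord_recl big_ord0 addr0; exact: (h (Ordinal k0) i).
  by have := h (Ordinal lk) i; rewrite /= gtn_eqF.
have PB l : (l < k)%N -> P (Y l @^-1` B l) =
    \prod_i normal_prob 0 (s l) ((if l == 0%N then A else C l) i).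
  move=> lk; have := gY lk (A := if l == 0%N then A else C l).
  rewrite /pushforward => ->; last by move=> i; case: ifP.
  by apply: eq_bigr => i _; rewrite mxE.
rewrite (indepY (A := fun l : 'I_k => B l) (fun l => mB l)).
rewrite -(big_mkord xpredT (fun l => P (Y l @^-1` B l))).
rewrite big_ltn// PB//; congr (_ * _).
  by apply: eq_bigr => i _; rewrite /tau big_ord1 sqrtr_sqr gtr0_norm// s0.
rewrite big_nat [RHS]big_nat; apply: eq_bigr => l /andP[l0 lk].
by rewrite PB// gtn_eqF.
Qed.

(** With the tail event from j + 1 on absorbed into the measure, the pairs of i-th coordinates of
    [S j] and [Y j] satisfy the product rule on rectangles, hence on Borel sets of the plane. Taking
    the sets of pairs whose sum lies in [A i], the convolution of normal laws concludes. *)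
Let claimS j : (0 < j)%N -> (j < k)%N -> claim j -> claim j.+1.
Proof.
move=> j0 jk cl A C mA mC.
have tau0 : (0 < tau j)%R.
  rewrite sqrtr_gt0 (bigD1 (Ordinal j0))//= ltr_wpDr ?exprn_gt0//.
    by apply: sumr_ge0 => l _; exact: sqr_ge0.
  by apply: s0; exact: ltn_trans jk.
have tauS : tau j.+1 = Num.sqrt (tau j ^+ 2 + s j ^+ 2).
  rewrite /tau big_ord_recr/= sqr_sqrtr//.
  by apply: sumr_ge0 => l _; exact: sqr_ge0.
pose D := tail j.+1 C.
have mD : measurable D by exact: measurable_tail.
pose c := fine (\prod_(j.+1 <= l < k) \prod_i normal_prob 0 (s l) (C l i)).
have cfin : \prod_(j.+1 <= l < k) \prod_i normal_prob 0 (s l) (C l i) \is a fin_num.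
  elim/big_ind : _ => // [x y|l _]; first exact: fin_numM.
  by elim/big_ind : _ => // [x y|i _]; [exact: fin_numM|exact: fin_num_measure].
have c0 : (0 <= c)%R.
  apply: fine_ge0; elim/big_ind : _ => // [x y|l _]; first exact: mule_ge0.
  by elim/big_ind : _ => // x y; exact: mule_ge0.
pose N1 : probability TR R := normal_prob 0 (tau j).
pose N2 : probability TR R := normal_prob 0 (s j).
pose N0 : probability (TR * TR)%type R := N1 \x N2.
pose N : {finite_measure set (TR * TR)%type -> \bar R} := N0.
pose M := [the {finite_measure set Om -> \bar R} of mrestr P mD].
have key := @product_rule_generated _ Om R _ (TR * TR)%type 'I_n (pair_mfun j)
  (fun=> N) M c rectangles (fun=> setT) c0.
have MN : forall E : 'I_n -> set (TR * TR), (forall i, measurable (E i)) ->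
    M [set w | forall i, E i (pair_mfun j i w)] = c%:E * \prod_i N (E i).
  apply: key.
  - exact: measurable_prod_measurableType.
  - exact: setI_rectangles.
  - by move=> _; exists setT => //; exists setT => //; rewrite setXTT.
  - by rewrite bigcup_const//; exists 0%N.
  move=> E RE.
  have [F FE] : {F : 'I_n -> set TR * set TR & forall i,
      [/\ measurable (F i).1, measurable (F i).2 & (F i).1 `*` (F i).2 = E i]}.
    apply: (@choice _ _ (fun i F => [/\ measurable F.1, measurable F.2 & F.1 `*` F.2 = E i])) => i.
    by have [U mU [W mW UW]] := RE i; exists (U, W).
  have mF1 i : measurable (F i).1 by case: (FE i).
  have mF2 i : measurable (F i).2 by case: (FE i).
  (* The second sides of the rectangles become the constraints on [Y j]. *)
  pose C' l := if l == j then (fun i => (F i).2) else C l.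
  have mC' l i : measurable (C' l i) by rewrite /C'; case: ifP.
  have := cl (fun i => (F i).1) C' mF1 mC'.
  rewrite big_ltn// [X in _ * (_ * X)](_ : _ = c%:E); last first.
    rewrite /c fineK//; rewrite big_nat [RHS]big_nat; apply: eq_bigr => l /andP[jl lk].
    by rewrite /C' gtn_eqF.
  have -> : \prod_i normal_prob 0 (s j) (C' j i) = \prod_i normal_prob 0 (s j) (F i).2.
    by rewrite /C' eqxx.
  rewrite muleA -big_split/= muleC => clE.
  have FE3 i : (F i).1 `*` (F i).2 = E i by case: (FE i).
  rewrite [RHS](_ : _ = c%:E * \prod_i (normal_prob 0 (tau j) (F i).1 * normal_prob 0 (s j) (F i).2)).
    rewrite -clE /M /= /mrestr; congr (P _); apply/seteqP; split=> w /=.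
      move=> [EF Dw]; split=> [i|l /andP[jl lk] i].
        by have := EF i; rewrite -FE3; case.
      rewrite /C'; case: eqVneq => [->|lj].
        by have := EF i; rewrite -FE3; case.
      by apply: Dw; rewrite lk andbT ltn_neqAle eq_sym lj.
    move=> [SF YC]; split=> [i|l /andP[jl lk] i].
      rewrite -FE3; split => /=; first exact: SF.
      by have := YC j; rewrite leqnn jk => /(_ isT i); rewrite /C' eqxx.
    by have := YC l; rewrite (ltnW jl) lk => /(_ isT i); rewrite /C' gtn_eqF.
  congr (_ * _); apply: eq_bigr => i _; rewrite -FE3.
  exact: product_measure1E.
have mE i : measurable [set p : TR * TR | A i (p.1 + p.2 : R)%R].
  rewrite -[X in measurable X]setTI.
  have madd : @measurable_fun _ _ (TR * TR)%type TR setT (fun p : TR * TR => (p.1 + p.2 : R)%R).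
    exact: measurable_funD.
  exact: madd.
have := MN (fun i => [set p : TR * TR | A i (p.1 + p.2 : R)%R]) mE.
rewrite (eq_bigr (fun i => normal_prob 0 (tau j.+1) (A i))); last first.
  move=> i _; rewrite tauS; apply: normal_prob_convolution => //.
  exact: s0.
rewrite /c fineK// muleC => <-.
rewrite /M /= /mrestr; congr (P _); apply/seteqP; split=> w /= [h1 h2]; split=> // i.
  by have := h1 i; rewrite /S big_ord_recr/= mxE.
by have := h1 i; rewrite /S [in X in _ -> X]big_ord_recr/= mxE.
Qed.

Lemma sum_gaussian : (0 < k)%N ->
  is_gaussian 0 (Num.sqrt (\sum_(l < k) s l ^+ 2))
    (pushforward P (fun w => \sum_(l < k) Y l w)%R).
Proof.
move=> k0.
have cl j : (0 < j)%N -> (j <= k)%N -> claim j.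
  elim: j => // -[|j] IH _ jk; first exact: claim1.
  by apply: claimS => //; apply: IH => //; exact: ltnW.
move=> A mA; have := cl k k0 (leqnn k) A (fun _ _ => setT) mA (fun _ _ => measurableT).
rewrite big_geq// mule1 /pushforward (_ : tail k _ = setT).
  by rewrite setIT => ->; apply: eq_bigr => i _; rewrite mxE.
by apply/seteqP; split=> // w _ l /andP[/leq_ltn_trans h /h]; rewrite ltnn.
Qed.

End sum_of_gaussians.

(** * Almost sure limits of variables with a common product law *)

Section limit_law.
Local Open Scope ereal_scope.
Context (R : realType) d (Om : measurableType d) (P : probability Om R) (n : nat).
Local Notation TR := (measurableTypeR R).
Variables (U : nat -> 'I_n -> {mfun Om >-> TR}) (X : 'I_n -> {mfun Om >-> TR}).
Variable q : probability TR R.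
Hypothesis UE : forall N (A : 'I_n -> set TR), (forall i, measurable (A i)) ->
  P [set w | forall i, A i (U N i w)] = \prod_i q (A i).
Hypothesis UX : {ae P, forall w, forall i, (fun N => U N i w : R) @ \oo --> (X i w : R)}.

Lemma measure_le_ae (A B : set Om) : measurable A -> measurable B ->
  {ae P, forall w, A w -> B w} -> P A <= P B.
Proof.
move=> mA mB [N [mN PN AB]].
apply: (@le_trans _ _ (P (B `|` N))).
  apply: le_measure; rewrite ?inE//; first exact: measurableU.
  move=> w Aw; apply: contrapT => /not_orP[Bw]; apply; apply: AB => /= h.
  exact/Bw/h.
apply: le_trans (measureU2 P mB mN) _.
by rewrite [X in _ + X](_ : _ = 0) ?adde0.
Qed.

(** Reverse Fatou lemma for events. It is applied to events about [U N], whose probability does not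
    depend on [N], so that laws need not be passed to the limit. *)
Lemma lim_sup_set_ge (F : (set Om)^nat) (c : \bar R) : (forall k, measurable (F k)) ->
  (forall k, c <= P (F k)) -> c <= P (lim_sup_set F).
Proof.
move=> mF cF.
have Foo : P (\bigcup_(k >= 0) F k) < +oo.
  by rewrite ltey_eq fin_num_measure//; exact: bigcup_measurable.
have /cvg_lim <- // := lim_sup_set_cvg P F mF Foo.
apply: lime_ge; first by apply/cvg_ex; eexists; exact: lim_sup_set_cvg P F mF Foo.
near=> N; apply: le_trans (cF N) _; apply: le_measure; rewrite ?inE//.
  exact: bigcup_measurable.
by move=> w Fw; exists N => /=.
Unshelve. all: by end_near. Qed.

(** The margin [a] lets a strict inequality survive the passage to the limit. *)
Let below (a : R) (Y : 'I_n -> {mfun Om >-> TR}) (x : 'I_n -> R) :=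
  [set w | forall i, (Y i w : R) < x i - a]%R.

Let mbelow a Y x : measurable (below a Y x).
Proof.
rewrite (_ : below a Y x = [set w | forall i, `]-oo, (x i - a)%R[%classic (Y i w)]).
  by apply: (@measurable_box _ Om _ TR 'I_n Y (fun i => `]-oo, (x i - a)%R[%classic)) => i; exact: measurable_itv.
by apply/seteqP; split=> w h i; have := h i; rewrite /= in_itv.
Qed.

Let PU N (x : 'I_n -> R) a :
  P (below a (U N) x) = \prod_i q `]-oo, (x i - a)%R[%classic.
Proof.
by rewrite -(UE N).
Qed.

(** Argued on complements: where the limit is below [x], so is [U N] eventually, hence the
    complementary events cannot recur infinitely often. *)
Let upper (x : 'I_n -> R) : P (below 0 X x) <= P (below 0 (U 0) x).
Proof.
have h : 1 - P (below 0 (U 0) x) <= 1 - P (below 0 X x).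
  rewrite -!probability_setC//.
  pose F N := ~` below 0 (U N) x.
  have mF N : measurable (F N) by apply: measurableC; exact: mbelow.
  apply: (@le_trans _ _ (P (lim_sup_set F))).
    apply: lim_sup_set_ge => // N; rewrite !probability_setC//.
    by rewrite !PU.
  apply: measure_le_ae.
  - by apply: bigcapT_measurable => N; apply: bigcup_measurable.
  - by apply: measurableC; exact: mbelow.
  apply: filterS UX => w cv Fw Xw.
  have : \forall N \near \oo, forall i, (U N i w < x i - 0)%R.
    by apply: filter_forall => i; apply: cvgr_lt (cv i) _ _; exact: Xw.
  move=> [N _ hN]; have [m /= Nm] := Fw N I.
  by apply => i; exact: hN.
move: h; rewrite -(@fineK _ (P (below 0 X x))) ?fin_num_measure//.
rewrite -(@fineK _ (P (below 0 (U 0) x))) ?fin_num_measure//.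
by rewrite -!EFinB !lee_fin lerD2l lerN2.
Qed.

(** Where [U N] is below x - a infinitely often, the limit is at most x - a, hence below [x]. *)
Let lower (x : 'I_n -> R) a : (0 < a)%R -> P (below a (U 0) x) <= P (below 0 X x).
Proof.
move=> a0; pose F N := below a (U N) x.
have mF N : measurable (F N) by exact: mbelow.
apply: (@le_trans _ _ (P (lim_sup_set F))).
  by apply: lim_sup_set_ge => // N; rewrite !PU.
apply: measure_le_ae.
- by apply: bigcapT_measurable => N; apply: bigcup_measurable.
- exact: mbelow.
apply: filterS UX => w cv Fw i; rewrite ltNge; apply/negP => xX.
have [N _ hN] : \forall N \near \oo, (x i - a < U N i w)%R.
  apply: cvgr_gt (cv i) _ _; apply: lt_le_trans xX.
  by rewrite subr0 ltrBlDr ltrDl.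
have [m /= Nm Fm] := Fw N I.
by have := lt_trans (hN m Nm) (Fm i); rewrite ltxx.
Qed.

(** The margin is removed by continuity from below along a = 1/(k+1). *)
Let limit_ray (x : 'I_n -> R) : P (below 0 X x) = P (below 0 (U 0) x).
Proof.
apply/eqP; rewrite eq_le upper/=.
pose F k := below k.+1%:R^-1 (U 0) x.
have cF : P (F k) @[k --> \oo] --> P (\bigcup_k F k).
  apply: nondecreasing_cvg_mu.
  - by move=> k; exact: mbelow.
  - by apply: bigcupT_measurable => k; exact: mbelow.
  - move=> k l kl; apply/subsetPset => w Fw i; apply: lt_le_trans (Fw i) _.
    by rewrite lerB// lef_pV2 ?posrE// ler_nat.
have -> : below 0 (U 0) x = \bigcup_k F k.
  apply/seteqP; split=> [w Bw|w [k _ Fw] i]; last first.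
    by rewrite subr0; apply: lt_trans (Fw i) _; rewrite ltrBlDr ltrDl.
  have : \forall k \near \oo, forall i, (U 0 i w < x i - k.+1%:R^-1)%R.
    apply: filter_forall => i.
    have d0 : (0 < x i - U 0 i w)%R by have := Bw i; rewrite subr0 subr_gt0.
    have := near_infty_natSinv_lt (PosNum d0).
    by apply: filterS => k /=; rewrite ltrBrDl ltrBrDr addrC.
  by move=> [k _ hk]; exists k => //; exact: (hk k (leqnn k)).
have /cvg_lim <- // := cF.
apply: lime_le; first by apply/cvg_ex; eexists; exact: cF.
by apply: nearW => k; apply: lower; rewrite invr_gt0.
Qed.

Lemma limit_product_law (A : 'I_n -> set TR) : (forall i, measurable (A i)) ->
  P [set w | forall i, A i (X i w)] = \prod_i q (A i).
Proof.
move=> mA.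
have := @product_rule_generated _ Om R _ TR 'I_n X (fun=> q : {finite_measure set TR -> \bar R}) P 1%R
  (@RGenInftyO.G R) (fun k => `]-oo, k%:R%R[%classic) ler01.
move=> key; rewrite -[RHS]mul1e; apply: key => //.
- exact: RGenInftyO.measurableE.
- move=> _ _ [a ->] [b ->]; exists (Num.min a b).
  apply/seteqP; split=> [x /= []|x /=]; rewrite !in_itv/= lt_min.
    by move=> -> ->.
  by move=> /andP[].
- by move=> k; exists k%:R.
- apply/seteqP; split=> // x _; exists (Num.bound `|x|%R) => //=.
  by rewrite in_itv/=; apply: le_lt_trans (ler_norm _) _; rewrite archi_boundP.
- move=> B /choice[b BE]; rewrite mul1e -(UE 0); last first.
    by move=> i; rewrite BE.
  have := limit_ray b; rewrite /below.
  rewrite (_ : [set w | forall i, _] = [set w | forall i, B i (X i w)]); last first.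
    by apply/seteqP; split=> w h i; have := h i; rewrite BE /= in_itv/= subr0.
  move=> E; rewrite [LHS]E; apply: congr1.
  by apply/seteqP; split=> w h i; have := h i; rewrite BE /= in_itv/= subr0.
Qed.

End limit_law.

(** * Gaussian law of the process at a fixed time *)

Section ou_law.
Context (R : realType).
Local Notation TR := (measurableTypeR R).

Lemma continuous_cst_segment (c : R) : {within `[0, +oo[, continuous (fun _ : R => c)}.
Proof. by apply: continuous_subspaceT => x; exact: cvg_cst. Qed.

(* The constant path 1/2 solves the integral equation driven by [b r = r / 2],
   which turns the sum of squared weights into an instance of the pathwise
   convergence. *)
Lemma ou_weights_sqr (t : R) : 0 < t ->
  (fun N => \sum_(j < N.+1) expR (grid t N j - t) ^+ 2 * (t / N.+1%:R))
    @ \oo --> (1 - expR (- (2 * t))) / 2.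
Proof.
move=> t0; have t20 : 0 < 2 * t by rewrite mulr_gt0.
(* Over the horizon 2 t, the weights are the squares of those over t. *)
have := @ou_riemann_sum R (fun=> 2^-1) id 2^-1 2^-1 (2 * t) t20
  (@continuous_cst_segment _) erefl.
rewrite (_ : (1 - _) / 2 = 2^-1 - expR (- (2 * t)) * 2^-1); last by field.
have zE r : 0 <= r -> 2^-1 = 2^-1 + 2^-1 * id r -
    \int[lebesgue_measure]_(x in `[0, r]) 2^-1 :> R.
  move=> r0; rewrite Rintegral_cst//= lebesgue_measure_itv/= lte_fin.
  by case: ltgtP r0 => //= [r0|<-] _; rewrite ?subr0 ?mulr0 ?addrK ?subr0 ?addr0.
move=> /(_ zE); apply: cvg_trans; apply: near_eq_cvg; near=> N.
apply: eq_bigr => j _; rewrite /= gridS.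
have -> : grid (2 * t) N j - 2 * t = 2%:R * (grid t N j - t) by rewrite /grid; ring.
by rewrite expRM_natl; congr (_ * _); field.
Unshelve. all: by end_near. Qed.

Context d (Om : measurableType d) (P : probability Om R) (n : nat).
Local Notation V := 'rV[R]_n.
Variables (sigma : R) (z0 : V) (B Z : R -> {RV P >-> V}).
Hypotheses (sigma0 : 0 < sigma) (hB : brownian_motion B) (hZ : ou_solution sigma z0 B Z).
Variable t : R.
Hypothesis t0 : 0 < t.

Let c N (j : nat) : R := sigma * expR (grid t N j - t).
Let c0 N j : 0 < c N j. Proof. by rewrite mulr_gt0// expR_gt0. Qed.
Let Yf N (j : nat) (w : Om) : V := c N j *: (B (grid t N j.+1) w - B (grid t N j) w).

Let mB r i : measurable_fun setT (fun w => B r w ord0 i).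
Proof. exact: (measurableT_comp (measurable_coord i) (measurable_funPT (B r))). Qed.

Let mYf N j : measurable_fun setT (Yf N j).
Proof.
apply: measurable_fun_rVP => i.
rewrite (_ : (fun w => _) = fun w => c N j * (B (grid t N j.+1) w ord0 i - B (grid t N j) w ord0 i)).
  by apply: measurable_funM => //; exact: measurable_funB.
by apply/funext => w; rewrite /rv_coord !mxE.
Qed.

Let Y N j : {mfun Om >-> V} := mfun_Sub (mem_set (mYf N j)).

Let s N (j : nat) : R := c N j * Num.sqrt (t / N.+1%:R).

Let s0 N j : 0 < s N j.
Proof. by rewrite mulr_gt0// sqrtr_gt0 divr_gt0. Qed.

(** The [+ 0] gives the preimage the shape expected by [normal_prob_affine]. *)
Let scale_set (a : R) (A : 'I_n -> set TR) : 'I_n -> set TR :=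
  fun i => (fun x : R => a * x + 0) @^-1` A i.

Let Y_gaussian N j : is_gaussian 0 (s N j) (pushforward P (Y N j)).
Proof.
move=> A mA.
have lt : grid t N j < grid t N j.+1.
  by rewrite -subr_gt0 gridS divr_gt0.
have mA' i : measurable (scale_set (c N j) A i).
  exact: (measurable_funPTI (maffine (c N j) 0)).
have := bm_gaussian_increments hB (grid_ge0 t0 N j) lt.
move=> /(_ _ mA'); rewrite /pushforward => E.
transitivity (P ((fun w => B (grid t N j.+1) w - B (grid t N j) w) @^-1`
  [set x : V | forall i, scale_set (c N j) A i (x ord0 i)])).
  congr (P _); apply/seteqP; split=> w h i; have := h i;
    by rewrite /scale_set /= /Yf !mxE addr0.
rewrite E; apply: eq_bigr => i _; rewrite /scale_set gridS mxE normal_prob_affine//.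
  by rewrite mulr0 addr0.
by rewrite sqrtr_gt0 divr_gt0.
Qed.

Let Y_independent N : mutually_independent P (fun j : 'I_N.+1 => Y N j : Om -> V).
Proof.
move=> A mA.
have inc : {homo grid t N : i j / (i < j)%N >-> i < j}.
  by move=> i j ij; rewrite /grid ltr_pM2r ?invr_gt0// ltr_pM2l// ltr_nat.
have := bm_independent_increments hB (k := N.+1) (grid_ge0 t0 N 0) inc.
have msc (j : 'I_N.+1) : measurable_fun setT (fun x : V => c N j *: x).
  apply: measurable_fun_rVP => i.
  rewrite (_ : (fun x => _) = fun x : V => c N j * x ord0 i).
    by apply: measurable_funM => //; exact: measurable_coord.
  by apply/funext => x; rewrite /rv_coord mxE.
have mA' (j : 'I_N.+1) : measurable ((fun x : V => c N j *: x) @^-1` A j).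
  by rewrite -[X in measurable X]setTI; exact: msc.
by move=> /(_ _ mA').
Qed.

Let W N (w : Om) : V := \sum_(j < N.+1) Y N j w.
Let tau N : R := Num.sqrt (\sum_(j < N.+1) s N j ^+ 2).

Let W_gaussian N : is_gaussian 0 (tau N) (pushforward P (W N)).
Proof.
by apply: sum_gaussian.
Qed.

Let u := expR (- (2 * t)).
Let sig : R := sigma * Num.sqrt ((1 - u) / 2).

Let u1 : u < 1. Proof. by rewrite expR_lt1 oppr_lt0 mulr_gt0. Qed.

Let sig0 : 0 < sig.
Proof. by rewrite mulr_gt0// sqrtr_gt0 divr_gt0// subr_gt0. Qed.

Let tau0 N : 0 < tau N.
Proof.
rewrite sqrtr_gt0 big_ord_recl ltr_wpDr ?exprn_gt0//.
by apply: sumr_ge0 => l _; exact: sqr_ge0.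
Qed.

Let tau_cvg : tau @ \oo --> sig.
Proof.
have -> : tau = (fun N => Num.sqrt (sigma ^+ 2 *
    (\sum_(j < N.+1) expR (grid t N j - t) ^+ 2 * (t / N.+1%:R)))).
  apply/funext => N; congr Num.sqrt; rewrite mulr_sumr; apply: eq_bigr => j _.
  by rewrite /s /c !exprMn sqr_sqrtr ?mulrA// divr_ge0// ltW.
have -> : sig = Num.sqrt (sigma ^+ 2 * ((1 - u) / 2)).
  by rewrite sqrtrM ?sqr_ge0// sqrtr_sqr gtr0_norm.
apply: continuous_cvg; first exact: sqrt_continuous.
by apply: cvgZr; exact: ou_weights_sqr.
Qed.

Let W_cvg : {ae P, forall w, forall i,
  (fun N => W N w ord0 i) @ \oo --> Z t w ord0 i - expR (- t) * z0 ord0 i}.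
Proof.
apply: filterS2 (bm_start hB) hZ => w B0 [cZ ZE] i.
have cz : {within `[0, +oo[, continuous (fun r : R => Z r w ord0 i)}.
  apply/subspace_continuousP => r r0; move/subspace_continuousP : cZ => /(_ r r0) h.
  exact: (@cvg_comp _ _ _ (fun r => Z r w) (fun x : V => x ord0 i) _ _ _ h
    (@coord_continuous R 1 n ord0 i (Z r w))).
have := @ou_riemann_sum R _ (fun r => B r w ord0 i) (z0 ord0 i) sigma t t0 cz.
rewrite B0 mxE => /(_ erefl) /(_ (fun r r0 => ZE r r0 i)).
apply: cvg_trans; apply: near_eq_cvg; near=> N.
rewrite /W summxE; apply: eq_bigr => j _.
by rewrite /= /Yf !mxE /c; ring.
Unshelve. all: by end_near. Qed.

Let mU N i : measurable_fun setT (fun w => (tau N)^-1 * W N w ord0 i : TR).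
Proof.
apply: measurable_funM => //.
rewrite (_ : (fun w => _) = fun w => \sum_(j < N.+1) Y N j w ord0 i).
  apply: measurable_sum => j.
  exact: (measurableT_comp (measurable_coord i) (measurable_funPT (Y N j))).
by apply/funext => w; rewrite /W summxE.
Qed.

Let mX i : measurable_fun setT (fun w => sig^-1 * (Z t w ord0 i - expR (- t) * z0 ord0 i) : TR).
Proof.
apply: measurable_funM => //; apply: measurable_funB => //.
exact: (measurableT_comp (measurable_coord i) (measurable_funPT (Z t))).
Qed.

Theorem ou_gaussian : is_gaussian (expR (- t) *: z0) sig (distribution P (Z t)).
Proof.
pose U N i : {mfun Om >-> TR} := @mfun_Sub _ _ Om TR _ (mem_set (@mU N i)).
pose X i : {mfun Om >-> TR} := @mfun_Sub _ _ Om TR _ (mem_set (@mX i)).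
have UE N (A : 'I_n -> set TR) : (forall i, measurable (A i)) ->
    P [set w | forall i, A i (U N i w)] = (\prod_i normal_prob 0 1 (A i))%E.
  move=> mA.
  have mA' i : measurable (scale_set (tau N)^-1 A i).
    exact: (measurable_funPTI (maffine (tau N)^-1 0)).
  have := @W_gaussian N _ mA'; rewrite /pushforward => E.
  transitivity (P (W N @^-1`
      [set x : V | forall i, scale_set (tau N)^-1 A i (x ord0 i)])).
    by congr (P _); apply/seteqP; split=> w h i; have := h i; rewrite /scale_set /= addr0.
  rewrite E; apply: eq_bigr => i _; rewrite /scale_set mxE normal_prob_affine ?invr_gt0//.
  by rewrite mulr0 addr0 mulVf// gt_eqF.
have UX : {ae P, forall w, forall i, (fun N => U N i w : R) @ \oo --> (X i w : R)}.
  apply: filterS W_cvg => w cv i; apply: cvgM; last exact: cv.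
  by apply: cvgV; [rewrite gt_eqF|exact: tau_cvg].
move=> A mA.
have mA' i : measurable ((fun x : R => sig * x + expR (- t) * z0 ord0 i) @^-1` A i).
  exact: (measurable_funPTI (maffine sig (expR (- t) * z0 ord0 i))).
have := limit_product_law UE UX mA'.
rewrite /distribution /pushforward => E.
transitivity (P [set w | forall i, ((fun x : R => sig * x + expR (- t) * z0 ord0 i) @^-1` A i) (X i w)]).
  congr (P _); apply/seteqP; split=> w h i; have := h i;
    by rewrite /= mulrA divff ?gt_eqF// mul1r subrK.
rewrite E; apply: eq_bigr => i _.
apply: etrans (normal_prob_affine _ _ sig0 ltr01 (mA i)) _.
by rewrite mulr0 add0r mulr1 mxE.
Qed.

End ou_law.

(** * Distances between Gaussian laws *)

Section gaussian_affinity.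
Local Open Scope ereal_scope.
Context (R : realType) (n : nat).
Local Notation V := 'rV[R]_n.+1.
Variables (m : V) (u : R) (nu mu : probability V R).
Hypothesis u01 : (0 < u < 1)%R.
Local Notation r := (Num.sqrt (n.+1%:R^-1 : R)).
Local Notation s := (Num.sqrt ((1 - u) / n.+1%:R : R)).
Hypotheses (gnu : is_gaussian m s nu) (gmu : is_gaussian 0 r mu).

Let u0 : (0 < u)%R. Proof. by case/andP: u01. Qed.
Let u1 : (u < 1)%R. Proof. by case/andP: u01. Qed.
Let n0 : (0 < n.+1%:R :> R)%R. Proof. by rewrite ltr0n. Qed.
Let r0 : (0 < r)%R. Proof. by rewrite sqrtr_gt0 invr_gt0. Qed.
Let s0 : (0 < s)%R. Proof. by rewrite sqrtr_gt0 divr_gt0// subr_gt0. Qed.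
Let r2 : (r ^+ 2 = n.+1%:R^-1)%R. Proof. by rewrite sqr_sqrtr// invr_ge0. Qed.
Let s2 : (s ^+ 2 = (1 - u) / n.+1%:R)%R.
Proof. by rewrite sqr_sqrtr// divr_ge0// subr_ge0 ltW. Qed.

Let L := log_density m s r.

Let rs : (r / s = Num.sqrt (1 - u)^-1)%R.
Proof.
rewrite -[LHS]gtr0_norm ?divr_gt0// -sqrtr_sqr; congr Num.sqrt.
rewrite expr_div_n r2 s2; field.
by rewrite !gt_eqF//= subr_gt0.
Qed.

Let lnrs : (ln (r / s) = - 2^-1 * ln (1 - u))%R.
Proof.
have p : (0 < (1 - u)^-1)%R by rewrite invr_gt0 subr_gt0.
rewrite rs -powR12_sqrt ?ltW// ln_powR lnV ?posrE ?subr_gt0//.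
by ring.
Qed.

(** Writing p and q for the densities of N(m_i, s^2) and N(0, r^2), the integrand against Lebesgue
    measure is p^k q^(1-k), a Gaussian of precision k / s^2 + (1 - k) / r^2 up to a factor. In units
    of n + 1 this precision is D / (1 - u), and its positivity is the condition for
    integrability. *)
Let integral_lratio (k : R) i : (0 < k + (1 - k) * (1 - u))%R ->
  \int[normal_prob 0 r]_x (expR (k * lratio m s r i x))%:E =
  (expR (- (k / 2) * ln (1 - u)) *
   Num.sqrt ((1 - u) / (k + (1 - k) * (1 - u))) *
   expR (n.+1%:R * m ord0 i ^+ 2 * (k * (k - 1)) / (2 * (k + (1 - k) * (1 - u)))))%:E.
Proof.
set D := (k + (1 - k) * (1 - u))%R => D0.
have uu : (0 < 1 - u)%R by rewrite subr_gt0.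
have AE : (k * ((2 * s ^+ 2)^-1 - (2 * r ^+ 2)^-1) + (2 * r ^+ 2)^-1 = n.+1%:R * D / (2 * (1 - u)))%R.
  by rewrite r2 s2 /D; field; rewrite !gt_eqF.
have A0 : (0 < k * ((2 * s ^+ 2)^-1 - (2 * r ^+ 2)^-1) + (2 * r ^+ 2)^-1)%R.
  by rewrite AE divr_gt0 ?mulr_gt0.
have := normal_expR_quadratic 0 (k * (m ord0 i / s ^+ 2))
  (k * (ln (r / s) - m ord0 i ^+ 2 / (2 * s ^+ 2))) r0 A0.
rewrite AE => E.
transitivity (\int[normal_prob 0 r]_x (expR (k * (ln (r / s) - m ord0 i ^+ 2 / (2 * s ^+ 2)) +
  k * (m ord0 i / s ^+ 2) * x - k * ((2 * s ^+ 2)^-1 - (2 * r ^+ 2)^-1) * x ^+ 2))%:E).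
  by apply: eq_integral => x _; congr (expR _)%:E; rewrite /lratio; ring.
rewrite E; congr EFin.
have -> : ((r * Num.sqrt (2 * (n.+1%:R * D / (2 * (1 - u)))))^-1 = Num.sqrt ((1 - u) / D))%R.
  rewrite -sqrtrM ?invr_ge0 ?ltW// -sqrtrV ?mulr_ge0 ?invr_ge0 ?divr_ge0 ?mulr_ge0 ?ltW//.
  by congr Num.sqrt; field; rewrite !gt_eqF.
rewrite -[RHS]mulrA [RHS]mulrCA; congr (_ * _)%R; rewrite -expRD; congr expR.
rewrite lnrs s2 r2 mul0r addr0 expr0n/= mul0r subr0.
rewrite /D; field.
by rewrite -/D (gt_eqF D0) (gt_eqF uu)/= nat1r gt_eqF.
Qed.

Let ler_exprn (k : nat) (x y : R) : (0 < k)%N -> (0 <= y)%R -> (x ^+ k <= y ^+ k)%R -> (x <= y)%R.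
Proof.
move=> k0 y0; have [x0|x0 _] := leP 0%R x; first by rewrite ler_pXn2r.
exact: le_trans (ltW x0) y0.
Qed.

Let q : R := (\sum_i m ord0 i ^+ 2)%R.

Let integrable_exp_L k v : \int[mu]_x (expR (k * L x))%:E = v%:E ->
  has_integral mu (fun x => expR (k * L x)) v.
Proof.
apply: has_integral_ge0 => [x|]; first exact: expR_ge0.
exact: measurable_log_density.
Qed.

Lemma gaussian_affinity : exists a,
  [/\ has_integral mu (fun x => expR (2^-1 * L x)) a, (0 < a)%R &
   (a <= expR (- (n.+1%:R * u ^+ 2 + 2 * n.+1%:R * q) / 16))%R].
Proof.
have [u0' u1'] := (u0, u1).
have D0 : (0 < 2^-1 + (1 - 2^-1) * (1 - u))%R by lra.
pose D := (2^-1 + (1 - 2^-1) * (1 - u))%R.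
pose b := (expR (- (2^-1 / 2) * ln (1 - u)) * Num.sqrt ((1 - u) / D))%R.
pose a i := (b * expR (n.+1%:R * m ord0 i ^+ 2 * (2^-1 * (2^-1 - 1)) / (2 * D)))%R.
have b0 : (0 < b)%R by rewrite mulr_gt0 ?expR_gt0// sqrtr_gt0 divr_gt0// subr_gt0.
have uu : (0 < 1 - u)%R by rewrite subr_gt0.
(* [b] is the contribution of the variances. Its fourth power is rational in u: b^4 = 1 - u^2 / (2 -
   u)^2 <= 1 - u^2 / 4 <= exp(- u^2 / 4), whence the 16. *)
have bE : (b <= expR (- u ^+ 2 / 16))%R.
  apply: (@ler_exprn 4) => //.
  rewrite /b exprMn -!expRM_natl (_ : 4%N = 2 * 2)%N// exprM sqr_sqrtr; last first.
    by rewrite divr_ge0 ?ltW.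
  rewrite (_ : (2 * 2)%:R * _ = - ln (1 - u))%R; last by rewrite natrM; field.
  rewrite expRN lnK ?posrE// natrM.
  rewrite [leRHS](_ : _ = expR (- (u ^+ 2 / 4)))%R; last by congr expR; field.
  apply: le_trans (expR_ge1Dx _).
  rewrite (_ : (1 - u)^-1 * _ = 1 - u ^+ 2 / (2 - u) ^+ 2)%R; last first.
    by rewrite /D; field; rewrite !gt_eqF//; lra.
  have d2 : (0 < 2 - u)%R by lra.
  rewrite lerD2l lerN2 ler_pM2l ?exprn_gt0// lef_pV2 ?posrE ?exprn_gt0//.
  by nra.
exists (\prod_i a i)%R; split.
- apply: integrable_exp_L; apply: integral_expR_log_density => // i.
  by rewrite integral_lratio// /a /b.
- by apply: prodr_gt0 => i _; rewrite mulr_gt0// expR_gt0.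
(* The mean contributes the exponent - (n + 1) m_i^2 / (8 D), where D = 1 - u / 2 <= 1. *)
apply: (@le_trans _ _ (\prod_(i < n.+1) expR (- u ^+ 2 / 16 - n.+1%:R * m ord0 i ^+ 2 / 8))%R).
  apply: ler_prod => i _; rewrite /a mulr_ge0 ?expR_ge0 ?(ltW b0)//= expRD.
  apply: ler_pM => //; rewrite ?expR_ge0 ?(ltW b0)//.
  rewrite ler_expR; set w := (n.+1%:R * _ ^+ 2)%R.
  have w0 : (0 <= w)%R by rewrite mulr_ge0 ?sqr_ge0// ltW.
  rewrite ler_pdivrMr; last by rewrite mulr_gt0.
  by rewrite /D; nra.
rewrite -expR_sum ler_expR big_split/= sumr_const card_ord /q.
rewrite sumrN -mulr_suml -mulr_sumr -mulr_natl.
by rewrite le_eqVlt; apply/orP; left; apply/eqP; field.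
Qed.

Lemma gaussian_sqr_density : exists v,
  has_integral mu (fun x => expR (2 * L x)) v /\
  ((u <= 2^-1)%R -> (v <= expR (n.+1%:R * u ^+ 2 + n.+1%:R * q))%R).
Proof.
have [u0' u1'] := (u0, u1).
have D0 : (0 < 2 + (1 - 2) * (1 - u))%R by lra.
pose D := (2 + (1 - 2) * (1 - u))%R.
pose b := (expR (- (2 / 2) * ln (1 - u)) * Num.sqrt ((1 - u) / D))%R.
pose a i := (b * expR (n.+1%:R * m ord0 i ^+ 2 * (2 * (2 - 1)) / (2 * D)))%R.
have b0 : (0 < b)%R by rewrite mulr_gt0 ?expR_gt0// sqrtr_gt0 divr_gt0// subr_gt0.
have uu : (0 < 1 - u)%R by rewrite subr_gt0.
exists (\prod_i a i)%R; split.
  apply: integrable_exp_L; apply: integral_expR_log_density => // i.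
  by rewrite integral_lratio// /a /b.
move=> u2.
(* Here b^2 = 1 / (1 - u^2), which is at most 1 + 2 u^2 <= exp(2 u^2) because u^2 <= 1/4. *)
have bE : (b <= expR (u ^+ 2))%R.
  apply: (@ler_exprn 2) => //.
  rewrite /b exprMn -!expRM_natl sqr_sqrtr; last by rewrite divr_ge0 ?ltW.
  rewrite (_ : 2%:R * (_ * ln _) = - (2%:R * ln (1 - u)))%R; last by field.
  rewrite expRN expRM_natl lnK ?posrE//.
  apply: le_trans (expR_ge1Dx _).
  rewrite (_ : _ * _ = (1 - u ^+ 2)^-1)%R; last first.
    rewrite /D; field; rewrite !gt_eqF//; try lra; nra.
  have d2 : (0 < 1 - u ^+ 2)%R by nra.
  have y4 : (u ^+ 2 <= 4^-1)%R by nra.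
  have y0 := sqr_ge0 u.
  rewrite -div1r ler_pdivrMr//; move: (u ^+ 2)%R y4 y0 => y y4 y0.
  by nra.
apply: (@le_trans _ _ (\prod_(i < n.+1) expR (u ^+ 2 + n.+1%:R * m ord0 i ^+ 2))%R).
  apply: ler_prod => i _; rewrite /a mulr_ge0 ?expR_ge0 ?(ltW b0)//= expRD.
  apply: ler_pM => //; rewrite ?expR_ge0 ?(ltW b0)//.
  rewrite ler_expR; set w := (n.+1%:R * _ ^+ 2)%R.
  have w0 : (0 <= w)%R by rewrite mulr_ge0 ?sqr_ge0// ltW.
  rewrite ler_pdivrMr; last by rewrite mulr_gt0.
  by rewrite /D; nra.
rewrite -expR_sum ler_expR big_split/= sumr_const card_ord /q.
by rewrite -mulr_sumr -[X in (X + _)%R]mulr_natl.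
Qed.

Lemma gaussian_log_density_integrable : exists w, has_integral nu L w.
Proof.
pose A i := (ln (r / s) - m ord0 i ^+ 2 / (2 * s ^+ 2))%R.
pose c := (- ((2 * s ^+ 2)^-1 - (2 * r ^+ 2)^-1))%R.
have h := gaussian_sum_quadratic s0 gnu A (fun i => m ord0 i / s ^+ 2)%R c.
eexists; apply: eq_has_integral h => x.
by apply: eq_bigr => i _; rewrite /lratio /A /c; ring.
Qed.

End gaussian_affinity.

(** * Gradients of quadratic functions *)

Section quadratic_gradient.
Context (R : realType) (n : nat).
Local Notation V := 'rV[R]_n.+1.

Lemma is_derive_coord (x v : V) (i : 'I_n.+1) :
  is_derive x v (fun y : V => y ord0 i : R) (v ord0 i).
Proof.
have cv : (fun h : R => h^-1 *: ((((fun y : V => y ord0 i : R) \o shift x) (h *: v) - x ord0 i) : R))%R @ (0 : R)^'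
    --> v ord0 i.
  apply: cvg_near_cst; near=> h.
  have h0 : h != 0%R by near: h; exact: nbhs_dnbhs_neq.
  by rewrite /= /shift/= !mxE addrK /GRing.scale/= mulrA mulVf// mul1r.
by apply: DeriveDef; [apply/cvg_ex; eexists; exact: cv|exact/cvg_lim].
Unshelve. all: by end_near. Qed.

Variables (A B : 'I_n.+1 -> R) (k : R).
(** The coefficients are arranged as in [lratio], so that [log_density] is an instance by
    conversion. *)
Let L (x : V) : R := (\sum_i (A i + B i * x ord0 i - k * x ord0 i ^+ 2))%R.

Let LE : L = (\sum_i (cst (A i) + B i \*: (fun y : V => y ord0 i : R) -
    k \*: ((fun y : V => y ord0 i : R) ^+ 2)))%R.
Proof.
apply/funext => x; rewrite fct_sumE; apply: eq_bigr => i _.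
by [].
Qed.

Lemma differentiable_quadratic x : differentiable L x.
Proof.
rewrite LE; apply: differentiable_sum => i.
apply: differentiableB.
  apply: differentiableD => //; apply: differentiableZ; exact: differentiable_coord.
apply: differentiableZ; apply: differentiableX; exact: differentiable_coord.
Qed.

Lemma gradient_quadratic x : gradient L x = (\row_i (B i - 2 * k * x ord0 i))%R.
Proof.
apply/rowP => i; rewrite !mxE.
pose v : V := delta_mx ord0 i.
have d j := is_derive_coord x v j.
have h j : is_derive x v (cst (A j) + B j \*: (fun y : V => y ord0 j : R) - k \*: ((fun y : V => y ord0 j : R) ^+ 2))
    (0 + B j *: v ord0 j - k *: ((2%:R * x ord0 j ^+ 1) *: v ord0 j)).
  have z1 : is_derive x v (cst (A j) : V -> R) 0 by exact: is_derive_cst.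
  have z2 := is_deriveZ (B j) (d j).
  have z3 := is_deriveD z1 z2.
  have z4 := @is_deriveX _ _ _ 2 _ _ _ (d j).
  have z5 := is_deriveZ k z4.
  exact: (is_deriveB z3 z5).
rewrite LE (derive_val (is_derive := is_derive_sum h)).
rewrite (bigD1 i)//= big1 => [|j /negbTE ji].
  by rewrite /v !mxE !eqxx /GRing.scale/= ; ring.
by rewrite /v !mxE ji andbF /GRing.scale/=; ring.
Qed.
End quadratic_gradient.

Section gaussian_full_support.
Local Open Scope ereal_scope.
Context (R : realType).
Local Notation TR := (measurableTypeR R).

(** A ball of mass zero would make the positive density vanish almost everywhere on a set of
    positive Lebesgue measure. *)
Lemma normal_prob_ball_gt0 (m s x e : R) : (0 < s)%R -> (0 < e)%R ->
  0 < normal_prob m s (ball x e).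
Proof.
move=> s0 e0; rewrite lt_neqAle measure_ge0 andbT eq_sym; apply/eqP => h.
have mb : measurable (ball x e : set TR) by exact: measurable_ball.
have pos y : (0 < normal_pdf m s y)%R.
  rewrite normal_pdf_expR// mulr_gt0 ?expR_gt0// invr_gt0 mulr_gt0//.
  by rewrite sqrtr_gt0 mulr_gt0// pi_gt0.
have : ae_eq lebesgue_measure (ball x e) (EFin \o normal_pdf m s) (cst 0).
  apply/ae_eq_integral_abs => //.
    by apply: measurable_funTS; exact: measurable_EFin_normal_pdf.
  rewrite -[RHS]h /normal_prob; apply: eq_integral => y _ /=.
  by rewrite ger0_norm// ltW.
case=> N [mN N0 sub].
have : lebesgue_measure (ball x e) <= 0.
  rewrite -[leRHS]N0; apply: le_measure; rewrite ?inE//.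
  apply: subset_trans sub => y By /= /(_ By) /eqP.
  by rewrite eqe gt_eqF.
rewrite (lebesgue_measure_ball _ (ltW e0)).
by rewrite leNgt lte_fin pmulrn_lgt0 ?e0.
Qed.

Context (n : nat).
Local Notation V := 'rV[R]_n.

(** If f and g differ at a point, they differ on a ball around it. For the sup norm this ball is a
    box, whose mass is a product of positive one-dimensional masses. *)
Lemma gaussian_ae_eq_continuous (m : V) s (nu : probability V R) (f g : V -> R) :
  (0 < s)%R -> is_gaussian m s nu -> continuous f -> continuous g ->
  ae_eq nu setT (EFin \o f) (EFin \o g) -> f =1 g.
Proof.
move=> s0 gnu cf cg [N [mN N0 sub]] x; apply/eqP/negP => /negP fgx.
have cd : {for x, continuous (fun y => f y - g y)%R} by exact: (continuousB (cf x) (cg x)).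
have d0 : (f x - g x)%R \in [set y | y != 0%R] by rewrite inE/= subr_eq0.
have : \forall y \near x, (f y - g y)%R != 0%R.
  apply: (cd [set y | y != 0%R]); apply: open_nbhs_nbhs; split; last by move: d0; rewrite inE.
  exact: open_neq.
move=> /nbhs_ballP[e /= e0 xe].
have mb i : measurable (ball (x ord0 i) e : set TR) by exact: measurable_ball.
have := gnu _ mb; apply/eqP; rewrite lt_eqF//.
apply: (@le_lt_trans _ _ 0).
  rewrite -[leRHS]N0; apply: le_measure; rewrite ?inE//.
    by apply: boxes_measurable; exists (fun i => ball (x ord0 i) e : set TR).
  apply: subset_trans sub => y By /= /(_ I) /eqP; rewrite eqe -subr_eq0.
  by apply/negP; apply: xe; split => // i j; rewrite (ord1 i); exact: By.
by apply: (big_ind (fun z : \bar R => 0 < z)) => [|? ? ? ?|i _]; [rewrite lte01|exact: mule_gt0|exact: normal_prob_ball_gt0].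
Qed.

End gaussian_full_support.

Lemma sqr_enorm (R : realType) n (x : 'rV[R]_n) : enorm x ^+ 2 = \sum_i x ord0 i ^+ 2.
Proof. by rewrite /enorm sqr_sqrtr//; apply: sumr_ge0 => i _; exact: sqr_ge0. Qed.

(** * Fisher information between the two Gaussian laws *)

Section gaussian_fisher.
Local Open Scope ereal_scope.
Context (R : realType) (n : nat).
Local Notation V := 'rV[R]_n.+1.
Variables (m : V) (u : R) (nu mu : probability V R).
Hypothesis u01 : (0 < u < 1)%R.
Local Notation r := (Num.sqrt (n.+1%:R^-1 : R)).
Local Notation s := (Num.sqrt ((1 - u) / n.+1%:R : R)).
Hypotheses (gnu : is_gaussian m s nu) (gmu : is_gaussian 0 r mu).

Let u0 : (0 < u)%R. Proof. by case/andP: u01. Qed.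
Let u1 : (u < 1)%R. Proof. by case/andP: u01. Qed.
Let n0 : (0 < n.+1%:R :> R)%R. Proof. by rewrite ltr0n. Qed.
Let r0 : (0 < r)%R. Proof. by rewrite sqrtr_gt0 invr_gt0. Qed.
Let s0 : (0 < s)%R. Proof. by rewrite sqrtr_gt0 divr_gt0// subr_gt0. Qed.
Let r2 : (r ^+ 2 = n.+1%:R^-1)%R. Proof. by rewrite sqr_sqrtr// invr_ge0. Qed.
Let s2 : (s ^+ 2 = (1 - u) / n.+1%:R)%R.
Proof. by rewrite sqr_sqrtr// divr_ge0// subr_ge0 ltW. Qed.

Let L : V -> R := log_density m s r.

Let measurable_L : measurable_fun setT L.
Proof. by apply: continuous_measurable_rV => x; apply: differentiable_continuous; exact: differentiable_quadratic. Qed.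

Let nuE : forall A, measurable A -> nu A = \int[mu]_(x in A) (expR (L x))%:E.
Proof. exact: (gaussian_density s0 r0 gnu gmu). Qed.

Let differentiable_density x : differentiable (expR \o L) x.
Proof.
apply: differentiable_comp; first exact: differentiable_quadratic.
by apply/derivable1_diffP.
Qed.

Let version_unique (h : V -> R) : (forall x, differentiable h x) ->
  ae_eq mu setT (EFin \o h) (density nu mu) -> h = expR \o L.
Proof.
move=> dh hE; apply/funext; apply: (gaussian_ae_eq_continuous r0 gmu).
- by move=> x; exact: differentiable_continuous.
- by move=> x; exact: differentiable_continuous.
- exact: ae_eq_trans hE (density_expR measurable_L nuE).
Qed.

Lemma gaussian_fisher : fisher nu mu =
  (n.+1%:R ^+ 2 * (enorm m ^+ 2 + u ^+ 2 / (1 - u)))%:E.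
Proof.
rewrite /fisher; case: asboolP => [_|]; last by have := dominates_expR measurable_L nuE.
set S := [set _ | _ in _]; set F := (X in _ = X).
suff -> : S = [set F] by rewrite ereal_inf1.
have uu : (0 < 1 - u)%R by rewrite subr_gt0.
have FE : \int[nu]_(x in [set x | (0 < (expR \o L) x)%R])
   (enorm (gradient (fun y => ln ((expR \o L) y)) x) ^+ 2)%:E = F.
  rewrite (_ : [set x | _] = setT); last first.
    by apply/seteqP; split => // x _ /=; rewrite expR_gt0.
  rewrite (_ : (fun y => ln _) = L); last by apply/funext => y /=; rewrite expRK.
  (* The i-th component of the gradient is (n + 1) (m_i - u x_i) / (1 - u), with square c (m_i - u
     x_i)^2. *)
  pose c := (n.+1%:R ^+ 2 / (1 - u) ^+ 2 : R)%R.
  have h := (gaussian_sum_quadratic s0 gnu (fun i => c * m ord0 i ^+ 2)%R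
     (fun i => - 2 * c * u * m ord0 i)%R (c * u ^+ 2)%R).2.
  transitivity (\int[nu]_x (\sum_i (c * m ord0 i ^+ 2 + - 2 * c * u * m ord0 i * x ord0 i + c * u ^+ 2 * x ord0 i ^+ 2))%R%:E).
    apply: eq_integral => x _; congr EFin.
    rewrite sqr_enorm; apply: eq_bigr => i _; rewrite gradient_quadratic mxE r2 s2 /c.
    by field; rewrite !gt_eqF.
  rewrite [LHS]h /F; congr EFin.
  rewrite sqr_enorm.
  rewrite (_ : u ^+ 2 / (1 - u) = \sum_(i < n.+1) (u ^+ 2 / (1 - u) / n.+1%:R))%R; last first.
    rewrite sumr_const card_ord -[RHS]mulr_natl; field.
    by rewrite !gt_eqF.
  rewrite -big_split/= mulr_sumr; apply: eq_bigr => i _; rewrite s2 /c.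
  by field; rewrite !gt_eqF.
apply/seteqP; split => [_ [h [/= dh hE] <-]|_ ->] /=.
  by rewrite (version_unique dh hE) FE.
exists (expR \o L) => //=; split; first exact: differentiable_density.
by apply: ae_eq_sym; exact: (density_expR measurable_L nuE).
Qed.

End gaussian_fisher.

Lemma has_integral_comp d d' (T : measurableType d) (T' : measurableType d') (R : realType)
    (P : probability T R) (Q : probability T' R) (X : {mfun T >-> T'}) (f : T' -> R) v :
  (forall A, measurable A -> P (X @^-1` A) = Q A) ->
  has_integral Q f v -> has_integral P (f \o X) v.
Proof.
move=> PQ [fi fv]; have mf := measurable_int _ fi.
have law A : measurable A -> A `<=` [set: T'] -> Q A = image_measure P X A.
  by move=> mA _; rewrite -PQ.
have iP : P.-integrable setT (EFin \o f \o X).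
  apply/(integrable_image P X mf); apply/integrableP; split => //.
  by rewrite -(eq_measure_integral _ law); case/integrableP : fi.
by split=> //; rewrite -fv (eq_measure_integral _ law) integral_image.
Qed.

(** * Optimal quadratic transport between the two Gaussian laws *)

Section gaussian_wasserstein.
Local Open Scope ereal_scope.
Context (R : realType) (n : nat).
Local Notation V := 'rV[R]_n.
Local Notation TR := (measurableTypeR R).
Variables (m : V) (s r : R) (nu mu : probability V R).
Hypotheses (s0 : (0 < s)%R) (r0 : (0 < r)%R).
Hypotheses (gnu : is_gaussian m s nu) (gmu : is_gaussian 0 r mu).

Let cost (xy : V * V) : R := (enorm (xy.1 - xy.2) ^+ 2)%R.

Let costE xy : cost xy = (\sum_i (rv_coord i xy.1 - rv_coord i xy.2) ^+ 2)%R.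
Proof. by rewrite /cost sqr_enorm; apply: eq_bigr => i _; rewrite !mxE. Qed.

Let measurable_cost : measurable_fun setT cost.
Proof.
rewrite (funext costE); apply: measurable_sum => i; apply: measurable_funX.
apply: measurable_funB.
- exact: (measurableT_comp (measurable_coord i) measurable_fst).
- exact: (measurableT_comp (measurable_coord i) measurable_snd).
Qed.

Let w2 : R := (enorm m ^+ 2 + n%:R * (s - r) ^+ 2)%R.

(* |x - y|^2 is bounded below by a function of x plus a function of y, with
   equality at the optimal map y = (r / s) (x - m). *)
Lemma gaussian_transport_lower pi : is_coupling nu mu pi ->
  w2%:E <= \int[pi]_xy (cost xy)%:E.
Proof.
(* An infinite cost is set aside; otherwise the cost is integrable and the comparison takes place in
   [R]. *)
move=> cpl; have [->|ifin] := eqVneq (\int[pi]_xy (cost xy)%:E) +oo; first by rewrite leey.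
have fin : \int[pi]_xy (cost xy)%:E \is a fin_num.
  rewrite ge0_fin_numE ?ltey// integral_ge0// => x _.
  by rewrite lee_fin sqr_ge0.
have ic : has_integral pi cost (fine (\int[pi]_xy (cost xy)%:E)).
  by apply: has_integral_ge0; rewrite ?fineK// => x; exact: sqr_ge0.
pose a := (r / s)%R.
have a0 : (0 < a)%R by rewrite divr_gt0.
pose pr1 : {mfun (V * V)%type >-> V} := mfun_Sub (mem_set (@measurable_fst _ _ V V)).
pose pr2 : {mfun (V * V)%type >-> V} := mfun_Sub (mem_set (@measurable_snd _ _ V V)).
(* In each coordinate, (x - y)^2 - (a (x - m_i) - y)^2 / a has no cross term x y. Its part in x is
   integrated in [h1], its part in y in [h2]; integrability under the marginals passes to the
   coupling. *)
have h1 : has_integral nu _ _ := gaussian_sum_quadratic s0 gnu (fun i => - a * m ord0 i ^+ 2)%R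
   (fun i => 2 * a * m ord0 i)%R (1 - a)%R.
have h2 : has_integral mu _ _ := gaussian_sum_quadratic r0 gmu (fun i => 0%R) (fun i => - 2 * m ord0 i)%R (1 - a^-1)%R.
have h1' := @has_integral_comp _ _ _ _ _ pi nu pr1 _ _ (fun A mA => (cpl A mA).1) h1.
have h2' := @has_integral_comp _ _ _ _ _ pi mu pr2 _ _ (fun A mA => (cpl A mA).2) h2.
rewrite -(fineK fin) lee_fin.
apply: le_trans (has_integral_le (has_integralD h1' h2') ic _).
  rewrite le_eqVlt; apply/orP; left; apply/eqP; rewrite /w2 sqr_enorm -[RHS]big_split/=.
  rewrite (_ : n%:R * (s - r) ^+ 2 = \sum_(i < n) (s - r) ^+ 2)%R; last by rewrite sumr_const card_ord mulr_natl.
  rewrite -big_split/=.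
  apply: eq_bigr => i _; rewrite mxE /a; field.
  by rewrite !gt_eqF.
move=> -[x y]; rewrite costE/= -big_split/=; apply: ler_sum => i _.
rewrite /rv_coord -subr_ge0.
rewrite [leRHS](_ : _ = (a * (x ord0 i - m ord0 i) - y ord0 i) ^+ 2 / a)%R.
  by rewrite divr_ge0 ?sqr_ge0 ?ltW.
by field; rewrite gt_eqF.
Qed.

Lemma gaussian_transport_upper : exists2 pi, is_coupling nu mu pi &
  \int[pi]_xy (cost xy)%:E = w2%:E.
Proof.
pose a := (r / s)%R.
have a0 : (0 < a)%R by rewrite divr_gt0.
pose psi (x : V) : V := (\row_i (a * rv_coord i x + - (a * m ord0 i)))%R.
have mpsi : measurable_fun setT psi.
  apply: measurable_fun_rVP => i.
  rewrite (_ : (fun t => _) = (fun x => a * rv_coord i x + - (a * m ord0 i))%R); last first.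
    by apply/funext => x; rewrite /psi {1}/rv_coord mxE.
  by apply: measurable_funD => //; apply: measurable_funM => //; exact: measurable_coord.
pose phi (x : V) : (V * V)%type := (x, psi x).
have mphi : measurable_fun setT phi by exact: measurable_fun_pair.
pose X : {mfun V >-> (V * V)%type} := mfun_Sub (mem_set mphi).
pose Y : {mfun V >-> V} := mfun_Sub (mem_set mpsi).
exists (distribution nu X).
  move=> A mA; split=> //.
  rewrite -[LHS]/(image_measure nu Y A).
  have law B : measurable B -> distribution nu Y B = mu B.
    apply: eq_measure_boxes => {}B mB; apply: etrans (esym (gmu mB)).
    have mB' i : measurable ((fun z : R => a * z + - (a * m ord0 i))%R @^-1` B i : set TR).
      exact: (measurable_funPTI (maffine _ _)).
    transitivity (nu [set x | forall i, ((fun z : R => a * z + - (a * m ord0 i))%R @^-1` B i) (x ord0 i)]).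
      by congr (nu _); apply/seteqP; split=> x /= h i; move: (h i);
        rewrite /psi /rv_coord mxE.
    rewrite (gnu mB'); apply: eq_bigr => i _.
    by rewrite normal_prob_affine// mxE subrr /a divfK// gt_eqF.
  exact: law.
have h : has_integral nu _ _ := gaussian_sum_quadratic s0 gnu (fun i => a ^+ 2 * m ord0 i ^+ 2)%R
   (fun i => 2 * (1 - a) * a * m ord0 i)%R ((1 - a) ^+ 2)%R.
rewrite [LHS]ge0_integral_distribution; last 2 first.
- exact/measurable_EFinP.
- by move=> x; rewrite lee_fin sqr_ge0.
transitivity (\int[nu]_x (\sum_i (a ^+ 2 * m ord0 i ^+ 2 +
   2 * (1 - a) * a * m ord0 i * x ord0 i + (1 - a) ^+ 2 * x ord0 i ^+ 2))%R%:E).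
  apply: eq_integral => x _; congr EFin; rewrite /= costE/=; apply: eq_bigr => i _.
  by rewrite /psi /rv_coord mxE; ring.
rewrite [LHS]h.2 /w2; congr EFin.
rewrite sqr_enorm.
rewrite (_ : n%:R * (s - r) ^+ 2 = \sum_(i < n) (s - r) ^+ 2)%R; last by rewrite sumr_const card_ord mulr_natl.
rewrite -big_split/=.
by apply: eq_bigr => i _; rewrite /a; field; rewrite gt_eqF.
Qed.

Lemma gaussian_wasserstein : wasserstein nu mu =
  (Num.sqrt (enorm m ^+ 2 + n%:R * (s - r) ^+ 2))%:E.
Proof.
rewrite /wasserstein; set S := [set _ | _ in _].
suff -> : ereal_inf S = w2%:E.
  rewrite poweR_EFin powR12_sqrt// /w2 addr_ge0 ?sqr_ge0// mulr_ge0 ?sqr_ge0//.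
apply/eqP; rewrite eq_le; apply/andP; split.
  have [pi cpl piE] := gaussian_transport_upper.
  by apply: ereal_inf_lbound; exists pi.
by apply: le_ereal_inf_tmp => _ [pi cpl <-]; exact: gaussian_transport_lower.
Qed.

End gaussian_wasserstein.

(* The distance between the Gaussian laws is governed by
   [dist_scale D n * (|m|^2 + u^2)], through the two functions below. *)
Definition dist_scale (R : realType) (D : distance) (n : nat) : R :=
  if D is Fisher then n%:R ^+ 2 else n%:R.

Definition dist_lower (R : realType) (D : distance) (x : R) : R :=
  match D with
  | TV | Hellinger => 1 - expR (- x / 16)
  | Kullback | Chi2 => x / 8
  | Fisher => x
  end.

Definition dist_upper (R : realType) (D : distance) (x : R) : R :=
  match D with
  | TV | Hellinger => Num.sqrt (expR x - 1)
  | Kullback | Chi2 => expR x - 1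
  | Fisher => 2 * x
  end.

Section dist_lower_upper.
Context (R : realType) (D : distance).
Implicit Types x y : R.

Lemma dist_lower_le : {homo @dist_lower R D : x y / x <= y}.
Proof.
move=> x y xy; case: D => //=; rewrite ?lerD2l ?lerN2 ?ler_expR; lra.
Qed.

Lemma dist_upper_le : {homo @dist_upper R D : x y / x <= y}.
Proof.
move=> x y xy; case: D => /=; rewrite ?ler_wsqrtr// ?lerD2r ?ler_expR// ler_pM2l//.
Qed.

Lemma dist_lower_ge0 x : 0 <= x -> 0 <= dist_lower D x.
Proof. by move=> x0; case: D => //=; rewrite ?subr_ge0 ?expR_le1; lra. Qed.

End dist_lower_upper.

(** * Bounds common to the five distances *)

Section gaussian_dist_bounds.
Context (R : realType) (n : nat).
Local Notation V := 'rV[R]_n.+1.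
Variables (m : V) (u : R) (nu mu : probability V R).
Hypothesis u01 : 0 < u < 1.
Local Notation r := (Num.sqrt (n.+1%:R^-1 : R)).
Local Notation s := (Num.sqrt ((1 - u) / n.+1%:R : R)).
Hypotheses (gnu : is_gaussian m s nu) (gmu : is_gaussian 0 r mu).

Let u0 : 0 < u. Proof. by case/andP: u01. Qed.
Let u1 : u < 1. Proof. by case/andP: u01. Qed.
Let n0 : 0 < n.+1%:R :> R. Proof. by rewrite ltr0n. Qed.
Let r0 : 0 < r. Proof. by rewrite sqrtr_gt0 invr_gt0. Qed.
Let s0 : 0 < s. Proof. by rewrite sqrtr_gt0 divr_gt0// subr_gt0. Qed.

Let L : V -> R := log_density m s r.

Let measurable_L : measurable_fun setT L.
Proof.
apply: continuous_measurable_rV => x; apply: differentiable_continuous.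
exact: differentiable_quadratic.
Qed.

Lemma gaussian_dist_bounds (D : distance) : exists w,
  let x := dist_scale R D n.+1 * (enorm m ^+ 2 + u ^+ 2) in
  [/\ dist D nu mu = w%:E, (w%:E <= dist_max R D)%E, dist_lower D x <= w &
      u <= 2^-1 -> w <= dist_upper D x].
Proof.
have [u0' u1'] := (u0, u1).
have N0 := n0.
have m0 : 0 <= enorm m ^+ 2 := sqr_ge0 _.
have [->|nF] := pselect (D = Fisher).
  eexists; split; rewrite /=; first exact: (gaussian_fisher u01 gnu gmu).
  - by rewrite leey.
  - rewrite ler_pM2l ?exprn_gt0// lerD2l ler_pdivlMr ?subr_gt0//.
    by have := sqr_ge0 u; nra.
  - move=> u2; rewrite mulrCA ler_pM2l ?exprn_gt0// mulrDr lerD//; first by lra.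
    by rewrite ler_pdivrMr ?subr_gt0//; have := sqr_ge0 u; nra.
have nuE : forall A, measurable A -> nu A = (\int[mu]_(x in A) (expR (L x))%:E)%E.
  exact: (gaussian_density s0 r0 gnu gmu).
have [a [ha a0 aE]] := gaussian_affinity m u01 gmu.
have [v [hv vE]] := gaussian_sqr_density m u01 gmu.
have hL := gaussian_log_density_integrable u01 gnu.
have -> : dist_scale R D n.+1 = n.+1%:R by case: D nF.
set x := n.+1%:R * (_ + _).
have ax : a <= expR (- x / 16).
  apply: le_trans aE _; rewrite ler_expR -sqr_enorm /x.
  have : 0 <= n.+1%:R * enorm m ^+ 2 by rewrite mulr_ge0// ltW.
  lra.
have vx : u <= 2^-1 -> v <= expR x.
  by move=> /vE; rewrite -sqr_enorm /x mulrDr addrC.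
have v1 := sqr_tilt_ge1 measurable_L nuE hv.
have a1 := affinity_le1 measurable_L nuE ha.
(* The 8 is the image of the 16 in the affinity bound under - 2 ln. *)
have lna : x / 8 <= - 2 * ln a.
  have : ln a <= - x / 16 by rewrite -[leRHS]expRK ler_ln ?posrE// expR_gt0.
  lra.
have [k [kE [k0 kv ka]]] := kullback_bounds measurable_L nuE ha hv a0 hL.
case: D nF => [_|_|_|_|/(_ erefl)//] /=.
- have [w [-> [aw w1 wv]]] := total_variation_bounds measurable_L nuE ha hv.
  exists w; split=> //; first by lra.
  by move=> /vx ?; apply: le_trans wv _; rewrite ler_wsqrtr// lerD2r.
- exists (Num.sqrt (1 - a)); rewrite (hellingerE measurable_L nuE ha); split=> //.
  + by rewrite lee_fin -[leRHS]sqrtr1 ler_wsqrtr//; lra.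
  + apply: (@le_trans _ _ (1 - a)); first lra.
    rewrite -[leLHS]ger0_norm ?subr_ge0// -sqrtr_sqr ler_wsqrtr//.
    have : 0 <= 1 - a by lra.
    by nra.
  (* The upper bound passes through the Kullback divergence: 1 - a <= - ln a, and - 2 ln a <=
     Kullback <= v - 1. *)
  + move=> /vx ?; rewrite ler_wsqrtr//.
    have : 1 - a <= - ln a.
      have := expR_ge1Dx (ln a); rewrite lnK ?posrE//; lra.
    lra.
- exists k; split => //; first by rewrite leey.
    by lra.
  by move=> /vx; lra.
(* The lower bound is that of Kullback, which is at most v - 1. *)
- exists (v - 1); rewrite (chi2E measurable_L nuE hv); split=> //; first by rewrite leey.
    by lra.
  by move=> /vx; lra.
Qed.

End gaussian_dist_bounds.

(** * Cutoff *)

Lemma sqr_enormZ (R : realType) n (c : R) (x : 'rV[R]_n) :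
  enorm (c *: x) ^+ 2 = c ^+ 2 * enorm x ^+ 2.
Proof.
by rewrite !sqr_enorm mulr_sumr; apply: eq_bigr => i _; rewrite mxE exprMn.
Qed.

Section ou_process.
Context (R : realType) d (Omega : measurableType d) (P : probability Omega R) (n : nat).
Local Notation V := 'rV[R]_n.+1.
Variables (z0 : V) (B Z : R -> {RV P >-> V}) (P0 : probability V R).
Hypotheses (hB : brownian_motion B) (hZ : ou_solution (Num.sqrt (2 / n.+1%:R)) z0 B Z).
Hypothesis hP0 : is_gaussian 0 (Num.sqrt (n.+1%:R^-1)) P0.
Variable t : R.
Hypothesis t0 : 0 < t.
Let u := expR (- (2 * t)).

Let u01 : 0 < u < 1.
Proof. by rewrite expR_gt0 expR_lt1 oppr_lt0 mulr_gt0. Qed.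

Let sqr_decay : expR (- t) ^+ 2 = u.
Proof. by rewrite -expRM_natl /u; congr expR; ring. Qed.

Lemma ou_law : is_gaussian (expR (- t) *: z0) (Num.sqrt ((1 - u) / n.+1%:R))
  (distribution P (Z t)).
Proof.
have n0 : 0 < n.+1%:R :> R by rewrite ltr0n.
have s0 : 0 < Num.sqrt (2 / n.+1%:R) :> R by rewrite sqrtr_gt0 divr_gt0.
have <- : Num.sqrt (2 / n.+1%:R) * Num.sqrt ((1 - u) / 2) = Num.sqrt ((1 - u) / n.+1%:R).
  rewrite -sqrtrM ?divr_ge0 ?ltW//; congr Num.sqrt.
  by field; rewrite gt_eqF.
exact: (@ou_gaussian _ _ _ _ _ _ _ _ _ s0 hB hZ _ t0).
Qed.

Lemma ou_dist_bounds (D : distance) : exists w,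
  let x := dist_scale R D n.+1 * (u * enorm z0 ^+ 2 + u ^+ 2) in
  [/\ dist D (distribution P (Z t)) P0 = w%:E, (w%:E <= dist_max R D)%E,
      dist_lower D x <= w & u <= 2^-1 -> w <= dist_upper D x].
Proof.
by have := gaussian_dist_bounds u01 ou_law hP0 D; rewrite sqr_enormZ sqr_decay.
Qed.

Lemma ou_wasserstein : wasserstein (distribution P (Z t)) P0 =
  (Num.sqrt (u * enorm z0 ^+ 2 + (1 - Num.sqrt (1 - u)) ^+ 2))%:E.
Proof.
have /andP[u0 u1] := u01.
have n0 : 0 < n.+1%:R :> R by rewrite ltr0n.
have s0 : 0 < Num.sqrt ((1 - u) / n.+1%:R) by rewrite sqrtr_gt0 divr_gt0// subr_gt0.
have r0 : 0 < Num.sqrt (n.+1%:R^-1) :> R by rewrite sqrtr_gt0 invr_gt0.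
rewrite (gaussian_wasserstein s0 r0 ou_law hP0) sqr_enormZ sqr_decay.
rewrite sqrtrM ?subr_ge0 ?ltW//; congr (Num.sqrt (_ + _))%:E.
set r := Num.sqrt (_^-1).
have r2 : r ^+ 2 = n.+1%:R^-1 by rewrite sqr_sqrtr// invr_ge0 ltW.
rewrite [LHS](_ : _ = n.+1%:R * r ^+ 2 * (1 - Num.sqrt (1 - u)) ^+ 2); last by ring.
by rewrite r2 divff ?mul1r// gt_eqF.
Qed.

End ou_process.

(** Exponential form of a maximum: it bounds both terms and equals one of them. When a = 0 the value
    -oo of [lne] is absorbed by the maximum, so that [fine] is applied to a finite number. *)
Lemma max_lne_bounds (R : realType) (a b : R) : 0 <= a ->
  let c := fine (maxe (lne a%:E) b%:E) in [/\ a <= expR c, b <= c & c = b \/ a = expR c].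
Proof.
rewrite le_eqVlt => /predU1P[<-|a0] c; rewrite /c {c}.
  by rewrite le0_lneNy// maxNye; split; [exact: expR_ge0| |left].
rewrite lne_EFin// -EFin_max /=; split; rewrite ?le_max ?lexx ?orbT//.
  by rewrite -[leLHS]lnK ?posrE// ler_expR le_max lexx.
by case: leP => _; [left|right; rewrite lnK].
Qed.

(** With K = [dist_scale], both formulas for the cutoff time read c = max(ln(sqrt K |z0|), ln K /
    4); for Fisher, K is the square of the dimension. At u = exp(- 2 c), both K u |z0|^2 and K u^2
    are thus at most 1, with equality for at least one of them. *)
Lemma cutoff_timeP (R : realType) (n : nat) (D : distance) (z0 : 'rV[R]_n.+1) :
  let c := cutoff_time D z0 in let K := dist_scale R D n.+1 in
  [/\ K * enorm z0 ^+ 2 <= expR (2 * c), K <= expR (4 * c) &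
      expR (4 * c) = K \/ expR (2 * c) = K * enorm z0 ^+ 2].
Proof.
set c := cutoff_time D z0; set K := dist_scale R D n.+1 => /=.
have n0 : 0 < n.+1%:R :> R by rewrite ltr0n.
have K0 : 0 < K by rewrite /K; case: (D) => //=; rewrite exprn_gt0.
have a0 : 0 <= Num.sqrt K * enorm z0 by rewrite mulr_ge0// sqrtr_ge0.
have -> : c = fine (maxe (lne (Num.sqrt K * enorm z0)%:E) (4^-1 * ln K)%:E).
  rewrite /c /cutoff_time /K; case: (D) => //=.
  by rewrite sqrtr_sqr (ger0_norm (ltW n0)) lnXn//; congr (fine (maxe _ _%:E)); field.
have [] := max_lne_bounds (4^-1 * ln K) a0.
set e := fine _ => h1 h2 h3.
have a2 : K * enorm z0 ^+ 2 = (Num.sqrt K * enorm z0) ^+ 2.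
  by rewrite exprMn [Num.sqrt K ^+ 2]sqr_sqrtr ?(ltW K0).
split.
- by rewrite a2 expRM_natl ler_pXn2r// nnegrE ?expR_ge0.
- by rewrite -[leLHS]lnK ?posrE// ler_expR; lra.
- case: h3 => [->|h3]; [left|right].
    by rewrite mulrA divff// mul1r lnK.
  by rewrite a2 h3 expRM_natl.
Qed.

(** * Limits of the bounds and growth of the cutoff time *)

Section limits.
Context (R : realType).
Implicit Types (x c : nat -> R) (D : distance).

Let cvgyM c (k : R) : 0 < k -> c @ \oo --> +oo -> (fun n => k * c n) @ \oo --> +oo.
Proof.
move=> k0 /cvgryPge cy; apply/cvgryPge => A.
by apply: filterS (cy (A / k)) => n; rewrite ler_pdivrMr// mulrC.
Qed.

Lemma cvgy_expRN c (k : R) : 0 < k -> c @ \oo --> +oo ->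
  (fun n => expR (- (k * c n))) @ \oo --> (0 : R).
Proof. by move=> k0 cy; exact: cvg_comp (cvgyM k0 cy) (@cvgr_expR R). Qed.

Lemma cvgy_expR c (k : R) : 0 < k -> c @ \oo --> +oo ->
  (fun n => expR (k * c n)) @ \oo --> +oo.
Proof.
move=> k0 cy; apply: (@ger_cvgy _ _ _ _ (fun n => k * c n)); last exact: cvgyM.
by near=> n; have := expR_ge1Dx (k * c n); lra.
Unshelve. all: by end_near. Qed.

Lemma dist_lower_cvg D x : x @ \oo --> +oo ->
  (dist_lower D (x n))%:E @[n --> \oo] --> dist_max R D.
Proof.
move=> xy.
have tv : (1 - expR (- x n / 16))%:E @[n --> \oo] --> 1%E.
  apply: cvg_EFin; first by near=> n.
  rewrite -[X in _ --> X]subr0; apply: cvgB; first exact: cvg_cst.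
  have := @cvgy_expRN x 16^-1; rewrite invr_gt0 => /(_ ltac:(by []) xy).
  by under eq_cvg do rewrite mulrC -mulNr.
have kl : (x n / 8)%:E @[n --> \oo] --> +oo%E.
  apply/cvgeryP; have : 0 < 8^-1 :> R by [].
  by move=> /cvgyM /(_ xy); under eq_cvg do rewrite mulrC.
by case: D => //=; apply/cvgeryP.
Unshelve. all: by end_near. Qed.

Lemma dist_upper_cvg D x : x @ \oo --> (0 : R) ->
  (dist_upper D (x n))%:E @[n --> \oo] --> 0%E.
Proof.
move=> x0; apply: cvg_EFin; first by near=> n.
have e0 : (expR (x n) - 1) @[n --> \oo] --> (0 : R).
  have -> : (0 : R) = expR 0 - 1 by rewrite expR0 subrr.
  apply: cvgB; last exact: cvg_cst.
  exact: (cvg_comp _ _ x0 (@continuous_expR R 0)).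
have s0 : Num.sqrt (expR (x n) - 1) @[n --> \oo] --> (0 : R).
  rewrite -[X in _ --> X](sqrtr0 R).
  exact: (cvg_comp _ _ e0 (@sqrt_continuous R 0)).
case: D => //=; rewrite -[X in _ --> X](mulr0 2).
by apply: cvgM => //; exact: cvg_cst.
Unshelve. all: by end_near. Qed.

(** The bound K <= exp(4 c) alone forces divergence, whatever the starting points. *)
Lemma cutoff_time_cvgy D (z0 : forall n, 'rV[R]_n.+1) :
  cutoff_time D (z0 n) @[n --> \oo] --> +oo.
Proof.
apply/cvgryPge => A; near=> n.
have [_ h _] := cutoff_timeP D (z0 n).
rewrite -(@ler_pM2l _ 4)// -ler_expR; apply: le_trans h.
have : expR (4 * A) <= n%:R by near: n; exact: nbhs_infty_ger.
have n1 : n%:R <= n.+1%:R :> R by rewrite ler_nat.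
have n0 : 1 <= n.+1%:R :> R by rewrite ler1n.
by case: D => /=; nra.
Unshelve. all: by end_near. Qed.

End limits.

Section cutoff_exponents.
Context (R : realType).
Variables (K q c eps : R).
Hypotheses (K0 : 0 <= K) (q0 : 0 <= q) (c0 : 0 <= c) (eps0 : 0 <= eps).

(** The term that equals 1 at the cutoff time suffices: earlier it is exp(4 eps c) for K u^2, or
    exp(2 eps c) for K u q. The weaker exponent is kept. *)
Lemma cutoff_before : expR (4 * c) = K \/ expR (2 * c) = K * q ->
  forall u, u = expR (- (2 * ((1 - eps) * c))) ->
  expR (2 * eps * c) <= K * (u * q + u ^+ 2).
Proof.
move=> KE u uE; have u0 : 0 < u by rewrite uE expR_gt0.
have ec : 0 <= eps * c by rewrite mulr_ge0.
case: KE => KE; [apply: (@le_trans _ _ (K * u ^+ 2))|apply: (@le_trans _ _ (K * q * u))].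
- by rewrite -KE uE -expRM_natl -expRD ler_expR; lra.
- by rewrite ler_wpM2l// lerDr mulr_ge0// ltW.
- by rewrite -KE uE -expRD ler_expR; lra.
- by rewrite mulrDr -mulrA [u * q]mulrC lerDl mulr_ge0// sqr_ge0.
Qed.

(** The two terms are at most exp(- 2 eps c) and exp(- 4 eps c), whence the factor 2. *)
Lemma cutoff_after : K * q <= expR (2 * c) -> K <= expR (4 * c) ->
  forall u, u = expR (- (2 * ((1 + eps) * c))) ->
  K * (u * q + u ^+ 2) <= 2 * expR (- (2 * eps * c)).
Proof.
move=> Kq KE u uE; have u0 : 0 < u by rewrite uE expR_gt0.
have ec : 0 <= eps * c by rewrite mulr_ge0.
rewrite mulrDr mulrCA [2 * expR _](_ : _ = expR (- (2 * eps * c)) + expR (- (2 * eps * c))); last by ring.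
apply: lerD.
- apply: (@le_trans _ _ (u * expR (2 * c))); first by rewrite ler_wpM2l// ltW.
  by rewrite uE -expRD ler_expR; lra.
- apply: (@le_trans _ _ (expR (4 * c) * u ^+ 2)); first by rewrite ler_wpM2r// sqr_ge0.
  by rewrite uE -expRM_natl -expRD ler_expR; lra.
Qed.

End cutoff_exponents.

Section ou_asymptotics.
Context (R : realType) (d : nat -> measure_display)
  (Omega : forall n, measurableType (d n)) (P : forall n, probability (Omega n) R).
Variables (z0 : forall n, 'rV[R]_n.+1)
  (B Z : forall n, R -> {RV (P n) >-> 'rV[R]_n.+1})
  (P0 : forall n, probability 'rV[R]_n.+1 R).
Hypotheses (hB : forall n, brownian_motion (B n))
  (hZ : forall n, ou_solution (Num.sqrt (2 / n.+1%:R)) (z0 n) (B n) (Z n))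
  (hP0 : forall n, is_gaussian 0 (Num.sqrt (n.+1%:R^-1)) (P0 n)).

Let law n t : probability 'rV[R]_n.+1 R := distribution (P n) (Z n t).

Section dist.
Variables (D : distance) (eps : R).
Hypothesis eps01 : 0 < eps < 1.
Let c n := cutoff_time D (z0 n).
Let cy : c @ \oo --> +oo. Proof. exact: cutoff_time_cvgy. Qed.
Let eps0 : 0 < eps. Proof. by case/andP: eps01. Qed.
Let eps1 : eps < 1. Proof. by case/andP: eps01. Qed.
Let near_c_gt0 : \forall n \near \oo, 0 < c n.
Proof. by move/cvgryPgt : cy; exact. Qed.
Let scale_ge0 n : 0 <= dist_scale R D n.
Proof. by rewrite /dist_scale; case: (D) => //; exact: sqr_ge0. Qed.

Lemma ou_dist_before :
  dist D (law n ((1 - eps) * c n)) (P0 n) @[n --> \oo] --> dist_max R D.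
Proof.
have e2 : 0 < 2 * eps by rewrite mulr_gt0.
apply: squeeze_cvge (dist_lower_cvg (cvgy_expR e2 cy)) (cvg_cst (dist_max R D)).
(* The Gaussian description of the law holds at positive times, and c n is positive for large n. *)
near=> n; have c0 : 0 < c n by near: n.
have t0 : 0 < (1 - eps) * c n by rewrite mulr_gt0// subr_gt0.
have [w [-> w1 lw _]] := ou_dist_bounds (@hB n) (@hZ n) (@hP0 n) t0 D.
rewrite w1 andbT lee_fin; apply: le_trans lw; apply: dist_lower_le.
have [_ _ cE] := cutoff_timeP D (z0 n).
by apply: cutoff_before => //; [exact: sqr_ge0|exact: ltW|exact: ltW].
Unshelve. all: by end_near. Qed.

Lemma ou_dist_after :
  dist D (law n ((1 + eps) * c n)) (P0 n) @[n --> \oo] --> 0%E.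
Proof.
have e2 : 0 < 2 * eps by rewrite mulr_gt0.
have x0 : (fun n => 2 * expR (- (2 * eps * c n))) @ \oo --> (0 : R).
  by rewrite -(mulr0 2); apply: cvgM; [exact: cvg_cst|exact: cvgy_expRN].
have uc := dist_upper_cvg D x0.
apply: squeeze_cvge (cvg_cst (0 : \bar R)%E) uc.
near=> n; have c0 : 0 < c n by near: n.
have t0 : 0 < (1 + eps) * c n by rewrite mulr_gt0// addr_gt0.
have [w [-> _ lw wu]] := ou_dist_bounds (@hB n) (@hZ n) (@hP0 n) t0 D.
rewrite !lee_fin; apply/andP; split.
  apply: le_trans lw; apply: dist_lower_ge0; apply: mulr_ge0; first exact: scale_ge0.
  by rewrite addr_ge0 ?sqr_ge0// mulr_ge0 ?expR_ge0 ?sqr_ge0.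
have [h1 h2 _] := cutoff_timeP D (z0 n).
(* The condition u <= 1/2 holds for large n, since u <= exp(- 2 c n) tends to 0. *)
apply: le_trans (wu _) _.
  have : expR (- (2 * c n)) < 2^-1.
    by near: n; apply: (cvgr_lt 0) => //; exact: cvgy_expRN.
  move=> /ltW; apply: le_trans; rewrite ler_expR.
  have : 0 < eps * c n by rewrite mulr_gt0.
  by lra.
apply: dist_upper_le; apply: cutoff_after => //; exact: ltW.
Unshelve. all: by end_near. Qed.

End dist.

Section wasserstein.
Hypothesis zy : enorm (z0 n) @[n --> \oo] --> +oo.
Variable eps : R.
Hypothesis eps01 : 0 < eps < 1.
Let c n := ln (enorm (z0 n)).
Let eps0 : 0 < eps. Proof. by case/andP: eps01. Qed.
Let eps1 : eps < 1. Proof. by case/andP: eps01. Qed.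

Let cy : c @ \oo --> +oo.
Proof.
apply/cvgryPge => A; near=> n.
rewrite -ler_expR lnK ?posrE.
  by near: n; move/cvgryPge : zy; exact.
by near: n; move/cvgryPgt : zy; exact.
Unshelve. all: by end_near. Qed.

Let near_c_gt0 : \forall n \near \oo, 0 < c n.
Proof. by move/cvgryPgt : cy; exact. Qed.

(** [ln] takes the value 0 at 0, so a positive c n excludes a zero starting point. *)
Let enormE n : 0 < c n -> enorm (z0 n) ^+ 2 = expR (2 * c n).
Proof.
move=> c0; rewrite expRM_natl lnK// posrE ltNge; apply/negP => z.
by move: c0; rewrite /c ln0// ltxx.
Qed.

Lemma ou_wasserstein_before :
  wasserstein (law n ((1 - eps) * c n)) (P0 n) @[n --> \oo] --> (+oo : \bar R)%E.
Proof.
have /cvgeryP ey := cvgy_expR eps0 cy.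
apply: gee_cvgy ey; near=> n; have c0 : 0 < c n by near: n.
have t0 : 0 < (1 - eps) * c n by rewrite mulr_gt0// subr_gt0.
rewrite (ou_wasserstein (@hB n) (@hZ n) (@hP0 n) t0) lee_fin enormE//.
rewrite -[leLHS]ger0_norm ?expR_ge0// -sqrtr_sqr ler_wsqrtr//.
rewrite -expRM_natl -expRD.
(* The displacement of the mean is enough: u |z0|^2 = exp(2 eps c). *)
apply: (@le_trans _ _ (expR (- (2 * ((1 - eps) * c n)) + 2 * c n))); last by rewrite lerDl sqr_ge0.
by rewrite ler_expR; lra.
Unshelve. all: by end_near. Qed.

Lemma ou_wasserstein_after :
  wasserstein (law n ((1 + eps) * c n)) (P0 n) @[n --> \oo] --> (0 : \bar R)%E.
Proof.
have e2 : 0 < 2 * eps by rewrite mulr_gt0.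
have x0 : (fun n => Num.sqrt (2 * expR (- (2 * eps * c n)))) @ \oo --> (0 : R).
  have y0 : (fun n => 2 * expR (- (2 * eps * c n))) @ \oo --> (0 : R).
    by rewrite -(mulr0 2); apply: cvgM; [exact: cvg_cst|exact: cvgy_expRN].
  by rewrite -(sqrtr0 R); exact: (cvg_comp _ _ y0 (@sqrt_continuous R 0)).
have uc : (Num.sqrt (2 * expR (- (2 * eps * c n))))%:E @[n --> \oo] --> (0 : \bar R)%E.
  by apply: cvg_EFin => //; near=> n.
apply: squeeze_cvge (cvg_cst (0 : \bar R)%E) uc.
near=> n; have c0 : 0 < c n by near: n.
have t0 : 0 < (1 + eps) * c n by rewrite mulr_gt0// addr_gt0.
rewrite (ou_wasserstein (@hB n) (@hZ n) (@hP0 n) t0) !lee_fin sqrtr_ge0/= enormE//.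
rewrite ler_wsqrtr//; set u := expR _.
have u0 : 0 < u by exact: expR_gt0.
have u1 : u <= 1 by rewrite expR_le1 oppr_le0 ltW// mulr_gt0.
have ec : 0 < eps * c n by rewrite mulr_gt0.
rewrite [leRHS](_ : _ = expR (- (2 * eps * c n)) + expR (- (2 * eps * c n))); last by ring.
apply: lerD; first by rewrite /u -expRD ler_expR; lra.
apply: (@le_trans _ _ u); last by rewrite ler_expR; lra.
(* With w = sqrt(1 - u), (1 - w)^2 <= (1 - w) (1 + w) = u. *)
have w2 : Num.sqrt (1 - u) ^+ 2 = 1 - u by rewrite sqr_sqrtr// subr_ge0.
have := sqrtr_ge0 (1 - u); move: (Num.sqrt _) w2 => w w2 w0.
by nra.
Unshelve. all: by end_near. Qed.

End wasserstein.

Lemma ou_wasserstein_lim (alpha t : R) : enorm (z0 n) @[n --> \oo] --> alpha -> 0 < t ->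
  (wasserstein (law n t) (P0 n) ^+ 2)%E @[n --> \oo]
    --> (alpha ^+ 2 * expR (- (2 * t)) +
         2 * (1 - Num.sqrt (1 - expR (- (2 * t))) - 2^-1 * expR (- (2 * t))))%:E.
Proof.
move=> za t0; pose u := expR (- (2 * t)); rewrite -/u.
have u0 : 0 < u by exact: expR_gt0.
have u1 : u < 1 by rewrite expR_lt1 oppr_lt0 mulr_gt0.
rewrite (_ : (fun n => _) = fun n =>
    (u * enorm (z0 n) ^+ 2 + (1 - Num.sqrt (1 - u)) ^+ 2)%:E); last first.
  apply/funext => n; rewrite (ou_wasserstein (@hB n) (@hZ n) (@hP0 n) t0).
  by rewrite -EFin_expe sqr_sqrtr// addr_ge0 ?sqr_ge0// mulr_ge0 ?sqr_ge0// ltW.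
apply: cvg_EFin; first by near=> n.
rewrite [X in _ --> X](_ : _ = u * alpha ^+ 2 + (1 - Num.sqrt (1 - u)) ^+ 2).
  apply: cvgD; last exact: cvg_cst.
  by apply: cvgM; [exact: cvg_cst|rewrite expr2; exact: cvgM].
by rewrite sqrrB sqr_sqrtr ?subr_ge0 ?ltW//; field.
Unshelve. all: by end_near. Qed.

End ou_asymptotics.

(* The n-th member of each family lives in dimension n.+1. *)
Theorem theorem1p2 (R : realType)
    (d : nat -> measure_display)
    (Omega : forall n, measurableType (d n))
    (P : forall n, probability (Omega n) R)
    (z0 : forall n, 'rV[R]_n.+1)
    (B Z : forall n, R -> {RV (P n) >-> 'rV[R]_n.+1})
    (P0 : forall n, probability 'rV[R]_n.+1 R)
    (hB : forall n, brownian_motion (B n))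
    (hZ : forall n, ou_solution (Num.sqrt (2 / n.+1%:R)) (z0 n) (B n) (Z n))
    (hP0 : forall n, is_gaussian 0 (Num.sqrt (n.+1%:R^-1)) (P0 n)) :
  let law n t : probability 'rV[R]_n.+1 R := distribution (P n) (Z n t) in
  (forall (D : distance) (eps : R), 0 < eps < 1 ->
     (dist D (law n ((1 - eps) * cutoff_time D (z0 n))) (P0 n) @[n --> \oo]
        --> dist_max R D) /\
     (dist D (law n ((1 + eps) * cutoff_time D (z0 n))) (P0 n) @[n --> \oo]
        --> (0 : \bar R)%E)) /\
  ((enorm (z0 n) @[n --> \oo] --> +oo) ->
     forall eps : R, 0 < eps < 1 ->
     (wasserstein (law n ((1 - eps) * ln (enorm (z0 n)))) (P0 n) @[n --> \oo]
        --> (+oo : \bar R)%E) /\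
     (wasserstein (law n ((1 + eps) * ln (enorm (z0 n)))) (P0 n) @[n --> \oo]
        --> (0 : \bar R)%E)) /\
  (forall alpha : R, 0 <= alpha -> enorm (z0 n) @[n --> \oo] --> alpha ->
     forall t : R, 0 < t ->
     (wasserstein (law n t) (P0 n) ^+ 2)%E @[n --> \oo]
        --> (alpha ^+ 2 * expR (- (2 * t)) +
             2 * (1 - Num.sqrt (1 - expR (- (2 * t)))
                  - 2^-1 * expR (- (2 * t))))%:E).
Proof.
move=> law; split; [|split].
- move=> D eps eps01; split.
    exact: (@ou_dist_before _ _ _ _ _ _ _ _ hB hZ hP0).
  exact: (@ou_dist_after _ _ _ _ _ _ _ _ hB hZ hP0).
- move=> zy eps eps01; split.
    exact: (@ou_wasserstein_before _ _ _ _ _ _ _ _ hB hZ hP0).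
  exact: (@ou_wasserstein_after _ _ _ _ _ _ _ _ hB hZ hP0).
- by move=> alpha _ za t t0; exact: (@ou_wasserstein_lim _ _ _ _ _ _ _ _ hB hZ hP0).
Qed.
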